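(* Let $\mathtt b\ge2$ be an integer and $\mu$ a probability measure on $\mathbb N$ with $\sum_kk\mu(k)=1$. Let $\boldsymbol\tau^*=(\tau^*,\varrho)$ be an IPGW$^+(\mu)$-tree, let $\mathbf o=(U_k)_{k\le0}$ be i.i.d. uniform on $\{1,\dots,\mathtt b\}$ (viewed as an element of $\mathbb W^*_{\mathtt b}$ of height $0$), independent of $\boldsymbol\tau^*$, and, conditionally given $\boldsymbol\tau^*$ and $\mathbf o$, let $\boldsymbol\Theta=(\tau^*,\varrho;(X_v)_{v\in\tau^*})$ be the branching random walk on $\mathbb W^*_{\mathtt b}$ with kernel $p_{\mathtt b}$ indexed by $\tau^*$ with $X_\varrho=\mathbf o$. Then: (1) $\mathtt{scc}^+(\boldsymbol\Theta)$ has the same law as $\boldsymbol\Theta$; (2) letting $(v_n)_{n\ge0}$ enumerate in increasing lexicographical order the vertices $v$ of $\tau^*$ with $\varrho\le v$ (so $v_0=\varrho$), almost surely $$\tfrac1n\#\{X_{v_k};1\le k\le n\}\xrightarrow[n\to\infty]{}c_{\mu,\mathtt b}:=\mathbf P\big(\mathbf o\notin\{X_{v_n};n\ge1\}\big);$$ (3) if moreover $\sum_{k\ge1}k(\log k)^{1+\beta}\mu(k)<\infty$ for some $\beta\in(1,\infty)$, then $c_{\mu,\mathtt b}>0$.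
   Context: $\mathbb W^*_{\mathtt b}$: set of sequences $x=(a_k)_{k\le m}$, $m\in\mathbb Z$, $a_k\in\{1,\dots,\mathtt b\}$; $|x|=m$ is its height; its parent is $\overleftarrow x=(a_k)_{k\le m-1}$ and $x\ast(i)=(a_1',\dots)$ is the sequence $(a_k)_{k\le m}$ extended by $a_{m+1}=i$. Kernel $p_{\mathtt b}(x,\cdot)$: go to $\overleftarrow x$ w.p. $1/2$, to each $x\ast(i)$ w.p. $1/(2\mathtt b)$. Shift: $\varphi_l((a_k)_{k\le m})=(a_{k+l})_{k\le m-l}$. Pointed trees with infinite line of ancestors: a countable tree $t$ in which every vertex has a parent and finitely many children, the children being linearly ordered, and any two vertices have a most recent common ancestor; with a distinguished vertex $\varrho$. Lexicographical order on $t$: $u<v$ if $u$ is a strict ancestor of $v$, or if, letting $w$ be their most recent common ancestor and $u',v'$ the children of $w$ that are ancestors-or-equal of $u,v$, $u'$ precedes $v'$. Labelled pointed trees $(t,\varrho;(x_v))$ are identified up to bijections preserving parent relation, child order, distinguished vertex and labels. IPGW$^+(\mu)$: $\varrho$ has ancestors $\varrho(p)$, $p\ge1$ ($\varrho(p+1)$ parent of $\varrho(p)$, $\varrho(0)=\varrho$); for each $p\ge1$, $\varrho(p)$ has $k$ children with probability $\bar\mu(k)=\sum_{l\ge k}\mu(l)$, $k\ge1$, and $\varrho(p-1)$ is its first child; these numbers are independent; the subtree of descendants of $\varrho$ and the subtrees of descendants of the other children of the $\varrho(p)$ are independent Galton–Watson($\mu$) trees. Branching random walk indexed by $(t,\varrho)$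 started at $o$: $X_\varrho=o$ and for every finite connected subset containing $\varrho$ the labels have joint law $\delta_o\prod_{v\neq\varrho}p_{\mathtt b}(x_{v'},dx_v)$, where $v'$ is the neighbour of $v$ on the path from $v$ to $\varrho$. Right-successor: for a labelled pointed tree $\Theta=(t,\varrho;(x_v))$, let $\varrho'$ be the smallest vertex strictly larger than $\varrho$ in lexicographical order; relabel $x'_v=\varphi_{|x_{\varrho'}|}(x_v)$; restrict to the set of ancestors of $\varrho'$ together with all vertices $v\ge\varrho'$, with induced parent relation and child order. The result, pointed at $\varrho'$, is $\mathtt{scc}^+(\Theta)$. *)

(* Defs.v *)
From HB Require Import structures.
From mathcomp Require Import all_boot all_order all_algebra.
From mathcomp Require Import all_classical all_reals all_analysis.

Set Implicit Arguments.
Unset Strict Implicit.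
Unset Printing Implicit Defensive.

Import Order.TTheory GRing.Theory Num.Theory.
Local Open Scope classical_set_scope.
Local Open Scope ring_scope.

(* The space W*_b.  A sequence x = (a_k)_{k <= m} is encoded as the pair
   (m, f) with f j = a_{m-j}  (j = 0 is the top digit a_m).  Digits are
   natural numbers (a.s. in {1,...,b}).                                     *)
Definition W := (int * (nat -> nat))%type.

Definition parentW (x : W) : W := (x.1 - 1, fun j => x.2 j.+1).
Definition childW (i : nat) (x : W) : W :=
  (x.1 + 1, fun j => if j is j'.+1 then x.2 j' else i).
Definition stepW (s : nat) (x : W) : W :=
  if s is 0 then parentW x else childW s x.
Definition shiftW (l : int) (x : W) : W := (x.1 - l, x.2).

(* Labelled pointed trees whose ancestor line is always the FIRST child
   (this is the case for IPGW^+ trees and is preserved by scc^+).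
   Vertices are encoded by pairs (p, w): w is an Ulam word (children numbered
   0,1,2,... in their order) below the ancestor rho(p) (rho(0) = rho); the
   pair (p.+1, 0 :: w) denotes the same vertex as (p, w).  A labelled tree is
   encoded by th : Theta, th p w = Some x iff (p,w) is a vertex with label x,
   and None otherwise.  This encoding is a complete invariant of the
   isomorphism class of such labelled pointed trees.                         *)
Definition Theta := nat -> seq nat -> option W.

(* The cylinder sigma-algebra on Theta: generated by the (discrete) coordinate
   observables "presence, height and j-th digit of the label of (p,w)". *)
Definition cyl_gen : set (set Theta) :=
  [set A | exists (p : nat) (w : seq nat) (j : nat) (v : option (int * nat)),
      A = [set th | omap (fun x : W => (x.1, x.2 j)) (th p w) = v]].

(* Primitive randomness.
   PN p w : offspring numbers (law mu) used for Galton-Watson subtrees;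
   PK p   : number of children of rho(p.+1) (law mubar on {1,2,...});
   PU j   : the digit U_{-j} of o (uniform on {1..b});
   PX p w : the kernel step (law: 0 w.p. 1/2, i in {1..b} w.p. 1/(2b))
            used for the label of vertex (p,w) from its neighbour towards rho. *)
Inductive prim := PN of nat & seq nat | PK of nat | PU of nat | PX of nat & seq nat.

(* membership of the word w (read after the prefix pre) in the plane tree
   whose vertex u has n u children *)
Fixpoint inGW (n : seq nat -> nat) (pre : seq nat) (w : seq nat) : bool :=
  if w is i :: w' then (i < n pre)%N && inGW n (rcons pre i) w' else true.

Fixpoint walk (xi : seq nat -> nat) (pre : seq nat) (x : W) (w : seq nat) : W :=
  if w is i :: w' then walk xi (rcons pre i) (stepW (xi (rcons pre i)) x) w'
  else x.

Section Construction.
Variables (Omega : Type) (Y : prim -> Omega -> nat) (om : Omega).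

Definition origin : W := (0%R, fun j => Y (PU j) om).

Fixpoint anc (p : nat) : W :=
  if p is p'.+1 then stepW (Y (PX p [::]) om) (anc p') else origin.

Fixpoint brw (p : nat) (w : seq nat) : option W :=
  match p with
  | 0 => if inGW (fun u => Y (PN 0 u) om) [::] w
         then Some (walk (fun u => Y (PX 0 u) om) [::] origin w) else None
  | p'.+1 =>
      match w with
      | [::] => Some (anc p)
      | 0 :: w' => brw p' w'
      | i :: w' =>
          if (i < Y (PK p') om)%N && inGW (fun u => Y (PN p u) om) [:: i] w'
          then Some (walk (fun u => Y (PX p u) om) [::] (anc p) w) else None
      end
  end.
End Construction.

Definition hgt (t : option W) : int := if t is Some x then x.1 else 0.

(* case 1: rho has a child; rho' = its first child (0,[::0]) *)
Definition scc_child (th : Theta) : Theta :=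
  let h := hgt (th 0%N [:: 0%N]) in
  fun p w => if p is p'.+1 then omap (shiftW h) (th p' w)
             else omap (shiftW h) (th 0%N (0%N :: w)).

(* case 2: rho is a leaf; rho' = (q, [::1]) with q >= 1 minimal such that
   rho(q) has a second child.  Ancestors rho(0..q-1) and the subtree of
   rho(q-1) are removed; the remaining children of rho(q) are renumbered. *)
Fixpoint scc_leaf (th : Theta) (q : nat) (h : int) (p : nat) (w : seq nat)
  : option W :=
  match p with
  | 0 => omap (shiftW h) (th q (1%N :: w))
  | 1 => match w with
         | [::] => omap (shiftW h) (th q [::])
         | i :: w' => omap (shiftW h) (th q (i.+1 :: w'))
         end
  | (p'.+1 as pp).+1 =>
      match w with
      | [::] => omap (shiftW h) (th (q + pp)%N [::])
      | 0 :: w' => scc_leaf th q h pp w'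
      | i :: w' => omap (shiftW h) (th (q + pp)%N w)
      end
  end.

Definition scc (th : Theta) : Theta :=
  if th 0%N [:: 0%N] is Some _ then scc_child th
  else match pselect (exists q, (0 < q)%N && isSome (th q [:: 1%N])) with
       | left H =>
           let q := ex_minn H in scc_leaf th q (hgt (th q [:: 1%N]))
       | right _ => th  (* no vertex after rho: scc^+ undefined *)
       end.

Fixpoint nextw_rev (th : Theta) (p : nat) (rw : seq nat) : option (seq nat) :=
  if rw is i :: ru then
    let cand := rcons (rev ru) i.+1 in
    if isSome (th p cand) then Some cand else nextw_rev th p ru
  else None.

Definition lex_succ (th : Theta) (v : nat * seq nat) : nat * seq nat :=
  let: (p, w) := v in
  if isSome (th p (rcons w 0%N)) then (p, rcons w 0%N)
  else match nextw_rev th p (rev w) with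
       | Some w' => (p, w')
       | None =>
         match pselect (exists q, (p < q)%N && isSome (th q [:: 1%N])) with
         | left H => (ex_minn H, [:: 1%N])
         | right _ => (p, w)  (* no further vertex *)
         end
       end.

Definition lex_vertex (th : Theta) (n : nat) : nat * seq nat :=
  iter n (lex_succ th) (0%N, [::]).

Definition lex_label (th : Theta) (n : nat) : option W :=
  th (lex_vertex th n).1 (lex_vertex th n).2.

(* #{ f k ; 1 <= k <= n } : number of first occurrences *)
Definition ndistinct (T : Type) (f : nat -> T) (n : nat) : nat :=
  (\sum_(1 <= k < n.+1) `[< forall j, (1 <= j < k)%N -> f j <> f k >])%N.

Section Prob.
Context (R : realType) (d : measure_display) (Omega : measurableType d)
        (P : probability Omega R).

Definition mutually_independent (I : Type) (Z : I -> Omega -> nat) :=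
  forall (n : nat) (idx : 'I_n -> I) (v : 'I_n -> nat), injective idx ->
    P [set om | forall k : 'I_n, Z (idx k) om = v k] =
    ((\prod_(k < n) fine (P [set om | Z (idx k) om = v k]))%:E)%E.

Definition same_law (X1 X2 : Omega -> Theta) :=
  forall A : set Theta, <<s cyl_gen >> A -> P (X1 @^-1` A) = P (X2 @^-1` A).
End Prob.

(* Main.v *)
(** A kernel step and the digits of the label from which it is taken can be
    recovered from the reverse step and the digits of the new label, and this
    exchange preserves their joint law.  Performing it along the path from the
    distinguished vertex to its successor, and then renaming the vertices, gives
    a measure-preserving map on the primitive randomness which covers the
    right-successor: this is (1).

    For (2), the number of distinct labels among the first [n] is compared with the
    number of times from which the current label is not met again (ever, or within
    [m] steps).  The stationary frequencies of such times are bounded by the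
    Katznelson-Weiss tiling argument, which only needs that the events where the upper
    frequency is at least [lam] have probability 0 or 1.  These events depend on
    the tree seen from a far ancestor and on its label; the height of the label
    along the ancestral line is a recurrent walk, so that this label forgets every
    finite part of the primitive randomness.  When [mu 0 = 0], the only vertices
    explored are those of an infinite ray of first children, which then plays the
    role of the ancestral line.

    For (3), a critical branching walk started below the [k]-th, but not below the
    [k-1]-th, ancestor of the origin hits the origin with probability at most
    [b^-k].  Between the generations [4^k] and [4^(k+1)] the ancestral line has
    reached the [2j]-th ancestor of the origin up to probability [6 j 2^-k], and its
    vertices have at most [2^j] children up to probability [O(4^k j^-a)], where
    [a = 1 + beta].  As [a > 2], some [j] of order [theta^k] with [theta < 2] and
    [theta^a > 4] makes all these bounds summable; conditioning finitely many
    ancestors to have a single child then makes the sum small. *)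

Require Import Defs.
From HB Require Import structures.
From mathcomp Require Import all_boot all_order all_algebra.
From mathcomp Require Import all_classical all_reals all_analysis.
From mathcomp Require Import measurable_realfun lra ring zify.
Set Implicit Arguments.
Unset Strict Implicit.
Unset Printing Implicit Defensive.
Import Order.TTheory GRing.Theory Num.Theory.
Import numFieldNormedType.Exports.
Local Open Scope classical_set_scope.
Local Open Scope ring_scope.

(** The exchange preserves the joint law by detailed balance: a step to the parent together with the
    uniform digit that it removes weighs [1/2 * 1/b], as much as a step to one given child. The
    removed digit is stored as a step, and [0] means the parent, so digits have to be positive,
    which holds almost surely. Conditional probabilities never appear. A branching estimate bounds
    the probability of [C] and [A] together by a constant times that of [C], for every event [C]
    that does not change when the coordinates still to be explored are modified ([insens]); such a
    [C] is carried through the inductions. Both halves of (2) are upper bounds on a frequency, that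
    of the escapes and that of the returns, so the ergodic theorem is needed in one direction only.
    In (3) the weight [b^-k] is harmonic for the class of the current label, and mean offspring 1
    makes a union bound over the children free of loss. *)

Definition prim_code (i : prim) : (nat * seq nat) + nat + nat + (nat * seq nat) :=
  match i with
  | PN p w => inl (inl (inl (p, w)))
  | PK p => inl (inl (inr p))
  | PU j => inl (inr j)
  | PX p w => inr (p, w)
  end.
Definition prim_decode (c : (nat * seq nat) + nat + nat + (nat * seq nat)) :=
  match c with
  | inl (inl (inl u)) => PN u.1 u.2
  | inl (inl (inr p)) => PK p
  | inl (inr j) => PU j
  | inr u => PX u.1 u.2
  end.
Lemma prim_codeK : cancel prim_code prim_decode. Proof. by case. Qed.
HB.instance Definition _ := Countable.copy prim (can_type prim_codeK).

(** * The coordinate space *)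

Definition V := prim -> nat.
HB.instance Definition _ := Pointed.on V.
Definition coord_gen : set (set V) :=
  [set A | exists i k, A = [set y | y i = k]].
Notation VT := (g_sigma_algebraType coord_gen).

Definition upd (y : V) (i : prim) (k : nat) : V :=
  fun j => if j == i then k else y j.

Lemma upd_eq y i k : upd y i k i = k. Proof. by rewrite /upd eqxx. Qed.
Lemma upd_neq y i k j : j != i -> upd y i k j = y j.
Proof. by rewrite /upd => /negbTE->. Qed.

(** * Measurability of countably valued maps and of countable formulas *)

Section DiscreteMeasurability.
Context {d : measure_display} {Omega : measurableType d}.

(** Only fibres are required to be measurable, so that [T] carries no sigma-algebra; for countable
    [T] this is ordinary measurability. *)
Definition dmeas (T : Type) (f : Omega -> T) :=
  forall t, measurable [set y | f y = t].

Lemma meas_not (A : Omega -> Prop) :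
  measurable [set y | A y] -> measurable [set y | ~ A y].
Proof. exact: measurableC. Qed.

Lemma meas_and (A B : Omega -> Prop) : measurable [set y | A y] ->
  measurable [set y | B y] -> measurable [set y | A y /\ B y].
Proof. exact: measurableI. Qed.

Lemma meas_or (A B : Omega -> Prop) : measurable [set y | A y] ->
  measurable [set y | B y] -> measurable [set y | A y \/ B y].
Proof. exact: measurableU. Qed.

Lemma meas_const (A : Prop) : measurable [set y : Omega | A].
Proof.
case: (pselect A) => hA.
  by rewrite (_ : [set _ | _] = setT)//; apply/seteqP; split.
by rewrite (_ : [set _ | _] = set0)//; apply/seteqP; split.
Qed.

Lemma meas_imply (A B : Omega -> Prop) : measurable [set y | A y] ->
  measurable [set y | B y] -> measurable [set y | A y -> B y].
Proof.
move=> mA mB; rewrite (_ : [set _ | _] = [set y | ~ A y \/ B y]).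
  by apply: meas_or => //; exact: meas_not.
apply/seteqP; split => y /=; last by case.
by move=> h; case: (pselect (A y)) => [/h|]; [right|left].
Qed.

Lemma meas_exists (S : countType) (A : S -> Omega -> Prop) :
  (forall s, measurable [set y | A s y]) -> measurable [set y | exists s, A s y].
Proof.
move=> mA; rewrite (_ : [set _ | _] = \bigcup_s [set y | A s y]).
  by apply: countable_bigcupT_measurable.
by apply/seteqP; split => y /= [s]; exists s.
Qed.

Lemma meas_forall (S : countType) (A : S -> Omega -> Prop) :
  (forall s, measurable [set y | A s y]) -> measurable [set y | forall s, A s y].
Proof.
move=> mA; rewrite (_ : [set _ | _] = [set y | ~ exists s, ~ A s y]).
  apply: meas_not; apply: meas_exists => s; exact: meas_not.
apply/seteqP; split => y /=; first by move=> h [s]; apply; exact: h.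
by move=> h s; apply: contrapT => h'; apply: h; exists s.
Qed.

Lemma dmeas_cst (T : Type) (t : T) : dmeas (fun=> t).
Proof. by move=> t'; exact: meas_const. Qed.

(** Splitting on the countably many values of [f] handles a choice that depends on earlier ones;
    recursive explorations are shown measurable in this way. *)
Lemma dmeas_bind (S : countType) (T : Type) (f : Omega -> S) (g : S -> Omega -> T) :
  dmeas f -> (forall s, dmeas (g s)) -> dmeas (fun y => g (f y) y).
Proof.
move=> mf mg t.
rewrite (_ : [set _ | _] = [set y | exists s, f y = s /\ g s y = t]).
  apply: meas_exists => s; apply: meas_and; [exact: mf|exact: mg].
apply/seteqP; split => y /=; first by exists (f y).
by move=> [s [<-]].
Qed.

Lemma dmeas_comp (S : countType) (T : Type) (f : Omega -> S) (h : S -> T) :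
  dmeas f -> dmeas (fun y => h (f y)).
Proof. by move=> mf; apply: (@dmeas_bind _ _ f (fun s _ => h s)) => // s; exact: dmeas_cst. Qed.

Lemma dmeas_comp2 (S1 S2 : countType) (T : Type) (f : Omega -> S1) (g : Omega -> S2)
    (h : S1 -> S2 -> T) :
  dmeas f -> dmeas g -> dmeas (fun y => h (f y) (g y)).
Proof.
move=> mf mg.
apply: (@dmeas_bind _ _ f (fun s y => h s (g y))) => // s; exact: dmeas_comp.
Qed.

Lemma dmeas_pred (S : countType) (f : Omega -> S) (A : S -> Prop) :
  dmeas f -> measurable [set y | A (f y)].
Proof.
move=> mf; rewrite (_ : [set _ | _] = [set y | exists s, A s /\ f y = s]).
  by apply: meas_exists => s; apply: meas_and => //; exact: meas_const.
by apply/seteqP; split => y /=; [exists (f y)|case=> s [? ->]].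
Qed.

Lemma dmeas_if (T : Type) (c : Omega -> bool) (f g : Omega -> T) :
  dmeas c -> dmeas f -> dmeas g -> dmeas (fun y => if c y then f y else g y).
Proof.
move=> mc mf mg.
by apply: (@dmeas_bind _ _ c (fun b y => if b then f y else g y)) => // -[].
Qed.

Lemma dmeas_eq (S : countType) (f g : Omega -> S) :
  dmeas f -> dmeas g -> measurable [set y | f y = g y].
Proof.
move=> mf mg; rewrite (_ : [set _ | _] = [set y | (f y == g y) = true]).
  exact: (dmeas_comp2 (fun a b => a == b)).
by apply/seteqP; split => y /= /eqP.
Qed.

Lemma dmeas_asbool (A : Omega -> Prop) :
  measurable [set y | A y] -> dmeas (fun y => `[< A y >]).
Proof.
move=> mA [].
  by rewrite (_ : [set _ | _] = [set y | A y])//; apply/seteqP; split => y /= /asboolP.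
rewrite (_ : [set _ | _] = [set y | ~ A y]); first exact: meas_not.
by apply/seteqP; split => y /=; [move/asboolPn|move=> /asboolPn/negbTE].
Qed.

End DiscreteMeasurability.

Lemma dmeas_coord (i : prim) : dmeas (fun y : VT => y i).
Proof. by move=> t; apply: sub_sigma_algebra; exists i, t. Qed.

Lemma meas_coord (i : prim) (p : nat -> Prop) : measurable [set y : VT | p (y i)].
Proof. by apply: (@dmeas_pred _ _ nat (fun y : VT => y i)); exact: dmeas_coord. Qed.

Lemma measurable_coord_map {d : measure_display} {Omega : measurableType d}
    (f : Omega -> VT) :
  (forall i, dmeas (fun x => f x i)) -> measurable_fun setT f.
Proof.
move=> mf; apply: (@measurability _ _ Omega VT setT f coord_gen) => //.
by move=> _ [_ [i [k ->]] <-]; rewrite setTI; exact: mf.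
Qed.

Lemma dmeas_precomp {d d' : measure_display} {O : measurableType d}
   {O' : measurableType d'} (T : Type) (f : O -> O') (g : O' -> T) :
  measurable_fun setT f -> dmeas g -> dmeas (fun x => g (f x)).
Proof.
move=> mf mg t; have := mf measurableT _ (mg t).
by rewrite setTI.
Qed.

Lemma measurable_precomp {d d' : measure_display} {O : measurableType d}
   {O' : measurableType d'} (f : O -> O') (A : set O') :
  measurable_fun setT f -> measurable A -> measurable [set x | A (f x)].
Proof. by move=> mf mA; have := mf measurableT _ mA; rewrite setTI. Qed.

Definition cyl (l : seq prim) (v : V) : set VT := [set y | forall i, i \in l -> y i = v i].

Lemma measurable_cyl l v : measurable (cyl l v).
Proof.
apply: meas_forall => i; apply: meas_imply; first exact: meas_const.
exact: dmeas_coord.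
Qed.

Lemma cyl_cons i l v : cyl (i :: l) v = [set y | y i = v i] `&` cyl l v.
Proof.
apply/seteqP; split => y /=.
  move=> h; split; first by apply: h; rewrite inE eqxx.
  by move=> j hj; apply: h; rewrite inE hj orbT.
by move=> [h1 h2] j; rewrite inE => /orP[/eqP->//|]; exact: h2.
Qed.

(** * Measures that agree on cylinders *)

Section Uniqueness.
Context {R : realType}.
Variables m1 m2 : {measure set VT -> \bar R}.
Hypothesis m1fin : (m1 setT < +oo)%E.

Let cyl_reduce (m : {measure set VT -> \bar R}) i l v : i \notin l ->
  m (cyl l v) = (\sum_(k <oo) m (cyl (i :: l) (upd v i k)))%E.
Proof.
move=> il.
have -> : cyl l v = \bigcup_k cyl (i :: l) (upd v i k).
  apply/seteqP; split => y /=.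
    move=> h; exists (y i) => // j; rewrite inE => /orP[/eqP->|jl]; first by rewrite upd_eq.
    by rewrite upd_neq ?h//; apply: contraNneq il => <-.
  move=> [k _ h] j jl; rewrite h ?inE ?jl ?orbT// upd_neq//.
  by apply: contraNneq il => <-.
rewrite measure_bigcup//; last first.
- apply/trivIsetP => a b _ _ ab; apply/seteqP; split => y //= [ha hb].
  have := ha i; rewrite inE eqxx upd_eq => /(_ isT) ea.
  have := hb i; rewrite inE eqxx upd_eq => /(_ isT) eb.
  by move: ab; rewrite -ea -eb eqxx.
- by move=> ? _; exact: measurable_cyl.
- by apply: eq_eseriesl => k; rewrite in_setT.
Qed.

(** Cylinders form a pi-system. A cylinder is a countable disjoint union of cylinders reading one
    more coordinate, so it is enough to compare the measures on arbitrarily large lists [L]; each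
    use takes an [L] suited to the coordinates that its map mixes. *)
Lemma cyl_measure_unique :
  (forall l : seq prim, exists2 L : seq prim, {subset l <= L} & forall v, m1 (cyl L v) = m2 (cyl L v)) ->
  forall A, measurable A -> m1 A = m2 A.
Proof.
move=> hL.
have red l1 l : (forall v, m1 (cyl (l1 ++ l) v) = m2 (cyl (l1 ++ l) v)) ->
    forall v, m1 (cyl l v) = m2 (cyl l v).
  elim: l1 => [//|i l1 IH] h; apply: IH => v.
  have [il|il] := boolP (i \in l1 ++ l).
    have -> // : cyl (l1 ++ l) v = cyl ((i :: l1) ++ l) v.
    apply/seteqP; split => y /= hy j; last by move=> jl; apply: hy; rewrite inE jl orbT.
    by rewrite inE => /orP[/eqP->|]; apply: hy.
  by rewrite !(cyl_reduce _ _ il); apply: eq_eseriesr => k _; exact: h.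
have cylE l v : m1 (cyl l v) = m2 (cyl l v).
  have [L lL hv] := hL l; apply: (red L) => v'.
  have -> // : cyl (L ++ l) v' = cyl L v'.
  apply/seteqP; split => y /= hy j jl; apply: hy; first by rewrite mem_cat jl.
  by move: jl; rewrite mem_cat => /orP[//|/lL].
pose G : set (set VT) := [set A | A = set0 \/ exists l v, A = cyl l v].
have GE : <<s G >> = @measurable _ VT.
  apply/seteqP; split => A.
    apply: smallest_sub; first exact: sigma_algebra_measurable.
    by move=> _ [->//|[l [v ->]]]; exact: measurable_cyl.
  move=> hA; apply: (smallest_sub _ _ hA); first exact: smallest_sigma_algebra.
  move=> _ [i [k ->]]; apply: sub_sigma_algebra; right; exists [:: i], (fun=> k).
  apply/seteqP; split => y /=; first by move=> h j; rewrite inE => /eqP->.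
  by move=> h; apply: h; rewrite inE.
move=> A mA.
apply: (@g_sigma_algebra_measure_unique _ R VT G _ (fun=> cyl [::] (fun=> 0%N))).
- by rewrite -GE; exact: sub_sigma_algebra.
- by move=> _; right; exists [::], (fun=> 0%N).
- by apply/seteqP; split => // y _; exists 0%N.
- move=> A1 A2 [->|[l1 [v1 ->]]]; first by move=> _; left; rewrite set0I.
  move=> [->|[l2 [v2 ->]]]; first by left; rewrite setI0.
  (* Two cylinders that meet at [y] can both be written with the values of [y], and their
     intersection reads [l1 ++ l2]. *)
  case: (pselect (exists y, cyl l1 v1 y /\ cyl l2 v2 y)) => [[y [h1 h2]]|h].
    right; exists (l1 ++ l2), y; apply/seteqP; split => z /=.
      move=> [z1 z2] i; rewrite mem_cat => /orP[il|il].
        by rewrite z1// h1.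
      by rewrite z2// h2.
    move=> hz; split => i il.
      by rewrite hz ?mem_cat ?il// h1.
    by rewrite hz ?mem_cat ?il ?orbT// h2.
  left; apply/seteqP; split => // z [z1 z2]; apply: h; by exists z.
- by move=> _ [->|[l [v ->]]]; [rewrite !measure0|exact: cylE].
- by move=> _; apply: le_lt_trans m1fin; apply: le_measure; rewrite ?inE//; exact: measurable_cyl.
- by rewrite GE.
Qed.
End Uniqueness.

(** * Real-valued probabilities *)

Section RealProbability.
Context {R : realType} {d : measure_display} {Omega : measurableType d}.
Variable P : probability Omega R.

Definition pr (A : set Omega) : R := fine (P A).

Lemma prE A : measurable A -> P A = (pr A)%:E.
Proof. by move=> mA; rewrite fineK//; apply: fin_num_measure. Qed.

Lemma pr_ge0 A : 0 <= pr A. Proof. exact: fine_ge0. Qed.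

Lemma prT : pr setT = 1. Proof. by rewrite /pr probability_setT. Qed.

Lemma pr_mono A B : measurable A -> measurable B -> A `<=` B -> pr A <= pr B.
Proof.
by move=> mA mB AB; rewrite -lee_fin -!prE//; apply: le_measure; rewrite ?inE.
Qed.

Lemma pr_le1 A : measurable A -> pr A <= 1.
Proof. by move=> mA; rewrite -prT; apply: pr_mono. Qed.

Lemma pr_disjU A B : measurable A -> measurable B -> A `&` B = set0 ->
  pr (A `|` B) = pr A + pr B.
Proof.
move=> mA mB AB; apply: EFin_inj; rewrite EFinD -!prE//; last exact: measurableU.
by rewrite measureU.
Qed.

Lemma pr_split A B : measurable A -> measurable B ->
  pr A = pr (A `&` B) + pr (A `&` ~` B).
Proof.
move=> mA mB; rewrite -pr_disjU ?setIUr ?setUv ?setIT//.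
- by rewrite -setIUr setUv setIT.
- exact: measurableI.
- by apply: measurableI => //; exact: measurableC.
- by rewrite setIACA setICr setI0.
Qed.

Lemma pr_setC A : measurable A -> pr (~` A) = 1 - pr A.
Proof.
by move=> mA; rewrite -prT (pr_split measurableT mA) !setTI; ring.
Qed.

Lemma pr_leD A B C : measurable A -> measurable B -> measurable C ->
  A `<=` B `|` C -> pr A <= pr B + pr C.
Proof.
move=> mA mB mC ABC; rewrite (pr_split mA mB); apply: lerD; apply: pr_mono => //.
- exact: measurableI.
- by apply: measurableI => //; exact: measurableC.
- by move=> y [/ABC[]].
Qed.

Lemma pr0_ext A B N : measurable A -> measurable B -> measurable N -> pr N = 0 ->
  (forall y, ~ N y -> A y <-> B y) -> pr A = pr B.
Proof.
move=> mA mB mN N0 h; apply/eqP; rewrite eq_le; apply/andP; split.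
  rewrite -[pr B]addr0 -N0; apply: pr_leD => // y Ay.
  by case: (pselect (N y)) => [|/h /iffLR]; [right|left; auto].
rewrite -[pr A]addr0 -N0; apply: pr_leD => // y Ay.
by case: (pselect (N y)) => [|/h /iffRL]; [right|left; auto].
Qed.

Lemma pr_countable_le A (F : nat -> set Omega) (c : R) :
  measurable A -> (forall k, measurable (F k)) -> A `<=` \bigcup_k F k ->
  (forall n, \sum_(0 <= k < n) pr (F k) <= c) -> pr A <= c.
Proof.
move=> mA mF AF hc; rewrite -lee_fin -prE//.
apply: (le_trans (measure_sigma_subadditive _ mF mA AF)).
apply: lime_le; first by apply: is_cvg_nneseries.
apply: nearW => n; rewrite (eq_bigr (fun k => (pr (F k))%:E)).
  by rewrite sumEFin lee_fin.
by move=> k _; exact: prE.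
Qed.

Lemma pr_sum_disj_le A (F : nat -> set Omega) n : measurable A ->
  (forall k, measurable (F k)) -> (forall k y, F k y -> A y) ->
  (forall j k y, F j y -> F k y -> j = k) ->
  \sum_(0 <= k < n) pr (F k) <= pr A.
Proof.
move=> mA mF FA dF.
suff -> : \sum_(0 <= k < n) pr (F k) = pr [set y | exists k, (k < n)%N /\ F k y].
  apply: pr_mono => //; last by move=> y [k [_ /FA]].
  by apply: meas_exists => k; apply: meas_and; [exact: meas_const|exact: mF].
elim: n => [|n IH].
  rewrite big_nil (_ : [set _ | _] = set0) ?/pr ?measure0//.
  by apply/seteqP; split => // y [k []].
rewrite big_nat_recr//= IH -pr_disjU.
- congr pr; apply/seteqP; split => y /=.
    by move=> [[k [kn]]|Fn]; [exists k; split => //; exact: ltnW|exists n].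
  move=> [k []]; rewrite ltnS leq_eqVlt => /orP[/eqP->|kn]; first by right.
  by left; exists k.
- by apply: meas_exists => k; apply: meas_and; [exact: meas_const|exact: mF].
- exact: mF.
- apply/seteqP; split => // y [[k [kn Fk]] Fn].
  by move: kn; rewrite (dF _ _ _ Fk Fn) ltnn.
Qed.

Lemma pr_nondecreasing_le A (F : nat -> set Omega) (c : R) :
  measurable A -> (forall k, measurable (F k)) -> A `<=` \bigcup_k F k ->
  (forall k y, F k y -> F k.+1 y) -> (forall n, pr (A `&` F n) <= c) -> pr A <= c.
Proof.
move=> mA mF AF hF hc; rewrite -lee_fin -prE//.
have -> : A = \bigcup_n (A `&` F n) by rewrite -setI_bigcupr setIidl.
have mAF n : measurable (A `&` F n) by exact: measurableI.
have mU : measurable (\bigcup_n (A `&` F n)) by exact: bigcupT_measurable.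
have cv := @nondecreasing_cvg_mu _ _ _ P _ mAF mU.
rewrite -(cvg_lim _ (cv _))//.
- apply: lime_le.
    apply/cvg_ex; eexists; apply: cv.
    apply/nondecreasing_seqP => n; apply/subsetPset => y [? ?]; split => //; exact: hF.
  by apply: nearW => n /=; rewrite prE// lee_fin.
- apply/nondecreasing_seqP => n; apply/subsetPset => y [? ?]; split => //; exact: hF.
Qed.

Lemma pr_null_bigcup (F : nat -> set Omega) : (forall k, measurable (F k)) ->
  (forall k, pr (F k) = 0) -> pr (\bigcup_k F k) = 0.
Proof.
move=> mF F0; apply/eqP; rewrite eq_le pr_ge0 andbT.
apply: (@pr_countable_le _ F) => //; first exact: bigcupT_measurable.
by move=> n; rewrite big1.
Qed.

Lemma pr_null_exists (S : countType) (A : S -> Omega -> Prop) :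
  (forall s, measurable [set y | A s y]) -> (forall s, pr [set y | A s y] = 0) ->
  pr [set y | exists s, A s y] = 0.
Proof.
move=> mA A0.
pose F n := [set y | if unpickle n is Some s then A s y else False].
rewrite (_ : [set _ | _] = \bigcup_n F n).
  apply: pr_null_bigcup => n; rewrite /F; case: unpickle => [s|]; rewrite ?A0//.
    exact: meas_const.
  by rewrite (_ : [set _ | _] = set0) ?/pr ?measure0//; apply/seteqP; split.
apply/seteqP; split => y /= [s h]; last by move: h; rewrite /F /=; case: unpickle => // t; exists t.
by exists (pickle s) => //; rewrite /F /= pickleK.
Qed.

Lemma pr_null_sub A B : measurable A -> measurable B -> A `<=` B -> pr B = 0 -> pr A = 0.
Proof. by move=> mA mB AB B0; apply/eqP; rewrite eq_le pr_ge0 andbT -B0 pr_mono. Qed.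

Lemma pr_nondecreasing_ge (F : nat -> set Omega) (c : R) :
  (forall k, measurable (F k)) -> (forall k y, F k y -> F k.+1 y) ->
  c < pr (\bigcup_k F k) -> exists k, c < pr (F k).
Proof.
move=> mF hF hc; apply: contrapT => h.
suff : pr (\bigcup_k F k) <= c by rewrite leNgt hc.
apply: (@pr_nondecreasing_le _ F) => //; first exact: bigcupT_measurable.
move=> n; rewrite leNgt; apply/negP => hn; apply: h; exists n.
apply: (lt_le_trans hn); apply: pr_mono => //.
by apply: measurableI => //; exact: bigcupT_measurable.
Qed.

Lemma pr_positive_nonnull A B : measurable A -> measurable B -> pr B = 0 ->
  pr (A `&` ~` B) = pr A.
Proof.
move=> mA mB B0; rewrite [RHS](pr_split mA mB).
rewrite (@pr_null_sub (A `&` B) B) ?add0r//; first exact: measurableI.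
Qed.

End RealProbability.

(** * Product laws: resampling and independence *)

Section Law.
Context {R : realType}.
Variables (nu : probability VT R) (m : prim -> nat -> R).
Hypothesis m_ge0 : forall i k, 0 <= m i k.
Hypothesis law : forall (l : seq prim) v, uniq l ->
  nu (cyl l v) = (\prod_(i <- l) m i (v i))%:E.

Lemma law_coord i k : pr nu [set y | y i = k] = m i k.
Proof.
rewrite /pr (_ : [set _ | _] = cyl [:: i] (fun=> k)).
  by rewrite law// big_seq1.
apply/seteqP; split => y /=; first by move=> h j; rewrite inE => /eqP->.
by apply; rewrite inE.
Qed.

Lemma measurable_upd i k : measurable_fun setT (fun y : VT => upd y i k : VT).
Proof.
apply: measurable_coord_map => j; rewrite /upd; case: (j == i); first exact: dmeas_cst.
exact: dmeas_coord.
Qed.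

Lemma measurable_resample (A : set VT) i k : measurable A ->
  measurable [set y : VT | A (upd y i k)].
Proof. by move=> mA; exact: (measurable_precomp (measurable_upd i k) mA). Qed.

Lemma eseries_single (f : nat -> \bar R) k0 : (forall k, (0 <= f k)%E) ->
  (forall k, k != k0 -> f k = 0%E) -> (\sum_(k <oo) f k)%E = f k0.
Proof.
move=> f0 h; rewrite (@nneseriesD1 _ f k0 xpredT)//.
by rewrite eseries0 ?adde0// => k _; exact: h.
Qed.

(** Fubini for one coordinate. Both sides are measures in [A], and on a cylinder that reads [i] only
    the term [k = v i] survives. *)
Lemma resample (A : set VT) i : measurable A ->
  nu A = (\sum_(k <oo) ((m i k)%:E * nu [set y | A (upd y i k)]))%E.
Proof.
pose mk k := mscale (NngNum (m_ge0 i k))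
  (measure_function_pushforward__canonical__measure_function_Measure nu (measurable_upd i k)).
have /= := @cyl_measure_unique R nu (mseries mk 0) _ _ A.
apply.
  by rewrite probability_setT ltry.
move=> l; exists (i :: undup ([seq j <- l | j != i])).
  move=> j jl; rewrite inE mem_undup mem_filter jl andbT /=.
  by case: eqP.
move=> v; set l' := undup _.
have il' : i \notin l' by rewrite mem_undup mem_filter /= eqxx.
have ul' : uniq l' by rewrite undup_uniq.
rewrite law/=; last by rewrite il' ul'.
pose f k := ((m i k)%:E * nu [set y : VT | cyl (i :: l') v (upd y i k : VT)])%E.
have -> : mseries mk 0 (cyl (i :: l') v) = (\sum_(k <oo) f k)%E by [].
rewrite (@eseries_single f (v i)) => [|k|k kv]; rewrite /f.
- rewrite (_ : [set _ | _] = cyl l' v).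
    by rewrite law// big_cons EFinM.
  rewrite cyl_cons; apply/seteqP; split => y /=.
    move=> [_ h] j jl; have := h _ jl; rewrite upd_neq//.
    by apply: contraNneq il' => <-.
  move=> h; rewrite upd_eq; split => // j jl; rewrite upd_neq ?h//.
  by apply: contraNneq il' => <-.
- by rewrite mule_ge0// lee_fin.
- rewrite (_ : [set _ | _] = set0) ?measure0 ?mule0//.
  apply/seteqP; split => // y /=; rewrite cyl_cons => -[/=].
  by rewrite upd_eq => /eqP; rewrite (negbTE kv).
Qed.

Lemma resample_le (A : set VT) i (c : R) n0 : measurable A ->
  (forall n, (n0 <= n)%N ->
     \sum_(0 <= k < n) m i k * pr nu [set y | A (upd y i k)] <= c) ->
  pr nu A <= c.
Proof.
move=> mA hc; rewrite -lee_fin -prE// (resample i)//.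
apply: lime_le.
  by apply: is_cvg_nneseries => k _ _; rewrite mule_ge0// lee_fin.
exists n0 => // n /= n0n.
rewrite (eq_bigr (fun k => (m i k * pr nu [set y | A (upd y i k)])%:E)).
  by rewrite sumEFin lee_fin; exact: hc.
by move=> k _; rewrite EFinM -prE//; exact: measurable_resample.
Qed.

(** Independence of the coordinate [i], expressed by modifying points rather than by
    sigma-algebras. *)
Definition insens i (A : set VT) := forall y k, A (upd y i k) <-> A y.

(** The coordinates of [L] are resampled one after another; this leaves [E] alone, and once they are
    all fixed [C] is full or empty. *)
Lemma indep_determined (E C : set VT) (L : seq prim) :
  measurable E -> measurable C -> (forall i, i \in L -> insens i E) ->
  (forall y y', (forall i, i \in L -> y i = y' i) -> C y -> C y') ->
  pr nu (E `&` C) = pr nu E * pr nu C.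
Proof.
move=> mE; elim: L C => [|i L IH] C mC fE hC.
  case: (pselect (exists y, C y)) => [[y Cy]|nC].
    rewrite (_ : C = setT) ?setIT ?prT ?mulr1//; apply/seteqP; split => // y' _.
    by apply: hC Cy.
  rewrite (_ : C = set0) ?setI0 ?/pr ?measure0 ?mulr0//; apply/seteqP; split => // y' ?.
  by apply: nC; exists y'.
have mEC : measurable (E `&` C) by exact: measurableI.
have fi : insens i E by apply: fE; rewrite inE eqxx.
apply: EFin_inj; rewrite EFinM -!prE// (resample i)// [nu C](resample i)//.
rewrite (prE _ mE) -nneseriesZl; last by move=> k _; rewrite mule_ge0// lee_fin.
apply: eq_eseriesr => k _; rewrite muleCA; congr (_ * _)%E.
have -> : [set y | (E `&` C) (upd y i k)] = E `&` [set y | C (upd y i k)].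
  by apply/seteqP; split => y /= [/fi].
have mCk : measurable [set y : VT | C (upd y i k)] by exact: measurable_resample.
rewrite !prE//; last exact: measurableI.
rewrite IH// ?EFinM//.
  by move=> j jL; apply: fE; rewrite inE jL orbT.
move=> y y' h /=; apply: hC => j; rewrite inE => /orP[/eqP->|jL]; first by rewrite !upd_eq.
by rewrite /upd; case: ifP => // _; exact: h.
Qed.

Lemma indep_coord (E : set VT) i (p : nat -> Prop) : measurable E -> insens i E ->
  pr nu (E `&` [set y | p (y i)]) = pr nu E * pr nu [set y | p (y i)].
Proof.
move=> mE fE; apply: (indep_determined (L := [:: i])) => //.
- exact: meas_coord.
- by move=> j; rewrite inE => /eqP->.
- by move=> y y' h /=; rewrite h ?inE.
Qed.

Lemma indep_coord_eq (E : set VT) i k : measurable E -> insens i E ->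
  pr nu (E `&` [set y | y i = k]) = pr nu E * m i k.
Proof. by move=> mE fE; rewrite (@indep_coord _ i (fun x => x = k))// law_coord. Qed.

Lemma indep_cyl (E : set VT) l v : uniq l -> measurable E -> (forall i, i \in l -> insens i E) ->
  pr nu (E `&` cyl l v) = pr nu E * \prod_(i <- l) m i (v i).
Proof.
move=> ul mE fE; rewrite (indep_determined (L := l))//; last 2 first.
- exact: measurable_cyl.
- by move=> y y' h Cy i il; rewrite -h// Cy.
by rewrite [in X in _ * X]/pr law.
Qed.

Lemma insens_setI i A B : insens i A -> insens i B -> insens i (A `&` B).
Proof. by move=> fA fB y k; have := fA y k; have := fB y k; rewrite /setI /=; tauto. Qed.

Lemma insens_setC i A : insens i A -> insens i (~` A).
Proof. by move=> fA y k; have := fA y k; rewrite /setC /=; tauto. Qed.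

End Law.

(** * The successor map on coordinates *)

Definition pcoord (i : prim) (y : V) : nat := y i.
Definition B (y : V) : Theta := brw pcoord y.
Notation org := (origin pcoord).
Notation ancV := (anc pcoord).

(* Takes the step [y i] from the label with digits [y (PU _)]: the digits become
   those of the new label, and the coordinate [i] becomes the reverse step. *)
Definition psi (i : prim) (y : V) : V := fun k =>
  if k == i then (if y i == 0%N then y (PU 0) else 0%N)
  else if k is PU j then
    (if y i == 0%N then y (PU j.+1) else if j is j'.+1 then y (PU j') else y i)
  else y k.

Fixpoint psis (e : nat -> prim) (r : nat) (y : V) : V :=
  if r is r'.+1 then psi (e r) (psis e r' y) else y.

Definition isPU (i : prim) := if i is PU _ then true else false.
Definition isPX (i : prim) := if i is PX _ _ then true else false.

Lemma psi_at i y : psi i y i = if y i == 0%N then y (PU 0) else 0%N.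
Proof. by rewrite /psi eqxx. Qed.

Lemma psi_other i y k : k != i -> ~~ isPU k -> psi i y k = y k.
Proof. by rewrite /psi => /negbTE->; case: k. Qed.

Lemma psi_PU i y j h : isPX i ->
  psi i y (PU j) = (stepW (y i) (h, fun j => y (PU j))).2 j.
Proof. by case: i => // p w _; rewrite /psi /=; case: (y (PX p w)) => //=. Qed.

Definition spine (p : nat) : prim := PX p [::].

Lemma psis_other e r y k : (forall p, (0 < p <= r)%N -> k != e p) -> ~~ isPU k ->
  psis e r y k = y k.
Proof.
move=> h kU; elim: r h => [//|r IH] h /=; rewrite psi_other ?h//; last by rewrite leqnn.
by apply: IH => p /andP[p0 pr]; apply: h; rewrite p0 leqW.
Qed.

Lemma spine_inj p p' : (spine p == spine p') = (p == p').
Proof. by apply/eqP/eqP => [[]|->]. Qed.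

Lemma psis_spine_PU r y j : psis spine r y (PU j) = (ancV y r).2 j.
Proof.
elim: r j => [//|r IH] j; rewrite /= (psi_PU _ _ (ancV y r).1)// psis_other//.
  by congr ((stepW _ _).2 j); rewrite [RHS]surjective_pairing; congr pair; apply/funext => i.
by move=> p /andP[_ pr]; rewrite spine_inj gtn_eqF.
Qed.

Lemma spine_neq p q a w : PX q (a :: w) != spine p.
Proof. by apply/eqP. Qed.

Lemma PX_neq p q (u w : seq nat) : (p != q) || (u != w) -> PX p u != PX q w.
Proof. by move=> h; apply/eqP => -[pq uw]; rewrite pq uw !eqxx in h. Qed.

(* The successor of the root is the vertex [(q, [:: brk q])] of the tree, where [q] is
   determined by [qis q]; [rho q] and [Rq q] rename the coordinates accordingly. *)
Definition brk (q : nat) : nat := (q != 0)%N.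

Definition rho (q : nat) (i : prim) : prim :=
  match i with
  | PK p.+1 => PK (q + p)%N
  | PN 0 w => PN q (brk q :: w)
  | PN 1 (i.+1 :: w) => PN q ((i.+1 + brk q)%N :: w)
  | PN p.+2 (i.+1 :: w) => PN (q + p.+1)%N (i.+1 :: w)
  | PX 0 (i :: w) => PX q (brk q :: i :: w)
  | PX 1 [::] => PX q [:: brk q]
  | PX 1 (i.+1 :: w) => PX q ((i.+1 + brk q)%N :: w)
  | PX p.+2 [::] => PX (q + p.+1)%N [::]
  | PX p.+2 (i.+1 :: w) => PX (q + p.+1)%N (i.+1 :: w)
  | _ => i
  end.

Definition Rq (q : nat) (y : V) : V := fun i =>
  if i is PK 0 then (if q is q'.+1 then (y (PK q')).-1 else y (PN 0 [::]))
  else y (rho q i).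

Definition qis (q : nat) (y : V) : bool :=
  if q is q'.+1 then
    [&& y (PN 0 [::]) == 0%N, all (fun j => y (PK j) <= 1)%N (iota 0 q') & (1 < y (PK q'))%N]
  else (0 < y (PN 0 [::]))%N.

(** The exchanges follow the path from the root to its successor: [q] steps up the ancestral line,
    then one step down. The digits end up being those of the label of the successor, and the last
    coordinate holds the step leading back from the successor to its parent. *)
Definition Psi (q : nat) (y : V) : V := psi (PX q [:: brk q]) (psis spine q y).

Definition shiftT (y : V) : V :=
  match pselect (exists q, qis q y) with
  | left H => Rq (ex_minn H) (Psi (ex_minn H) y)
  | right _ => y
  end.

Lemma qis_inj q q' y : qis q y -> qis q' y -> q = q'.
Proof.
wlog : q q' / (q <= q')%N.
  move=> h; case: (leqP q q') => [|/ltnW] qq hq hq'; first exact: h.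
  by apply/esym; apply: h.
rewrite leq_eqVlt => /orP[/eqP//|].
case: q' => // q' qq; case: q qq => [|q] /= qq h /and3P[/eqP h0 /allP h1 h2].
  by rewrite h0 in h.
move: h => /and3P[_ _]; rewrite ltnNge h1//.
by rewrite mem_iota add0n.
Qed.

Lemma shiftTE q y : qis q y -> shiftT y = Rq q (Psi q y).
Proof.
move=> hq; rewrite /shiftT; case: pselect => [H|[]]; last by exists q.
by case: ex_minnP => n hn _; rewrite (qis_inj hq hn).
Qed.

Lemma stepW_shift s h x : stepW s (shiftW h x) = shiftW h (stepW s x).
Proof.
by case: s => [|s]; rewrite /= /parentW /childW /shiftW /=; congr pair; ring.
Qed.

Lemma walk_shift xi pre h x w :
  walk xi pre (shiftW h x) w = shiftW h (walk xi pre x w).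
Proof. by elim: w pre x => [//|i w IH] pre x /=; rewrite stepW_shift IH. Qed.

Lemma walk_rcons xi pre x w i :
  walk xi pre x (rcons w i) = stepW (xi (pre ++ rcons w i)) (walk xi pre x w).
Proof.
elim: w pre x => [|j w IH] pre x /=; first by rewrite cats1.
by rewrite IH cat_rcons.
Qed.

Lemma eq_inGW (n n' : seq nat -> nat) pre pre' w :
  (forall u, n (pre ++ u) = n' (pre' ++ u)) -> inGW n pre w = inGW n' pre' w.
Proof.
elim: w pre pre' => [//|i w IH] pre pre' h /=.
have := h [::]; rewrite !cats0 => ->; congr andb; apply: IH => u.
by rewrite !cat_rcons.
Qed.

Lemma eq_walk (xi xi' : seq nat -> nat) pre pre' x w :
  (forall i u, xi (pre ++ i :: u) = xi' (pre' ++ i :: u)) ->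
  walk xi pre x w = walk xi' pre' x w.
Proof.
elim: w pre pre' x => [//|i w IH] pre pre' x h /=.
have := h i [::]; rewrite !cats1 => ->; apply: IH => j u.
by rewrite !cat_rcons.
Qed.

Lemma eq_walk_cons (xi xi' : seq nat -> nat) i i' x w :
  (forall u, xi (i :: u) = xi' (i' :: u)) ->
  walk xi [::] x (i :: w) = walk xi' [::] x (i' :: w).
Proof. by move=> h /=; rewrite h; apply: eq_walk => j u; exact: h. Qed.

Section Successor.
Variables (y : V) (q : nat).
Hypothesis hq : qis q y.
Hypothesis U_pos : forall j, (0 < y (PU j))%N.

Let y2 := Psi q y.
Let y' := Rq q y2.
Let xr := stepW (y (PX q [:: brk q])) (ancV y q).
Let h := xr.1.

Lemma anc_digit_pos p j : (0 < (ancV y p).2 j)%N.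
Proof.
elim: p j => [|p IH] j /=; first exact: U_pos.
rewrite /pcoord; case: (y (PX p.+1 [::])) => [|s] /=; first exact: IH.
by case: j.
Qed.

Let y2E i : ~~ isPU i -> i != PX q [:: brk q] ->
  (forall p, (0 < p <= q)%N -> i != spine p) -> y2 i = y i.
Proof. by move=> iU i1 i2; rewrite /y2 /Psi psi_other// psis_other. Qed.

Let psisq : psis spine q y (PX q [:: brk q]) = y (PX q [:: brk q]).
Proof. by rewrite psis_other// => p _; exact: spine_neq. Qed.

Lemma org_succ : org y' = shiftW h xr.
Proof.
rewrite /origin /shiftW subrr; congr pair; apply/funext => j.
rewrite /pcoord /= /y2 /Psi (psi_PU _ _ (ancV y q).1)// psisq.
congr ((stepW _ _).2 j); rewrite [RHS]surjective_pairing; congr pair; apply/funext => i.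
exact: psis_spine_PU.
Qed.

(** Only the edge between the successor and its parent is walked backwards, with the reverse step
    left by [Psi]; above it the steps are the old ones. If the step along this edge was [0], walking
    back restores the removed digit, which is a child step because digits are positive. *)
Lemma anc_succ p : ancV y' p.+1 = shiftW h (ancV y (q + p)%N).
Proof.
elim: p => [|p IH].
  rewrite [LHS]/= org_succ addn0 stepW_shift; congr shiftW.
  rewrite /pcoord /= /y2 /Psi psi_at psisq psis_spine_PU /xr.
  case: (y (PX q [:: brk q])) => [|s] /=.
    have := anc_digit_pos q 0; case E : ((ancV y q).2 0%N) => [|a] // _ /=.
    rewrite /childW /parentW /= subrK [RHS]surjective_pairing; congr pair.
    by apply/funext => -[|j] //; rewrite E.
  by rewrite /parentW /= addrK [RHS]surjective_pairing.
rewrite -[LHS]/(stepW (pcoord (PX p.+2 [::]) y') (ancV y' p.+1)).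
have -> : stepW (pcoord (PX p.+2 [::]) y') (ancV y' p.+1) =
  stepW (y (PX (q + p.+1)%N [::])) (ancV y' p.+1).
  congr stepW; rewrite /pcoord /y' /= y2E// => [|k /andP[_ kq]].
    by apply: PX_neq; apply/orP; left; apply/eqP; lia.
  by rewrite -/(spine _) spine_inj; apply/eqP; lia.
by rewrite IH stepW_shift addnS.
Qed.

Lemma N_succ0 u : y' (PN 0 u) = y (PN q (brk q :: u)).
Proof. by rewrite /y' /= y2E. Qed.
Lemma X_succ0 i u : y' (PX 0 (i :: u)) = y (PX q (brk q :: i :: u)).
Proof.
rewrite /y' /= y2E//; first by apply: PX_neq; apply/orP; right; apply/eqP.
by move=> p _; exact: spine_neq.
Qed.
Lemma N_succ1 i u : y' (PN 1 (i.+1 :: u)) = y (PN q ((i.+1 + brk q)%N :: u)).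
Proof. by rewrite /y' /= y2E. Qed.
Lemma X_succ1 i u : y' (PX 1 (i.+1 :: u)) = y (PX q ((i.+1 + brk q)%N :: u)).
Proof.
rewrite /y' /= y2E//; last by move=> p _; exact: spine_neq.
by apply: PX_neq; apply/orP; right; apply/eqP => -[]; lia.
Qed.
Lemma N_succ2 p i u : y' (PN p.+2 (i.+1 :: u)) = y (PN (q + p.+1)%N (i.+1 :: u)).
Proof. by rewrite /y' /= y2E. Qed.
Lemma X_succ2 p i u : y' (PX p.+2 (i.+1 :: u)) = y (PX (q + p.+1)%N (i.+1 :: u)).
Proof.
rewrite /y' /= y2E//; last by move=> k _; exact: spine_neq.
by apply: PX_neq; apply/orP; left; apply/eqP; lia.
Qed.
Lemma K_succ2 p : y' (PK p.+1) = y (PK (q + p)%N).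
Proof. by rewrite /y' /= y2E. Qed.

Lemma succ_0 w : B y' 0 w = omap (shiftW h) (B y q (brk q :: w)).
Proof.
have -> : B y q (brk q :: w) = if inGW (fun u => y (PN q u)) [:: brk q] w
    then Some (walk (fun u => y (PX q u)) [:: brk q] xr w) else None.
  rewrite /xr; case: q hq => [|q'] /=; first by rewrite /pcoord /= => ->.
  by move=> /and3P[_ _]; rewrite /pcoord /= => ->.
rewrite /B /= (@eq_inGW _ (fun u => y (PN q u)) _ [:: brk q]); last by move=> u; exact: N_succ0.
case: ifP => // _ /=; rewrite org_succ walk_shift; congr (Some (shiftW _ _)).
by apply: eq_walk => i u; exact: X_succ0.
Qed.

Lemma succ_1 i w : B y' 1 (i :: w) = omap (shiftW h) (B y q ((i + brk q)%N :: w)).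
Proof.
case: i => [|i]; first exact: succ_0.
have -> : B y q ((i.+1 + brk q)%N :: w) =
    if (i.+1 < y' (PK 0))%N && inGW (fun u => y (PN q u)) [:: (i.+1 + brk q)%N] w
    then Some (walk (fun u => y (PX q u)) [::] (ancV y q) ((i.+1 + brk q)%N :: w)) else None.
  (* The new first ancestor is the old root when [q = 0], and keeps all its children; otherwise it
     is [rho(q)], whose first child has been removed, hence the predecessor and the shift of the
     index by [brk q]. *)
  rewrite /y' /Rq; case: (q) y2E => [|q'] y2E' /=.
    by rewrite /pcoord /brk /= !addn0 y2E'.
  rewrite /brk addn1 /pcoord /= y2E'//.
  by case: (y (PK q')) => [//|[]//].
rewrite [LHS]/B [brw _ _ _ _]/= /pcoord (@eq_inGW _ (fun u => y (PN q u)) _ [:: (i.+1 + brk q)%N]).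
  case: ifP => // _; congr Some.
  rewrite -[LHS]/(walk (fun u => y' (PX 1 u)) [::] (ancV y' 1) (i.+1 :: w)).
  rewrite -walk_shift anc_succ addn0.
  by apply: eq_walk_cons => u; exact: X_succ1.
by move=> u; exact: N_succ1.
Qed.

Lemma succ_2 p i w : B y' p.+2 (i.+1 :: w) = omap (shiftW h) (B y (q + p.+1)%N (i.+1 :: w)).
Proof.
rewrite addnS /B [brw _ _ _ _]/= [brw pcoord y _ _]/= /pcoord.
rewrite K_succ2 (@eq_inGW _ (fun u => y (PN (q + p)%N.+1 u)) _ [:: i.+1]).
  case: ifP => // _; congr Some.
  rewrite -[LHS]/(walk (fun u => y' (PX p.+2 u)) [::] (ancV y' p.+2) (i.+1 :: w)).
  rewrite -[RHS]/(shiftW h (walk (fun u => y (PX (q + p)%N.+1 u)) [::]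
    (ancV y (q + p)%N.+1) (i.+1 :: w))).
  rewrite anc_succ addnS -walk_shift.
  by apply: eq_walk_cons => u; rewrite X_succ2 addnS.
by move=> u; rewrite N_succ2 addnS.
Qed.

Lemma B_leaf p : isSome (B y p.+1 [:: 1%N]) = (1 < y (PK p))%N.
Proof. by rewrite /B /= /pcoord andbT; case: ifP. Qed.

Lemma hgt_succ : hgt (B y q [:: brk q]) = h.
Proof.
rewrite /h /xr; case: q hq => [|q'] /=; rewrite /B/= /pcoord; first by move=> ->.
by move=> /and3P[_ _ ->].
Qed.

End Successor.

Definition sccq (q : nat) (th : Theta) : Theta :=
  if q is 0 then scc_child th else scc_leaf th q (hgt (th q [:: 1%N])).

Lemma sccE q y : qis q y -> scc (B y) = sccq q (B y).
Proof.
case: q => [|q] hq; rewrite /scc.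
  have s0 : isSome (B y 0 [:: 0%N]) by move: hq; rewrite /B /= /pcoord => ->.
  by case: (B y 0 [:: 0%N]) s0.
have -> : B y 0 [:: 0%N] = None by move: hq => /and3P[/eqP h _ _]; rewrite /B /= /pcoord h.
case: pselect => [H|[]]; last first.
  by exists q.+1; rewrite ltnS leq0n B_leaf; case/and3P: hq.
have -> // : ex_minn H = q.+1.
case: ex_minnP => -[//|n] /andP[_]; rewrite B_leaf => hn min.
apply/eqP; rewrite eqn_leq min /=; last by rewrite B_leaf; case/and3P: hq.
rewrite ltnNge; apply/negP => nq; move: hq => /and3P[_ /allP/(_ n)].
by rewrite mem_iota add0n leq0n => /(_ nq); rewrite leqNgt hn.
Qed.

Lemma scc_stuck y : ~ (exists q, qis q y) -> scc (B y) = B y.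
Proof.
move=> nq; rewrite /scc.
have N0 : y (PN 0 [::]) = 0%N by apply/eqP/negPn/negP => h; apply: nq; exists 0%N; rewrite /= lt0n.
have -> : B y 0 [:: 0%N] = None by rewrite /B /= /pcoord N0.
case: pselect => // H; exfalso; apply: nq.
case: (ex_minnP H) => -[//|n] /andP[_]; rewrite B_leaf => hn min.
exists n.+1; rewrite /= N0 eqxx hn andbT /=; apply/allP => j; rewrite mem_iota => /andP[_ jn].
rewrite leqNgt; apply/negP => hj; have := min j.+1.
by rewrite B_leaf hj => /(_ isT); rewrite leqNgt ltnS jn.
Qed.

Lemma B_shiftT y q : qis q y -> (forall j, (0 < y (PU j))%N) ->
  B (shiftT y) = scc (B y).
Proof.
move=> hq hU; rewrite (shiftTE hq) (sccE hq).
have hroot y0 p : B y0 p [::] = Some (ancV y0 p) by case: p.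
apply/funext => p; apply/funext => w; rewrite /sccq.
case: q hq => [|q] hq.
  have hg : hgt (B y 0 [:: 0%N]) = _ := hgt_succ hq.
  rewrite /scc_child hg.
  elim: p w => [|p IH] w; first exact: succ_0.
  case: w => [|[|i] w].
  - by rewrite !hroot anc_succ.
  - case: p IH => [|p] IH; first exact: succ_0.
    exact: IH.
  - case: p {IH} => [|p]; first by rewrite succ_1// addn0.
    exact: succ_2.
have hg : hgt (B y q.+1 [:: 1%N]) = _ := hgt_succ hq.
rewrite hg.
elim: p w => [|p IH] w; first exact: succ_0.
case: p IH => [|p] IH.
  case: w => [|i w]; first by rewrite !hroot anc_succ// addn0.
  by rewrite succ_1// /brk addn1.
case: w => [|[|i] w].
- by rewrite !hroot anc_succ.
- exact: IH.
- exact: succ_2.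
Qed.

(** * Invariance of the law *)

Definition marg (R : realType) (b : nat) (mu mubar : nat -> R) (i : prim) (k : nat) : R :=
  match i with
  | PN _ _ => mu k
  | PK _ => if k == 0%N then 0 else mubar k
  | PU _ => if (1 <= k <= b)%N then b%:R^-1 else 0
  | PX _ _ => if k == 0%N then 2^-1 else if (k <= b)%N then (2 * b%:R)^-1 else 0
  end.

Record brw_law (R : realType) (b : nat) (mu mubar : nat -> R) (nu : probability VT R) : Prop :=
  BrwLaw {
  bl_b : (2 <= b)%N;
  bl_mu_ge0 : forall k, 0 <= mu k;
  bl_mu_sum : (\sum_(k <oo) (mu k)%:E = 1)%E;
  bl_mu_mean : (\sum_(k <oo) (k%:R * mu k)%:E = 1)%E;
  bl_mubar : forall k, (mubar k)%:E = (\sum_(k <= l <oo) (mu l)%:E)%E;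
  bl_law : forall (l : seq prim) v, uniq l ->
    nu (cyl l v) = (\prod_(i <- l) marg b mu mubar i (v i))%:E }.

Section Invariance.
Context {R : realType}.
Variables (b : nat) (mu mubar : nat -> R) (nu : probability VT R).
Hypothesis HL : brw_law b mu mubar nu.
Let m := marg b mu mubar.
Let law : forall (l : seq prim) v, uniq l ->
  nu (cyl l v) = (\prod_(i <- l) m i (v i))%:E := bl_law HL.
Let mu_ge0 := bl_mu_ge0 HL.

Lemma b_gt0 : (0 < b)%N. Proof. exact: ltnW (bl_b HL). Qed.

Lemma mubar_ge0 k : 0 <= mubar k.
Proof.
by rewrite -lee_fin (bl_mubar HL); apply: nneseries_ge0 => n _ _; rewrite lee_fin.
Qed.

Lemma mubarE k : mubar k = mu k + mubar k.+1.
Proof.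
apply: EFin_inj; rewrite EFinD !(bl_mubar HL) (@nneseries_split _ _ k 1).
  by rewrite addn1 big_nat1.
by move=> n _; rewrite lee_fin.
Qed.

Lemma mubar1 : mubar 1 = 1 - mu 0.
Proof.
have : mubar 0 = 1 by apply: EFin_inj; rewrite (bl_mubar HL) (bl_mu_sum HL).
by rewrite mubarE => <-; ring.
Qed.

(** The mean is at least [mu 1 + 2 * mubar 2]. When [mu 0 = 0], it follows that almost surely no
    ancestor has a second child. *)
Lemma mubar2_le : mubar 2 <= mu 0.
Proof.
suff : mu 1 + 2 * mubar 2 <= 1 by have := mubarE 1; rewrite mubar1; lra.
rewrite -lee_fin -(bl_mu_mean HL) (@nneseries_split _ _ 0 2); last first.
  by move=> n _; rewrite lee_fin mulr_ge0.
rewrite add0n EFinD; apply: leeD.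
  by rewrite sumEFin lee_fin big_nat_recr//= big_nat1 mul0r add0r mul1r.
rewrite EFinM (bl_mubar HL) -nneseriesZl; last by move=> *; rewrite lee_fin.
rewrite ereal_series [leRHS]ereal_series.
apply: lee_nneseries => n; first by move=> _ _; rewrite -EFinM lee_fin mulr_ge0.
by move=> hn; rewrite -EFinM lee_fin ler_wpM2r// ler_nat.
Qed.

Lemma marg_ge0 i k : 0 <= m i k.
Proof.
rewrite /m; case: i => *; rewrite /marg //.
- by case: ifP => // _; exact: mubar_ge0.
- by case: ifP => // _; rewrite invr_ge0.
- by do 2 case: ifP => // _; rewrite invr_ge0// mulr_ge0.
Qed.
Let m_ge0 := marg_ge0.

Lemma measurable_psi i : measurable_fun setT (psi i : VT -> VT).
Proof.
apply: measurable_coord_map => k; rewrite /psi.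
have mc j : dmeas (fun x : VT => x j) := @dmeas_coord j.
have mi : dmeas (fun x : VT => x i == 0%N) := dmeas_comp (fun a => a == 0%N) (mc i).
case: (k == i); first by apply: dmeas_if => //; exact: dmeas_cst.
by case: k => [p w|p|[|j]|p w] //; apply: dmeas_if.
Qed.

(** Detailed balance of the kernel with respect to uniform digits; digits out of range have weight
    zero on both sides. *)
Lemma psi_marg p w j a : a != 0%N -> m (PX p w) 0 * m (PU j) a = m (PX p w) a.
Proof.
move=> a0; rewrite /m /= (negbTE a0) lt0n a0 /=; case: ifP => _; last by rewrite mulr0.
by rewrite invfM.
Qed.

(** The preimage of a cylinder that reads [i] and the first digits is, up to a null set, a cylinder
    with one digit fewer or one digit more, and [psi_marg] compares the weights. *)
Lemma psi_preserves i A : isPX i -> measurable A -> nu [set y | A (psi i y : VT)] = nu A.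
Proof.
case: i => // pp ww _; set i := PX pp ww.
pose m1 : {measure set VT -> \bar R} :=
  measure_function_pushforward__canonical__measure_function_Measure nu (measurable_psi i).
apply: (@cyl_measure_unique R m1 nu).
  by rewrite /m1 /= /pushforward preimage_setT probability_setT ltry.
move=> l; pose l' := undup [seq k <- l | (k != i) && ~~ isPU k].
pose J := (\max_(k <- l) if k is PU j then j.+1 else 0)%N.
pose L n := i :: (map PU (iota 0 n) ++ l').
exists (L J.+1).
  move=> k kl; rewrite inE mem_cat mem_undup mem_filter kl andbT.
  have [//|ki] := eqVneq k i.
  case: k kl {ki} => [? ?|?|j|? ?] jl; rewrite [isPU _]/= ?orbT//.
  apply/orP; right; apply/orP; left; rewrite mem_map; last by move=> ? ? [].
  rewrite mem_iota add0n leq0n /= ltnS.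
  apply/ltnW; rewrite /J (big_rem _ jl) /=; exact: leq_maxl.
have uL n : uniq (L n).
  rewrite /L cons_uniq mem_cat negb_or cat_uniq undup_uniq andbT; apply/andP; split.
    apply/andP; split; first by apply/negP => /mapP[].
    by rewrite mem_undup mem_filter eqxx.
  apply/andP; split; first by rewrite map_inj_uniq ?iota_uniq// => ? ? [].
  apply/hasPn => k; rewrite mem_undup mem_filter => /andP[/andP[_]].
  by case: k => // *; apply/negP => /mapP[].
have l'P k : k \in l' -> k != i /\ ~~ isPU k.
  by rewrite mem_undup mem_filter => /andP[/andP[]].
have prodL n w : \prod_(k <- L n) m k (w k) =
    m i (w i) * ((\prod_(j <- iota 0 n) m (PU j) (w (PU j))) * \prod_(k <- l') m k (w k)).
  by rewrite big_cons big_cat big_map.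
have prcyl n w : pr nu (cyl (L n) w) = \prod_(k <- L n) m k (w k) by rewrite /pr law.
have cylL n w y : cyl (L n) w y <-> [/\ y i = w i, (forall j, (j < n)%N -> y (PU j) = w (PU j))
    & forall k, k \in l' -> y k = w k].
  split.
    move=> h; split => [|j jn|k kl]; apply: h; rewrite ?inE ?eqxx// mem_cat.
      by rewrite mem_map ?mem_iota ?add0n ?jn ?orbT// => ? ? [].
    by rewrite kl !orbT.
  move=> [h1 h2 h3] k; rewrite inE => /orP[/eqP->//|]; rewrite mem_cat => /orP[/mapP[j]|/h3//].
  by rewrite mem_iota add0n => /andP[_ /h2 ? ->].
move=> v; have mN : measurable [set y : VT | y (PU 0) = 0%N] := @dmeas_coord (PU 0) 0%N.
have N0 : pr nu [set y : VT | y (PU 0) = 0%N] = 0 by rewrite (law_coord law) /m.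
have mpre : measurable [set y : VT | cyl (L J.+1) v (psi i y)].
  exact: (measurable_precomp (measurable_psi i) (measurable_cyl _ _)).
change (nu [set y : VT | cyl (L J.+1) v (psi i y)] = nu (cyl (L J.+1) v)).
rewrite (prE nu mpre) law// prodL; congr EFin.
have psi_l' (y : V) k : k \in l' -> psi i y k = y k.
  by move=> /l'P[ki kU]; rewrite psi_other.
(* A reverse step [0] comes from a step down to the new top digit, so that the preimage reads one
   digit fewer. A reverse step [v i > 0] comes from a step [0] that removed the digit [v i], and the
   preimage reads one digit more. In both cases [w] lists the values before the exchange. *)
have [vi0|vi0] := eqVneq (v i) 0%N.
  have [v0|v0] := eqVneq (v (PU 0)) 0%N.
    transitivity (0 : R); last by rewrite -[iota 0 J.+1]/(0%N :: iota 1 J) big_cons v0 [m (PU 0) 0]/= !mul0r mulr0.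
    apply: (pr_null_sub mpre mN) => // y /= /cylL[]; rewrite psi_at vi0.
    have [_ //|yi] := eqVneq (y i) 0%N => _ /(_ 0%N isT).
    by rewrite v0 /psi /= (negbTE yi) => h; rewrite h eqxx in yi.
  pose w : V := fun k => if k == i then v (PU 0) else if k is PU j then v (PU j.+1) else v k.
  transitivity (pr nu (cyl (L J) w)).
    apply: (pr0_ext mpre (measurable_cyl _ _) mN N0) => y /eqP ny; split.
      move=> /cylL[]; rewrite psi_at vi0 => + h2 h3.
      have [_ /eqP|yi _] := eqVneq (y i) 0%N; first by rewrite (negbTE ny).
      apply/cylL; rewrite /w /= eqxx; split=> [|j jn|k kl].
      - by have := h2 0%N isT; rewrite /psi /= (negbTE yi).
      - by have := h2 j.+1 jn; rewrite /psi /= (negbTE yi).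
      - by rewrite -psi_l'// h3//; have [/negbTE-> ] := l'P _ kl; case: (k).
    move=> /cylL[]; rewrite /w /= eqxx => h1 h2 h3; apply/cylL.
    rewrite psi_at vi0 h1 (negbTE v0); split => [//|[|j] jn|k kl].
    - by rewrite /psi /= h1 (negbTE v0).
    - by rewrite /psi /= h1 (negbTE v0) h2.
    - by rewrite psi_l'// h3//; have [/negbTE-> ] := l'P _ kl; case: (k).
  rewrite prcyl prodL vi0 {1}/w eqxx -(@psi_marg pp ww 0 (v (PU 0)))// -mulrA; congr (_ * _).
  rewrite big_cons -mulrA; congr (_ * _); congr (_ * _).
    by rewrite -[RHS]/(\prod_(j <- iota (1 + 0) J) m (PU j) (v (PU j))) iotaDl big_map.
  rewrite !big_seq; apply: eq_bigr => k kl; rewrite /w.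
  by have [/negbTE-> ] := l'P _ kl; case: (k).
pose w : V := fun k => if k == i then 0%N else if k is PU j then (if j is j'.+1 then v (PU j') else v i) else v k.
transitivity (pr nu (cyl (L J.+2) w)).
  congr pr; apply/seteqP; split => y /=.
    move=> /cylL[]; rewrite psi_at => + h2 h3.
    have [yi h1|yi h1] := eqVneq (y i) 0%N; last by rewrite -h1 eqxx in vi0.
    apply/cylL; rewrite /w /= eqxx; split => [//|[|j] jn //|k kl].
      by have := h2 j jn; rewrite /psi /= yi.
    by rewrite -psi_l'// h3//; have [/negbTE-> ] := l'P _ kl; case: (k).
  move=> /cylL[]; rewrite /w /= eqxx => h1 h2 h3.
  apply/cylL; rewrite psi_at h1 /=; split => [|j jn|k kl].
  - exact: (h2 0%N).
  - by rewrite /psi /= h1 /=; exact: (h2 j.+1).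
  - by rewrite psi_l'// h3//; have [/negbTE-> ] := l'P _ kl; case: (k).
rewrite prcyl prodL {1}/w eqxx -(@psi_marg pp ww 0 (v i))// -mulrA; congr (_ * _).
rewrite -[iota 0 J.+2]/(0%N :: iota 1 J.+1) big_cons -mulrA; congr (_ * _); congr (_ * _).
  by rewrite -[LHS]/(\prod_(j <- iota (1 + 0) J.+1) m (PU j) (w (PU j))) iotaDl big_map.
rewrite !big_seq; apply: eq_bigr => k kl; rewrite /w.
by have [/negbTE-> ] := l'P _ kl; case: (k).
Qed.

Lemma measurable_psis e r : measurable_fun setT (psis e r : VT -> VT).
Proof.
elim: r => [|r IH]; first exact: measurable_id.
by apply: (measurableT_comp (measurable_psi (e r.+1)) IH).
Qed.

Lemma psis_preserves e r A : (forall k, isPX (e k)) -> measurable A ->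
  nu [set y | A (psis e r y : VT)] = nu A.
Proof.
move=> he; elim: r A => [//|r IH] A mA.
rewrite -[RHS](psi_preserves (he r.+1) mA).
by rewrite -[RHS]IH//; exact: (measurable_precomp (measurable_psi _) mA).
Qed.

Lemma measurable_Psi q : measurable_fun setT (Psi q : VT -> VT).
Proof. exact: (measurableT_comp (measurable_psi _) (measurable_psis spine q)). Qed.

Lemma Psi_preserves q A : measurable A -> nu [set y | A (Psi q y : VT)] = nu A.
Proof.
move=> mA; rewrite -[RHS](@psi_preserves (PX q [:: brk q]) _ isT mA).
rewrite -[RHS](@psis_preserves spine q)//.
exact: (measurable_precomp (measurable_psi _) mA).
Qed.

Lemma Psi_qis q q' y : qis q (Psi q' y) = qis q y.
Proof.
have h i : ~~ isPU i -> ~~ isPX i -> Psi q' y i = y i.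
  by move=> iU iX; rewrite /Psi psi_other ?psis_other//; case: i iU iX.
rewrite /qis; case: q => [|q]; rewrite !h//.
by congr (_ && (_ && _)); apply: eq_all => j; rewrite h.
Qed.

Lemma measurable_Rq q : measurable_fun setT (Rq q : VT -> VT).
Proof.
apply: measurable_coord_map => k; rewrite /Rq.
have mc j : dmeas (fun x : VT => x j) := @dmeas_coord j.
by case: k => [p w|[|p]|j|p w] //; case: q => // q; exact: (dmeas_comp predn).
Qed.

Lemma measurable_qis q : dmeas (fun y : VT => qis q y).
Proof.
have mc j : dmeas (fun x : VT => x j) := @dmeas_coord j.
have ma n : dmeas (fun y : VT => all (fun j => y (PK j) <= 1)%N (iota 0 n)).
  elim: (iota 0 n) => [|j s IH] /=; first exact: dmeas_cst.
  exact: (dmeas_comp2 andb (dmeas_comp (fun a => (a <= 1)%N) (mc (PK j))) IH).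
case: q => [|q] /=; first exact: (dmeas_comp (fun a => (0 < a)%N) (mc _)).
apply: (dmeas_comp2 andb (dmeas_comp (fun a => a == 0%N) (mc _))).
exact: (dmeas_comp2 andb (ma _) (dmeas_comp (fun a => (1 < a)%N) (mc _))).
Qed.

Definition rhoV (q : nat) (j : prim) : prim :=
  match j with
  | PK p => PK (p - q).+1
  | PN p (a :: w) =>
      if (p == q) && (brk q <= a)%N then
        (if a == brk q then PN 0 w else PN 1 ((a - brk q)%N :: w))
      else if (q < p)%N && (0 < a)%N then PN (p - q).+1 (a :: w) else j
  | PX p [::] => if (q < p)%N then PX (p - q).+1 [::] else j
  | PX p (a :: w) =>
      if (p == q) && (brk q <= a)%N then
        (if a == brk q then PX (w == [::]) w else PX 1 ((a - brk q)%N :: w))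
      else if (q < p)%N && (0 < a)%N then PX (p - q).+1 (a :: w) else j
  | _ => j
  end.

Lemma rhoK q i : i != PK 0 -> rhoV q (rho q i) = i.
Proof.
have e1 p : (q + p.+1 == q)%N = false by apply/negbTE; lia.
have e2 p : (q < q + p.+1)%N by lia.
have e3 p : (q + p.+1 - q).+1 = p.+2 by lia.
have e4 a : (a.+1 + brk q == brk q)%N = false by apply/negbTE; lia.
have e5 p : ((p.+1 == q) && (brk q <= 0))%N = false.
  by rewrite /brk; case: eqP => [<-|].
case: i => [[|[|p]] [|[|a] u]|[|p]|jj|[|[|p]] [|[|a] u]] // _; rewrite /rho /rhoV;
  by rewrite ?eqxx ?leqnn ?leq_addl ?e1 ?e2 ?e3 ?e4 ?e5 /= ?addnK ?addKn ?eqxx ?andbF ?ltn0.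
Qed.

Lemma rho_inj q i j : i != PK 0 -> j != PK 0 -> rho q i = rho q j -> i = j.
Proof. by move=> hi hj e; rewrite -(rhoK q hi) e rhoK. Qed.

Lemma rho_marg q i : i != PK 0 -> m (rho q i) = m i.
Proof. by case: i => [[|[|p]] [|[|a] u]|[|p]|jj|[|[|p]] [|[|a] u]]. Qed.

Let mc j : dmeas (fun x : VT => x j) := @dmeas_coord j.

Lemma pr_PK_le1 j : pr nu [set y : VT | (y (PK j) <= 1)%N] = mubar 1.
Proof.
have -> : [set y : VT | (y (PK j) <= 1)%N] =
    [set y : VT | y (PK j) = 0%N] `|` [set y : VT | y (PK j) = 1%N].
  apply/seteqP; split => y /=; first by case: (y (PK j)) => [|[]]; [left|right|].
  by case=> ->.
rewrite pr_disjU ?(law_coord law) ?add0r//.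
- exact: mc.
- exact: mc.
- by apply/seteqP; split => y //= -[->].
Qed.

Let late n : set VT :=
  [set y : VT | y (PN 0 [::]) = 0%N /\ forall j, (j < n)%N -> (y (PK j) <= 1)%N].

Let mlate n : measurable (late n).
Proof.
apply: meas_and; first exact: mc.
apply: meas_forall => j; apply: meas_imply; first exact: meas_const.
exact: (meas_coord (PK j) (fun a => (a <= 1)%N)).
Qed.

Let insens_late n i : (forall p, i != PN 0 p) -> (forall j, (j < n)%N -> i != PK j) -> insens i (late n).
Proof.
move=> hN hK y k; rewrite /late /= upd_neq 1?eq_sym//.
by split=> -[h1 h2]; split=> // j jn; have := h2 j jn; rewrite upd_neq 1?eq_sym ?hK.
Qed.

Let pr_late n : pr nu (late n) = mu 0 * mubar 1 ^+ n.
Proof.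
elim: n => [|n IH].
  rewrite expr0 mulr1 -[RHS]/(m (PN 0 [::]) 0) -(law_coord law).
  by congr pr; apply/seteqP; split => y /= => [[]|].
have -> : late n.+1 = late n `&` [set y : VT | (y (PK n) <= 1)%N].
  apply/seteqP; split => y /=.
    move=> [h1 h2]; split; last exact: h2.
    by split=> // j jn; apply: h2; exact: ltnW.
  move=> [[h1 h2] h3]; split => // j; rewrite ltnS leq_eqVlt => /orP[/eqP->//|]; exact: h2.
rewrite (@indep_coord _ nu m m_ge0 law _ _ (fun a => (a <= 1)%N))//.
  by rewrite pr_PK_le1 IH exprSr mulrA.
apply: insens_late => // j jn; by apply/eqP => -[?]; subst; rewrite ltnn in jn.
Qed.

Let first_coord q k : set VT := [set y : VT | qis q y /\ Rq q y (PK 0) = k].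

Let mfirst q k : measurable (first_coord q k).
Proof.
apply: meas_and; first exact: measurable_qis.
exact: (dmeas_precomp (measurable_Rq q) (mc (PK 0))).
Qed.

Let pr_first0 k : pr nu (first_coord 0 k) = if k == 0%N then 0 else mu k.
Proof.
have [->|k0] := eqVneq k 0%N.
  rewrite (_ : first_coord _ _ = set0) ?/pr ?measure0//.
  by apply/seteqP; split => y //= -[/= + h]; rewrite h.
rewrite -[RHS]/(m (PN 0 [::]) k) -(law_coord law).
congr pr; apply/seteqP; split => y /=; first by case.
by move=> h; split; rewrite /= h ?lt0n.
Qed.

Let pr_first q k : pr nu (first_coord q.+1 k) =
  if k == 0%N then 0 else mu 0 * mubar 1 ^+ q * mubar k.+1.
Proof.
have [->|k0] := eqVneq k 0%N.
  rewrite (_ : first_coord _ _ = set0) ?/pr ?measure0//.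
  apply/seteqP; split => y //= -[/and3P[_ _] /=].
  by case: (y (PK q)) => [|[]].
have -> : first_coord q.+1 k = late q `&` [set y : VT | y (PK q) = k.+1].
  apply/seteqP; split => y /=.
    move=> [/and3P[/eqP h1 /allP h2 h3] h4]; split; last first.
      by move: h3 h4 => /=; case: (y (PK q)) => [//|n] _ /= ->.
    by split => // j jq; apply: h2; rewrite mem_iota.
  move=> [[h1 h2] h3]; split; rewrite /= ?h1 h3//= ltnS lt0n k0 andbT.
  by apply/allP => j; rewrite mem_iota => /andP[_ ?]; exact: h2.
rewrite (indep_coord_eq m_ge0 law)// ?pr_late//.
apply: insens_late => // j jn; by apply/eqP => -[?]; subst; rewrite ltnn in jn.
Qed.

(** The number of children of the new first ancestor has law [mubar] again. The terms are [mu k],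
    then [mu 0 * mubar 1 ^+ q * mubar k.+1]; as [mu 0 = 1 - mubar 1], the geometric series sums to
    [mubar k.+1], and [mu k + mubar k.+1 = mubar k]. *)
Let sum_first k : (\sum_(q <oo) (pr nu (first_coord q k))%:E)%E = (m (PK 0) k)%:E.
Proof.
rewrite /m /=; have [->|k0] := eqVneq k 0%N.
  by apply: eseries0 => -[|q] _ _; rewrite ?pr_first0 ?pr_first.
have partial n : \sum_(0 <= q < n.+1) pr nu (first_coord q k) =
    mubar k - mubar 1 ^+ n * mubar k.+1.
  elim: n => [|n IH].
    by rewrite big_nat1 pr_first0 (negbTE k0) (mubarE k) expr0 mul1r addrK.
  rewrite big_nat_recr//= IH pr_first (negbTE k0) exprSr mubar1; ring.
apply/cvg_lim => //; rewrite -cvg_shiftS /=.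
under eq_fun do rewrite sumEFin partial.
apply: cvg_EFin; first by near=> n.
rewrite -[X in _ --> X]subr0; apply: cvgB; first exact: cvg_cst.
(* If [mu 0 = 0] the geometric factor stays equal to 1, but then [mubar k.+1] vanishes for [k > 0]
   by [mubar2_le]. *)
have [mu00|mu00] := eqVneq (mu 0) 0.
  have -> : mubar k.+1 = 0.
    apply/eqP; rewrite eq_le mubar_ge0 andbT -mu00; apply: le_trans mubar2_le.
    case: k k0 {partial} => // k _; elim: k => [//|k IH].
    by apply: le_trans IH; rewrite (mubarE k.+2) lerDr.
  by under eq_fun do rewrite mulr0; exact: cvg_cst.
rewrite -(mul0r (mubar k.+1)); apply: cvgMl; apply: cvg_expr.
rewrite ger0_norm ?mubar_ge0// mubar1; have := mu_ge0 0; lra.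
Unshelve. all: by end_near.
Qed.

Let pr_reindex (E : set VT) q (l : seq prim) (v : V) : measurable E -> uniq l -> PK 0 \notin l ->
  (forall i, i \in l -> insens (rho q i) E) ->
  pr nu (E `&` [set y : VT | forall i, i \in l -> y (rho q i) = v i]) =
  pr nu E * \prod_(i <- l) m i (v i).
Proof.
move=> mE; elim: l => [|i l IH].
  by move=> *; rewrite big_nil mulr1; congr pr; apply/seteqP; split => y /=; [case|].
rewrite /= inE negb_or => /andP[il ul] /andP[i0 l0] fE; rewrite big_cons.
have mC : measurable [set y : VT | forall i, i \in l -> y (rho q i) = v i].
  apply: meas_forall => j; apply: meas_imply; [exact: meas_const|exact: mc].
have -> : E `&` [set y : VT | forall j, j \in i :: l -> y (rho q j) = v j] =
    (E `&` [set y : VT | forall i, i \in l -> y (rho q i) = v i]) `&`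
    [set y : VT | y (rho q i) = v i].
  apply/seteqP; split => y /=.
    move=> [h1 h2]; split; first by split => // j jl; apply: h2; rewrite inE jl orbT.
    by apply: h2; rewrite inE eqxx.
  by move=> [[h1 h2] h3]; split=> // j; rewrite inE => /orP[/eqP->//|]; exact: h2.
rewrite (indep_coord_eq m_ge0 law).
- rewrite IH//; last by move=> j jl; apply: fE; rewrite inE jl orbT.
  by rewrite [m (rho q i)](@rho_marg q) 1?eq_sym// mulrCA mulrC mulrA.
- exact: measurableI.
- apply: insens_setI; first by apply: fE; rewrite inE eqxx.
  have hne j : j \in l -> rho q j != rho q i.
    move=> jl; apply/eqP => /rho_inj e; move: il; rewrite -(e _ _) ?jl//.
      by apply: contraNneq l0 => <-.
    by rewrite eq_sym.
  by move=> y k /=; split=> h j jl; have := h j jl; rewrite upd_neq ?hne.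
Qed.

(** The event [qis q] and the new [PK 0] read none of the coordinates that [Rq q] gives to the other
    names. On [qis q] these are therefore still independent with their marginals, and summing over
    [q] only concerns the law of [PK 0], which is [sum_first]. *)
Lemma Rq_law A : measurable A ->
  nu A = (\sum_(q <oo) nu ([set y : VT | A (Rq q y)] `&` [set y : VT | qis q y]))%E.
Proof.
have mq q : measurable [set y : VT | qis q y] by exact: measurable_qis.
pose mk q : {measure set VT -> \bar R} :=
  measure_function_pushforward__canonical__measure_function_Measure
    (mrestr nu (mq q)) (measurable_Rq q).
have /= := @cyl_measure_unique R nu (mseries mk 0) _ _ A.
apply.
  by rewrite probability_setT ltry.
move=> l; exists (PK 0 :: undup [seq k <- l | k != PK 0]).
  by move=> k kl; rewrite inE mem_undup mem_filter kl andbT; case: eqP.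
move=> v; set l' := undup _.
have l0 : PK 0 \notin l' by rewrite mem_undup mem_filter eqxx.
have ul' : uniq l' by rewrite undup_uniq.
change (nu (cyl (PK 0 :: l') v) =
  (\sum_(q <oo) nu ([set y : VT | cyl (PK 0%N :: l') v (Rq q y : VT)] `&` [set y : VT | qis q y]))%E).
rewrite law/=; last by rewrite l0.
rewrite big_cons mulrC EFinM -sum_first -nneseriesZl; last by move=> q _; rewrite lee_fin pr_ge0.
apply: eq_eseriesr => q _.
have mpre : measurable ([set y : VT | cyl (PK 0 :: l') v (Rq q y : VT)] `&` [set y : VT | qis q y]).
  apply: measurableI => //.
  exact: (measurable_precomp (measurable_Rq q) (measurable_cyl _ _)).
rewrite (prE nu mpre) -EFinM; congr EFin; rewrite mulrC -(@pr_reindex _ q)//; last first.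
  move=> i il; have i0 : i != PK 0 by apply: contraNneq l0 => <-.
  case: q {mpre} => [|q].
    have e k : qis 0 (upd k.1 (rho 0 i) k.2) = qis 0 k.1 /\
      Rq 0 (upd k.1 (rho 0 i) k.2) (PK 0) = Rq 0 k.1 (PK 0).
      by rewrite /= upd_neq//; case: (i) => [[|[|p]] [|[|a] u]|[|p]|jj|[|[|p]] [|[|a] u]].
    by move=> y k; rewrite /first_coord /=; have [/= -> ->] := e (y, k).
  move=> y k; rewrite /first_coord /=.
  have e j : (j <= q)%N -> upd y (rho q.+1 i) k (PK j) = y (PK j).
    move=> jq; rewrite upd_neq//; case: (i) i0 => [[|[|p]] [|[|a] u]|[|p]|jj|[|[|p]] [|[|a] u]] //= _.
    by apply/eqP => -[]; lia.
  rewrite (e q)// upd_neq; last by case: (i) i0 => [[|[|p]] [|[|a] u]|[|p]|jj|[|[|p]] [|[|a] u]].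
  have -> // : all (fun j => upd y (rho q.+1 i) k (PK j) <= 1)%N (iota 0 q) =
    all (fun j => y (PK j) <= 1)%N (iota 0 q).
  by apply: eq_in_all => j; rewrite mem_iota => /andP[_ /ltnW jq]; rewrite e.
congr pr; rewrite cyl_cons; apply/seteqP; split => y /= [[h1 h2] h3].
  split; last exact: h1.
  split; first exact: h2.
  move=> i il; rewrite -h3//.
  by case: i il => [| [|p]| |] //= il; rewrite il in l0.
split => // i il; rewrite -h2//.
by case: i il => [| [|p]| |] //= il; rewrite il in l0.
Qed.

End Invariance.

(** * Measurability of the successor map and of the observables of the tree *)

Lemma measurable_shiftT : measurable_fun setT (shiftT : VT -> VT).
Proof.
apply: measurable_coord_map => i t.
have -> : [set y : VT | shiftT y i = t] = [set y : VT |
    (exists q, qis q y /\ Rq q (Psi q y) i = t) \/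
    (~ (exists q, qis q y) /\ y i = t)].
  apply/seteqP; split => y /=.
    move=> h; case: (pselect (exists q, qis q y)) => [[q hq]|nq].
      by left; exists q; rewrite -(shiftTE hq).
    by right; split => //; move: h; rewrite /shiftT; case: pselect.
  move=> [[q [hq <-]]|[nq <-]]; first by rewrite (shiftTE hq).
  by rewrite /shiftT; case: pselect.
apply: meas_or.
  apply: meas_exists => q; apply: meas_and; first exact: measurable_qis.
  have h := measurableT_comp (measurable_Rq q) (measurable_Psi q).
  exact: (dmeas_precomp h (@dmeas_coord i)).
apply: meas_and; last exact: dmeas_coord.
apply: meas_not; apply: meas_exists => q; exact: measurable_qis.
Qed.

Section ObservableMeasurability.

Definition obs (j : nat) (t : option W) : option (int * nat) :=
  omap (fun x : W => (x.1, x.2 j)) t.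

Definition wmeas (f : VT -> W) :=
  dmeas (fun y => (f y).1) /\ forall j, dmeas (fun y => (f y).2 j).

Lemma wmeas_stepW f i : wmeas f -> wmeas (fun y => stepW (y i) (f y)).
Proof.
have mc : dmeas (fun x : VT => x i) := @dmeas_coord i.
move=> [h1 h2]; split => [|j].
  apply: (@dmeas_bind _ _ nat _ (fun y : VT => y i) (fun s y => (stepW s (f y)).1)) => // -[|s].
    exact: (dmeas_comp (fun a : int => a - 1) h1).
  exact: (dmeas_comp (fun a : int => a + 1) h1).
apply: (@dmeas_bind _ _ nat _ (fun y : VT => y i) (fun s y => (stepW s (f y)).2 j)) => // -[|s].
  exact: h2.
by case: j => [|j]; [exact: dmeas_cst|exact: h2].
Qed.

Lemma wmeas_anc p : wmeas (fun y => ancV y p).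
Proof.
elim: p => [|p IH].
  by split => [|j]; [exact: dmeas_cst|exact: dmeas_coord].
exact: (wmeas_stepW (PX p.+1 [::]) IH).
Qed.

Lemma wmeas_walk p pre w f : wmeas f ->
  wmeas (fun y => walk (fun u => y (PX p u)) pre (f y) w).
Proof.
elim: w pre f => [//|i w IH] pre f hf /=.
apply: (IH (rcons pre i) (fun y => stepW (y (PX p (rcons pre i))) (f y))).
exact: wmeas_stepW.
Qed.

Lemma dmeas_inGW p pre w : dmeas (fun y : VT => inGW (fun u => y (PN p u)) pre w).
Proof.
elim: w pre => [|i w IH] pre /=; first exact: dmeas_cst.
exact: (dmeas_comp2 andb (dmeas_comp (fun a => (i < a)%N) (@dmeas_coord _)) (IH _)).
Qed.

Lemma dmeas_obs_some j c f : dmeas c -> wmeas f ->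
  dmeas (fun y : VT => obs j (if c y then Some (f y) else None)).
Proof.
move=> mc [h1 h2].
have : dmeas (fun y : VT => if c y then Some ((f y).1, (f y).2 j) else None).
  apply: dmeas_if => //; last exact: dmeas_cst.
  exact: (dmeas_comp2 (fun a b => Some (a, b)) h1 (h2 j)).
by congr dmeas; apply/funext => y; case: (c y).
Qed.

Lemma dmeas_obs_B j p w : dmeas (fun y : VT => obs j (B y p w)).
Proof.
elim: p w => [|p IH] w.
  apply: dmeas_obs_some; first exact: dmeas_inGW.
  exact: (wmeas_walk 0 [::] w (wmeas_anc 0)).
case: w => [|[|i] w].
- by apply: (@dmeas_obs_some j (fun=> true)); [exact: dmeas_cst|exact: (wmeas_anc p.+1)].
- exact: IH.
- apply: (@dmeas_obs_some j (fun y => (i.+1 < y (PK p))%N &&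
      inGW (fun u => y (PN p.+1 u)) [:: i.+1] w)).
    exact: (dmeas_comp2 andb (dmeas_comp (fun a => (i.+1 < a)%N) (@dmeas_coord _))
      (dmeas_inGW p.+1 [:: i.+1] w)).
  exact: (wmeas_walk p.+1 [::] (i.+1 :: w) (wmeas_anc p.+1)).
Qed.

Lemma dmeas_hgt_B p w : dmeas (fun y : VT => hgt (B y p w)).
Proof.
have : dmeas (fun y : VT => if obs 0 (B y p w) is Some x then x.1 else 0).
  exact: (dmeas_comp (fun t : option (int * nat) => if t is Some x then x.1 else 0)
    (dmeas_obs_B 0 p w)).
by congr dmeas; apply/funext => y; case: (B y p w).
Qed.

Lemma dmeas_present p w : dmeas (fun y : VT => isSome (B y p w)).
Proof.
have : dmeas (fun y : VT => isSome (obs 0 (B y p w))).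
  exact: (dmeas_comp (fun t : option (int * nat) => isSome t) (dmeas_obs_B 0 p w)).
by congr dmeas; apply/funext => y; case: (B y p w).
Qed.

Lemma obs_shift j h t :
  obs j (omap (shiftW h) t) = omap (fun x : int * nat => (x.1 - h, x.2)) (obs j t).
Proof. by case: t. Qed.

Lemma dmeas_obs_shift j (h : VT -> int) p w : dmeas h ->
  dmeas (fun y : VT => obs j (omap (shiftW (h y)) (B y p w))).
Proof.
move=> mh.
have := @dmeas_comp2 _ _ _ _ _ _ _ (fun (t : option (int * nat)) h =>
   omap (fun x : int * nat => (x.1 - h, x.2)) t) (dmeas_obs_B j p w) mh.
by congr dmeas; apply/funext => y; rewrite obs_shift.
Qed.

Lemma dmeas_obs_sccq j q p w : dmeas (fun y : VT => obs j (sccq q (B y) p w)).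
Proof.
have ms p' w' := @dmeas_obs_shift j _ p' w' (dmeas_hgt_B _ _).
case: q => [|q]; first by case: p => [|p]; exact: ms.
elim: p w => [|[|p] IH] w; first exact: ms.
  by case: w => [|i w]; exact: ms.
by case: w => [|[|i] w]; [exact: ms|exact: IH|exact: ms].
Qed.

Lemma dmeas_obs_scc j p w : dmeas (fun y : VT => obs j (scc (B y) p w)).
Proof.
move=> t.
have -> : [set y : VT | obs j (scc (B y) p w) = t] = [set y : VT |
    (exists q, qis q y /\ obs j (sccq q (B y) p w) = t) \/
    (~ (exists q, qis q y) /\ obs j (B y p w) = t)].
  apply/seteqP; split => y /=.
    move=> h; case: (pselect (exists q, qis q y)) => [[q hq]|nq].
      by left; exists q; rewrite -(sccE hq).
    by right; split => //; rewrite -(scc_stuck nq).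
  move=> [[q [hq <-]]|[nq <-]]; first by rewrite (sccE hq).
  by rewrite scc_stuck.
apply: meas_or.
  by apply: meas_exists => q; apply: meas_and; [exact: measurable_qis|exact: dmeas_obs_sccq].
apply: meas_and; last exact: dmeas_obs_B.
apply: meas_not; apply: meas_exists => q; exact: measurable_qis.
Qed.

Lemma measurable_Theta (f : VT -> Theta) (A : set Theta) :
  (forall j p w, dmeas (fun y => obs j (f y p w))) -> <<s cyl_gen >> A ->
  measurable [set y | A (f y)].
Proof.
move=> hf; apply: (@smallest_sub _ _ _ [set A : set Theta | measurable [set y | A (f y)]]).
  split => /=.
  - exact: measurable0.
  - move=> A1 mA; rewrite (_ : [set _ | _] = ~` [set y | A1 (f y)]).
      exact: measurableC.
    by apply/seteqP; split => y /=; [case|].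
  - move=> F mF; rewrite (_ : [set _ | _] = \bigcup_k [set y | F k (f y)]).
      exact: bigcupT_measurable.
    by apply/seteqP; split => y /= [k _ h]; exists k.
by move=> _ [p [w [j [v ->]]]]; exact: hf.
Qed.

End ObservableMeasurability.

(** * Stationarity under the right-successor *)

Section Stationarity.
Context {R : realType}.
Variables (b : nat) (mu mubar : nat -> R) (nu : probability VT R).
Hypothesis HL : brw_law b mu mubar nu.
Let m := marg b mu mubar.
Let law : forall (l : seq prim) v, uniq l ->
  nu (cyl l v) = (\prod_(i <- l) m i (v i))%:E := bl_law HL.
Let mq q : measurable [set y : VT | qis q y] := @measurable_qis q true.
Let mqe : measurable [set y : VT | exists q, qis q y].
Proof. exact: meas_exists. Qed.

Let qis_bigcup : [set y : VT | exists q, qis q y] = \bigcup_q [set y : VT | qis q y].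
Proof. by apply/seteqP; split => y /= [q]; exists q. Qed.

Let nu_qis (A : set VT) : measurable A ->
  nu (A `&` [set y | exists q, qis q y]) = (\sum_(q <oo) nu (A `&` [set y : VT | qis q y]))%E.
Proof.
move=> mA; rewrite qis_bigcup setI_bigcupr measure_bigcup//.
- by apply: eq_eseriesl => q; rewrite in_setT.
- by move=> q _; exact: measurableI.
- apply/trivIsetP => i j _ _ ij; apply/seteqP; split => y //= -[[_ hi] [_ hj]].
  by move: ij; rewrite (qis_inj hi hj) eqxx.
Qed.

(** [Rq_law] for the whole space says that the probabilities of the disjoint events [qis q] add up
    to 1. *)
Lemma stuck_null : pr nu (~` [set y : VT | exists q, qis q y]) = 0.
Proof.
rewrite pr_setC//.
have h : nu [set y : VT | exists q, qis q y] = nu setT.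
  rewrite -[[set y | _]]setTI nu_qis// [RHS](Rq_law HL measurableT).
  apply: eq_eseriesr => q _; congr (nu _).
rewrite /pr h probability_setT /=; lra.
Qed.

(** On [qis q] the map is [Psi q] followed by [Rq q]; [Psi q] preserves both the law and the event
    [qis q], and [Rq_law] puts the pieces together. *)
Lemma shiftT_preserves (A : set VT) : measurable A -> pr nu [set y | A (shiftT y : VT)] = pr nu A.
Proof.
move=> mA.
have mT : measurable [set y : VT | A (shiftT y : VT)].
  exact: (measurable_precomp measurable_shiftT mA).
rewrite -(@pr_positive_nonnull _ _ _ nu _ _ mT (measurableC mqe) stuck_null) setCK.
apply: EFin_inj; rewrite -!prE//; last exact: measurableI.
rewrite nu_qis// (Rq_law HL)//; apply: eq_eseriesr => q _.
have mR : measurable ([set y : VT | A (Rq q y)] `&` [set y : VT | qis q y]).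
  by apply: measurableI => //; exact: (measurable_precomp (measurable_Rq q) mA).
rewrite -[RHS](Psi_preserves HL q mR); congr (nu _); apply/seteqP; split => y /= [h hq].
  by split; rewrite ?Psi_qis// -(shiftTE hq).
by move: hq; rewrite Psi_qis => hq; split => //; rewrite (shiftTE hq).
Qed.

Lemma U_pos_null : pr nu [set y : VT | exists j, y (PU j) = 0%N] = 0.
Proof.
by apply: pr_null_exists => j; [exact: dmeas_coord|rewrite (law_coord law)].
Qed.

Definition regular : set VT := [set y : VT | (exists q, qis q y) /\ forall j, (0 < y (PU j))%N].

Lemma measurable_regular : measurable regular.
Proof.
apply: meas_and => //; apply: meas_forall => j.
exact: (meas_coord (PU j) (fun a => (0 < a)%N)).
Qed.

Lemma regular_null : pr nu (~` regular) = 0.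
Proof.
apply/eqP; rewrite eq_le pr_ge0 andbT -[leRHS]addr0 -{1}stuck_null -U_pos_null.
apply: pr_leD.
- by apply: measurableC; exact: measurable_regular.
- exact: measurableC.
- by apply: meas_exists => j; exact: dmeas_coord.
- move=> y /= h; case: (pselect (exists q, qis q y)) => hq; [right|by left].
  apply: contrapT => hj; apply: h; split => // j; rewrite lt0n; apply/eqP => h.
  by apply: hj; exists j.
Qed.

Lemma scc_invariant (A : set Theta) : <<s cyl_gen >> A ->
  pr nu [set y | A (B y)] = pr nu [set y | A (scc (B y))].
Proof.
move=> hA.
have mB : measurable [set y : VT | A (B y)].
  by apply: measurable_Theta hA => j p w; exact: dmeas_obs_B.
rewrite -(shiftT_preserves mB).
apply: (pr0_ext _ _ (measurableC measurable_regular) regular_null).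
- exact: (measurable_precomp measurable_shiftT mB).
- by apply: measurable_Theta hA => j p w; exact: dmeas_obs_scc.
- by move=> y /contrapT[[q hq] hU] /=; rewrite (B_shiftT hq hU).
Qed.

End Stationarity.

(** * Lexicographic exploration *)

Definition jump (th : Theta) (p : nat) (w : seq nat) : nat * seq nat :=
  match pselect (exists q, (p < q)%N && isSome (th q [:: 1%N])) with
  | left H => (ex_minn H, [:: 1%N])
  | right _ => (p, w)
  end.

Lemma lex_succE th p w : lex_succ th (p, w) =
  if isSome (th p (rcons w 0%N)) then (p, rcons w 0%N)
  else if nextw_rev th p (rev w) is Some w' then (p, w') else jump th p w.
Proof. by []. Qed.

Lemma jump_some (th : Theta) p w q : (p < q)%N -> isSome (th q [:: 1%N]) ->
  (forall k, (p < k < q)%N -> ~~ isSome (th k [:: 1%N])) -> jump th p w = (q, [:: 1%N]).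
Proof.
move=> pq hq hmin; rewrite /jump; case: pselect => [H|[]]; last by exists q; rewrite pq.
case: ex_minnP => n /andP[pn hn] min; congr pair; apply/eqP; rewrite eqn_leq min ?pq//=.
by rewrite leqNgt; apply/negP => nq; have := hmin n; rewrite pn nq hn => /(_ isT).
Qed.

Lemma jump_none (th : Theta) p w : (forall k, (p < k)%N -> ~~ isSome (th k [:: 1%N])) ->
  jump th p w = (p, w).
Proof.
move=> h; rewrite /jump; case: pselect => // H; exfalso.
have [q /andP[pq hq]] := H.
by have := h _ pq; rewrite hq.
Qed.

Lemma jumpP (th : Theta) p :
  (exists q, [/\ (p < q)%N, isSome (th q [:: 1%N]) &
     forall k, (p < k < q)%N -> ~~ isSome (th k [:: 1%N])]) \/
  (forall k, (p < k)%N -> ~~ isSome (th k [:: 1%N])).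
Proof.
case: (pselect (exists q, (p < q)%N && isSome (th q [:: 1%N]))) => [H|nH].
  left; exists (ex_minn H); case: ex_minnP => n /andP[pn hn] min; split => // k /andP[pk kn].
  by apply/negP => hk; have := min k; rewrite pk hk leqNgt kn => /(_ isT).
by right => k pk; apply/negP => hk; apply: nH; exists k; rewrite pk.
Qed.

(** From a vertex off the ancestral line, the search for the successor only tests vertices off this
    line that are grafted on the same ancestor or on a higher one. Two trees that agree on the
    presence of these, up to a shift of the index, are explored in parallel. *)
Lemma lex_succ_far (th th' : Theta) a a' p i w :
  (forall p i w, isSome (th' (a' + p)%N (i.+1 :: w)) = isSome (th (a + p)%N (i.+1 :: w))) ->
  exists p1 i1 w1, lex_succ th' ((a' + p)%N, i.+1 :: w) = ((a' + p1)%N, i1.+1 :: w1) /\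
    lex_succ th ((a + p)%N, i.+1 :: w) = ((a + p1)%N, i1.+1 :: w1).
Proof.
move=> h; rewrite !lex_succE !rcons_cons h.
case: ifP => _; first by exists p, i, (rcons w 0%N).
have e rw : nextw_rev th (a + p) (rcons rw i.+1) = nextw_rev th' (a' + p) (rcons rw i.+1) /\
    (forall w', nextw_rev th' (a' + p) (rcons rw i.+1) = Some w' ->
     exists i1 w1, w' = i1.+1 :: w1).
  elim: rw => [|j ru [IH1 IH2]] /=.
    rewrite h; split => // w'; case: ifP => // _ [<-]; by exists i.+1, [::].
  rewrite rev_rcons rcons_cons h; split; first by rewrite IH1.
  move=> w'; case: ifP => // _; last exact: IH2.
  by move=> [<-]; exists i, (rcons (rev ru) j.+1).
rewrite rev_cons; have [-> e2] := e (rev w).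
case E : (nextw_rev th' (a' + p) (rcons (rev w) i.+1)) => [w'|].
  by have [i1 [w1 ->]] := e2 _ E; exists p, i1, w1.
case: (jumpP th' (a' + p)) => [[q [pq hq hmin]]|hn].
  exists (q - a')%N, 0%N, [::]; rewrite (jump_some _ pq hq hmin) subnKC; last by lia.
  split => //; apply: jump_some.
  - lia.
  - by rewrite -h subnKC//; lia.
  - move=> k /andP[pk kq]; have := hmin (a' + (k - a))%N; rewrite h subnKC; last by lia.
    by apply; lia.
exists p, i, w; rewrite jump_none//; split => //; apply: jump_none => k pk.
have := hn (a' + (k - a))%N; rewrite h subnKC; last by lia.
by apply; lia.
Qed.

Section SuccessorExploration.
Variables (th th' : Theta) (q c : nat) (h : int).
Hypothesis e0 : forall w, th' 0%N w = omap (shiftW h) (th q (c :: w)).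
Hypothesis e1 : forall i w, th' 1%N (i :: w) = omap (shiftW h) (th q ((i + c)%N :: w)).
Hypothesis e2 : forall p i w,
  th' (2 + p)%N (i.+1 :: w) = omap (shiftW h) (th (q.+1 + p)%N (i.+1 :: w)).

Let isSome_omap (x : option W) : isSome (omap (shiftW h) x) = isSome x.
Proof. by case: x. Qed.

(* [emb v v'] : the vertex [v'] of the successor tree is the vertex [v] of the tree. *)
Inductive emb : nat * seq nat -> nat * seq nat -> Prop :=
| emb0 w : emb (q, c :: w) (0%N, w)
| emb1 i w : emb (q, (i.+1 + c)%N :: w) (1%N, i.+1 :: w)
| emb2 p i w : emb ((q.+1 + p)%N, i.+1 :: w) ((2 + p)%N, i.+1 :: w).

Lemma emb_label v v' : emb v v' -> th' v'.1 v'.2 = omap (shiftW h) (th v.1 v.2).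
Proof. by case=> [w|i w|p i w]; [exact: e0|exact: (e1 i.+1 w)|exact: e2]. Qed.

Let jump_emb p p' w w' : (p' = 1%N /\ p = q) \/ (exists k, p = (q.+1 + k)%N /\ p' = (2 + k)%N) ->
  emb (p, w) (p', w') -> emb (jump th p w) (jump th' p' w').
Proof.
move=> hp he; case: (jumpP th' p') => [[q' [pq hq' hmin]]|hn].
  have hq2 : (2 <= q')%N by move: hp => [[? ?]|[k []]]; lia.
  rewrite (jump_some _ pq hq' hmin).
  rewrite (@jump_some th p w (q.+1 + (q' - 2))%N).
  - by have := emb2 (q' - 2) 0 [::]; rewrite (subnKC hq2).
  - by move: hp => [[? ?]|[k []]]; lia.
  - by move: hq'; rewrite -(subnKC hq2) e2 isSome_omap subnKC.
  - move=> k /andP[pk kq]; have := hmin (2 + (k - q.+1))%N; rewrite e2 isSome_omap subnKC.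
      by apply; move: hp => [[? ?]|[j []]]; lia.
    by move: hp => [[? ?]|[j []]]; lia.
rewrite (jump_none _ hn) jump_none// => k pk.
have := hn (2 + (k - q.+1))%N; rewrite e2 isSome_omap subnKC.
  by apply; move: hp => [[? ?]|[j []]]; lia.
by move: hp => [[? ?]|[j []]]; lia.
Qed.

Lemma emb_succ v v' : emb v v' -> emb (lex_succ th v) (lex_succ th' v').
Proof.
case=> [w|i w|p i w]; last first.
- have [//|p1 [i1 [w1 [-> ->]]]] := @lex_succ_far th th' q.+1 2 p i w.
    by move=> p0 i0 w0; rewrite e2 isSome_omap.
  exact: emb2.
- rewrite !lex_succE !rcons_cons e1 isSome_omap.
  case: ifP => _; first exact: emb1.
  have e rw : (exists i1 w1, nextw_rev th' 1 (rcons rw i.+1) = Some (i1.+1 :: w1) /\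
       nextw_rev th q (rcons rw (i.+1 + c)%N) = Some ((i1.+1 + c)%N :: w1)) \/
      (nextw_rev th' 1 (rcons rw i.+1) = None /\ nextw_rev th q (rcons rw (i.+1 + c)%N) = None).
    elim: rw => [|j ru IH] /=.
      rewrite e1 isSome_omap; case: ifP => _; last by right.
      by left; exists i.+1, [::].
    rewrite !rev_rcons !rcons_cons e1 isSome_omap; case: ifP => // _.
    by left; exists i, (rcons (rev ru) j.+1).
  rewrite !rev_cons; have [[i1 [w1 [-> ->]]]|[-> ->]] := e (rev w); first exact: emb1.
  by apply: jump_emb; [left|exact: emb1].
- rewrite !lex_succE !rcons_cons e0 isSome_omap.
  case: ifP => _; first exact: emb0.
  (* Once the subtree of the new root is finished, the old tree backtracks to the sibling [c.+1],
     whereas the successor tree jumps to [(1, [:: 1])]: these are the same vertex. *)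
  have e rw : nextw_rev th q (rcons rw c) =
      if nextw_rev th' 0 rw is Some w' then Some (c :: w')
      else if isSome (th q [:: c.+1]) then Some [:: c.+1] else None.
    elim: rw => [//|j ru IH] /=.
    by rewrite rev_rcons rcons_cons e0 isSome_omap IH; case: ifP.
  rewrite rev_cons e; case: (nextw_rev th' 0 (rev w)) => [w'|]; first exact: emb0.
  have := e1 1 [::]; rewrite add1n => e11.
  case: ifP => hc.
    rewrite (@jump_some th' 0 w 1)//.
    - by rewrite -[[:: c.+1]]/[:: (1 + c)%N]; exact: emb1.
    - by rewrite e11 isSome_omap.
    - by move=> k; case: k.
  case: (jumpP th' 0) => [[q' [pq hq' hmin]]|hn].
    rewrite (jump_some _ pq hq' hmin).
    have hq2 : (2 <= q')%N.
      case: q' pq hq' {hmin} => [//|[|//]] _; by rewrite e11 isSome_omap hc.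
    rewrite (@jump_some th q (c :: w) (q.+1 + (q' - 2))%N).
    - by have := emb2 (q' - 2) 0 [::]; rewrite (subnKC hq2).
    - lia.
    - by move: hq'; rewrite -(subnKC hq2) e2 isSome_omap subnKC.
    - move=> k /andP[pk kq]; have := hmin (2 + (k - q.+1))%N; rewrite e2 isSome_omap subnKC//.
      by apply; lia.
  rewrite (jump_none _ hn) jump_none; first exact: emb0.
  move=> k pk; have := hn (2 + (k - q.+1))%N; rewrite e2 isSome_omap subnKC//.
  by apply.
Qed.

Lemma emb_label_succ n : lex_succ th (0%N, [::]) = (q, [:: c]) ->
  lex_label th' n = omap (shiftW h) (lex_label th n.+1).
Proof.
move=> start; rewrite /lex_label; apply: emb_label; rewrite /lex_vertex.
elim: n => [|n IH]; first by rewrite -[iter 1 _ _]/(lex_succ th (0%N, [::])) start; exact: emb0.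
by rewrite 2!iterS; apply: emb_succ.
Qed.

End SuccessorExploration.

Lemma lex_succ_root y q : qis q y -> lex_succ (B y) (0%N, [::]) = (q, [:: brk q]).
Proof.
rewrite lex_succE.
have -> : isSome (B y 0%N (rcons [::] 0%N)) = (0 < y (PN 0 [::]))%N.
  by rewrite /B /= /pcoord andbT; case: ifP.
case: q => [|q'] /=; first by move=> ->.
move=> /and3P[/eqP-> /allP h1 h2] /=.
apply: jump_some => //; first by rewrite B_leaf.
by move=> [//|k] /andP[_ kq]; rewrite B_leaf -leqNgt; apply: h1; rewrite mem_iota.
Qed.

Lemma lex_label_shiftT y : regular y ->
  exists h, forall n, lex_label (B (shiftT y)) n = omap (shiftW h) (lex_label (B y) n.+1).
Proof.
move=> [[q hq] hU]; exists (stepW (y (PX q [:: brk q])) (ancV y q)).1 => n.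
apply: (@emb_label_succ _ _ q (brk q)); last exact: lex_succ_root.
- by move=> w; rewrite (shiftTE hq) succ_0.
- by move=> i w; rewrite (shiftTE hq) succ_1.
- by move=> p i w; rewrite (shiftTE hq) add2n succ_2// addSnnS.
Qed.

Definition lab (y : V) (n : nat) : option W := lex_label (B y) n.

Lemma dmeas_nextw p rw : dmeas (fun y : VT => nextw_rev (B y) p rw).
Proof.
elim: rw => [|i ru IH] /=; first exact: dmeas_cst.
by apply: dmeas_if => //; [exact: dmeas_present|exact: dmeas_cst].
Qed.

Lemma dmeas_jump p w : dmeas (fun y : VT => jump (B y) p w).
Proof.
have mp k : measurable [set y : VT | isSome (B y k [:: 1%N])].
  exact: (dmeas_pred (fun x : bool => x) (@dmeas_present k [:: 1%N])).
have mp' k : measurable [set y : VT | ~~ isSome (B y k [:: 1%N])].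
  exact: (dmeas_pred (fun x : bool => ~~ x) (@dmeas_present k [:: 1%N])).
move=> t.
have -> : [set y : VT | jump (B y) p w = t] = [set y : VT |
   (exists q, [/\ (p < q)%N, isSome (B y q [:: 1%N]) &
     forall k, (p < k < q)%N -> ~~ isSome (B y k [:: 1%N])] /\ (q, [:: 1%N]) = t) \/
   ((forall k, (p < k)%N -> ~~ isSome (B y k [:: 1%N])) /\ (p, w) = t)].
  apply/seteqP; split => y /=.
    move=> <-; case: (jumpP (B y) p) => [[q [h1 h2 h3]]|h].
      by left; exists q; rewrite (jump_some _ h1 h2 h3).
    by right; rewrite (jump_none _ h).
  by move=> [[q [[h1 h2 h3] <-]]|[h <-]]; [rewrite (jump_some _ h1 h2 h3)|rewrite (jump_none _ h)].
apply: meas_or.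
  apply: meas_exists => q; apply: meas_and; last exact: meas_const.
  rewrite (_ : [set _ | _] = [set y : VT | (p < q)%N /\ (isSome (B y q [:: 1%N]) /\
     forall k, (p < k < q)%N -> ~~ isSome (B y k [:: 1%N]))]).
    apply: meas_and; first exact: meas_const.
    apply: meas_and; first exact: mp.
    by apply: meas_forall => k; apply: meas_imply; [exact: meas_const|exact: mp'].
  by apply/seteqP; split => y /= => [[]|[? []]].
apply: meas_and; last exact: meas_const.
by apply: meas_forall => k; apply: meas_imply; [exact: meas_const|exact: mp'].
Qed.

Lemma dmeas_lex_vertex n : dmeas (fun y : VT => lex_vertex (B y) n).
Proof.
elim: n => [|n IH]; first exact: dmeas_cst.
apply: (@dmeas_bind _ _ (nat * seq nat)%type _ (fun y : VT => lex_vertex (B y) n)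
  (fun v y => lex_succ (B y) v)) => // -[p w].
apply: dmeas_if; [exact: dmeas_present|exact: dmeas_cst|].
apply: (@dmeas_bind _ _ (option (seq nat)) _ (fun y : VT => nextw_rev (B y) p (rev w))
  (fun o y => if o is Some w' then (p, w') else jump (B y) p w)).
  exact: dmeas_nextw.
by case=> [w'|]; [exact: dmeas_cst|exact: dmeas_jump].
Qed.

Lemma obs_ext (t t' : option W) : (forall j, obs j t = obs j t') -> t = t'.
Proof.
case: t t' => [[x f]|] [[x' f']|] h //; last 2 first.
- by have := h 0%N.
- by have := h 0%N.
have := h 0%N; rewrite /obs /= => -[-> _]; congr (Some (_, _)); apply/funext => j.
by have := h j; rewrite /obs /= => -[].
Qed.

(** Labels range over an uncountable set, so their equality is tested observable by observable, at
    each of the countably many possible vertices. *)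
Lemma measurable_lab_eq n k : measurable [set y : VT | lab y n = lab y k].
Proof.
have -> : [set y : VT | lab y n = lab y k] = [set y : VT | forall v v',
    lex_vertex (B y) n = v -> lex_vertex (B y) k = v' ->
    forall j, obs j (B y v.1 v.2) = obs j (B y v'.1 v'.2)].
  apply/seteqP; split => y /=.
    by move=> h v v' ev ev' j; congr obs; rewrite -ev -ev'.
  by move=> h; apply: obs_ext => j; exact: h.
apply: meas_forall => v; apply: meas_forall => v'.
apply: meas_imply; first exact: dmeas_lex_vertex.
apply: meas_imply; first exact: dmeas_lex_vertex.
by apply: meas_forall => j; apply: dmeas_eq; exact: dmeas_obs_B.
Qed.

(** * An ergodic theorem *)

Section KatznelsonWeiss.
Context {R : realType}.

Definition hits (d : nat -> bool) (n : nat) : nat := (\sum_(0 <= k < n) d k)%N.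

Lemma hitsD d n k : hits d (n + k) = (hits d n + hits (fun j => d (n + j)%N) k)%N.
Proof.
rewrite /hits (@big_cat_nat _ _ _ n)//= ?leq_addr//; congr addn.
rewrite -[X in index_iota X _]add0n big_addn addnC addnK.
by apply: eq_bigr => j _; rewrite addnC.
Qed.

Lemma hits_le d n : (hits d n <= n)%N.
Proof.
rewrite /hits; apply: (@leq_trans (\sum_(0 <= k < n) 1)%N); last by rewrite sum_nat_const_nat subn0 muln1.
by apply: leq_sum => k _; case: (d k).
Qed.

Definition quick (lam : R) (M : nat) (d : nat -> bool) :=
  exists n, (0 < n <= M)%N /\ lam * n%:R <= (hits d n)%:R.

(** Greedy tiling: from a quick position one jumps over a block in which [d] has frequency at least
    [lam]; a position that is not quick belongs to [g] and is passed alone, at frequency [1 >= lam].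
    Only the last stretch, of length at most [M], may contribute nothing. *)
Lemma KW_tiling (lam : R) M (d : nat -> bool) (g : nat -> bool) : lam <= 1 -> 0 <= lam ->
  (forall j, d j -> g j) ->
  (forall j, ~ quick lam M (fun k => d (j + k)%N) -> g j) ->
  forall L, lam * (L%:R - M%:R) <= (hits g L)%:R.
Proof.
move=> lam1 lam0 hd hg L.
suff H : forall L j, lam * (L%:R - M%:R) <= (hits (fun k => g (j + k)%N) L)%:R by exact: (H L 0%N).
move=> {}L; have [n] := ubnP L; elim: n L => // n IH L Ln j.
case: (leqP L M) => LM.
  apply: (@le_trans _ _ 0); last exact: ler0n.
  by rewrite mulr_ge0_le0// subr_le0 ler_nat.
case: (pselect (quick lam M (fun k => d (j + k)%N))) => [[k [/andP[k0 kM] hk]]|nq].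
  have kL : (k <= L)%N by lia.
  rewrite -(subnKC kL) hitsD !natrD.
  have := IH (L - k)%N _ (j + k)%N; rewrite (_ : (L - k < n)%N); last by lia.
  move=> /(_ isT) h.
  have hdg : (hits (fun k => d (j + k)%N) k)%:R <= (hits (fun k => g (j + k)%N) k)%:R :> R.
    rewrite ler_nat; apply: leq_sum => i _.
    by case E : (d (j + i)%N) => //; rewrite hd.
  have -> : hits (fun j0 => g (j + (k + j0))%N) (L - k) = hits (fun k0 => g (j + k + k0)%N) (L - k).
    by apply: eq_bigr => i _; rewrite addnA.
  lra.
have L0 : (0 < L)%N by lia.
rewrite -(subnKC L0) hitsD !natrD.
have := IH (L - 1)%N _ (j + 1)%N; rewrite (_ : (L - 1 < n)%N); last by lia.
move=> /(_ isT) h.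
have -> : hits (fun k => g (j + k)%N) 1 = 1%N by rewrite /hits big_nat1 addn0 hg.
have -> : hits (fun j0 => g (j + (1 + j0))%N) (L - 1) = hits (fun k0 => g (j + 1 + k0)%N) (L - 1).
  by apply: eq_bigr => i _; rewrite addnA.
lra.
Qed.

Context {d : measure_display} {Omega : measurableType d}.
Variable P : probability Omega R.

Lemma pr_sum_ge (G : nat -> set Omega) n (c : R) : (forall j, measurable (G j)) ->
  (forall y, c <= \sum_(0 <= j < n) (\1_(G j) y : R)) ->
  c <= \sum_(0 <= j < n) pr P (G j).
Proof.
move=> mG h; case: (leP c 0) => c0; first by apply: (le_trans c0); apply: sumr_ge0 => j _; exact: pr_ge0.
rewrite -lee_fin.
have -> : c%:E = (\int[P]_(y in setT) c%:E)%E.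
  transitivity (c%:E * P setT)%E; first by rewrite probability_setT mule1.
  by rewrite integral_cst.
have -> : (\sum_(0 <= j < n) pr P (G j))%:E = (\int[P]_(y in setT) (\sum_(0 <= j < n) (\1_(G j) y : R))%:E)%E.
  under eq_integral do rewrite -sumEFin.
  rewrite ge0_integral_sum//.
    rewrite -sumEFin; apply: eq_bigr => j _; rewrite integral_indic// setIT.
    by apply/esym; exact: prE.
  by move=> j; apply/measurable_EFinP; exact: measurable_indic.
apply: ge0_le_integral => //.
- by move=> y _; rewrite lee_fin ltW.
- apply/measurable_EFinP; apply: measurable_sum => j; exact: measurable_indic.
- by move=> y _; rewrite lee_fin; exact: h.
Qed.

Variables (D : nat -> Omega -> bool).
Hypothesis mD : forall k, dmeas (D k).
Let seqD j (y : Omega) k := D (j + k)%N y.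
Hypothesis stat : forall (Q : (nat -> bool) -> Prop),
  (forall j, measurable [set y | Q (seqD j y)]) ->
  forall j, pr P [set y | Q (seqD j y)] = pr P [set y | Q (seqD 0 y)].

Lemma dmeas_hits j n : dmeas (fun y => hits (seqD j y) n).
Proof.
rewrite /hits; elim: n => [|n IH].
  by under eq_fun do rewrite big_nil; exact: dmeas_cst.
under eq_fun do rewrite big_nat_recr//=.
exact: (dmeas_comp2 (fun (a : nat) (b : bool) => (a + b)%N) IH (mD _)).
Qed.

Lemma measurable_quick lam M j : measurable [set y | quick lam M (seqD j y)].
Proof.
apply: meas_exists => n; apply: meas_and; first exact: meas_const.
exact: (dmeas_pred (fun a : nat => lam * n%:R <= a%:R) (dmeas_hits j n)).
Qed.

(** By stationarity the expected count in the tiling bound is linear in [L], and dividing by [L]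
    removes the loss [lam * M]. Then [M] grows, and the event of not being quick loses its mass. *)
Lemma KW_le (lam : R) : 0 <= lam <= 1 ->
  pr P [set y | exists M, quick lam M (seqD 0 y)] = 1 -> lam <= pr P [set y | D 0 y].
Proof.
move=> /andP[lam0 lam1] full.
have mQ := measurable_quick lam.
have mD0 : measurable [set y | D 0 y] by exact: (mD 0 true).
have key M : lam <= pr P [set y | D 0 y] + pr P (~` [set y | quick lam M (seqD 0 y)]).
  pose G (s : nat -> bool) := s 0%N \/ ~ quick lam M s.
  have mG j : measurable [set y | G (seqD j y)].
    apply: meas_or; first by rewrite /seqD addn0; exact: (mD _ true).
    exact: meas_not.
  have GL L : lam * (L%:R - M%:R) <= L%:R * pr P [set y | G (seqD 0 y)].
    have := @pr_sum_ge (fun j => [set y | G (seqD j y)]) L (lam * (L%:R - M%:R)) mG.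
    have -> : \sum_(0 <= j < L) pr P [set y | G (seqD j y)] = L%:R * pr P [set y | G (seqD 0 y)].
      under eq_bigr do rewrite (stat mG).
      by rewrite sumr_const_nat subn0 mulr_natl.
    apply => y.
    pose g j := `[< G (seqD j y) >].
    have -> : \sum_(0 <= j < L) (\1_[set y | G (seqD j y)] y : R) = (hits g L)%:R.
      rewrite /hits natr_sum; apply: eq_bigr => j _; rewrite indicE /g.
      case: (pselect (G (seqD j y))) => hG; first by rewrite mem_set// asboolT.
      by rewrite memNset// asboolF.
    apply: (@KW_tiling lam M (fun k => D k y) g) => // j.
      by move=> Dj; apply/asboolP; left; rewrite /seqD addn0.
    by move=> nq; apply/asboolP; right.
  have GU : pr P [set y | G (seqD 0 y)] <=
      pr P [set y | D 0 y] + pr P (~` [set y | quick lam M (seqD 0 y)]).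
    apply: pr_leD => //; exact: measurableC.
  apply: le_trans GU; apply/ler_addgt0Pl => e e0.
  have [L hL] : exists L : nat, M%:R * e^-1 < L%:R.
    exists (Num.truncn (M%:R * e^-1)).+1; exact: truncnS_gt.
  have L0 : 0 < L%:R :> R by apply: le_lt_trans hL; rewrite mulr_ge0// invr_ge0 ltW.
  have hM : M%:R < e * L%:R by rewrite mulrC -ltr_pdivrMr.
  have := GL L; set z := pr P _ => h.
  rewrite -(ler_pM2r L0) mulrDl.
  have : lam * M%:R <= M%:R by rewrite ler_piMl.
  lra.
rewrite leNgt; apply/negP => hlt.
have [||M hM] := @pr_nondecreasing_ge _ _ _ P (fun M => [set y | quick lam M (seqD 0 y)])
  (1 - (lam - pr P [set y | D 0 y])) (fun M => mQ M 0%N).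
- by move=> M y [n [/andP[n0 nM] hn]]; exists n; rewrite n0 leqW.
- rewrite (_ : \bigcup_k _ = [set y | exists M, quick lam M (seqD 0 y)]).
    by rewrite full; lra.
  by apply/seteqP; split => y /= => [[M _ h]|[M h]]; exists M.
- have := key M; rewrite pr_setC//; lra.
Qed.
End KatznelsonWeiss.

(** * Hitting times of the height along a path *)

(* A walk reads its [n] steps off the coordinates [e (a+1), e (a+2), ...]; it goes
   one level down on the steps [s] with [(s == 0) = up], and one level up otherwise.
   [nohit] says that it never goes down by [lv] levels. *)
Fixpoint nohit (up : bool) (e : nat -> prim) (a n lv : nat) (y : V) : bool :=
  if lv is lv'.+1 then
    if n is n'.+1 then
      nohit up e a.+1 n' (if (y (e a.+1) == 0%N) == up then lv' else lv.+1) y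
    else true
  else false.

Lemma bernoulli_pow (R : realType) (x : R) n : 0 <= x <= 1 -> (1 + n%:R * x) * (1 - x) ^+ n <= 1.
Proof.
move=> /andP[x0 x1]; elim: n => [|n IH]; first by rewrite mul0r addr0 expr0 mulr1.
rewrite exprS mulrA; apply: le_trans IH; apply: ler_wpM2r; first by rewrite exprn_ge0// subr_ge0.
rewrite -natr1; have : 0 <= n%:R :> R by []; nra.
Qed.

Lemma bernoulli_sub (R : realType) (t : R) n : 0 <= t <= 1 -> 1 - n%:R * t <= (1 - t) ^+ n.
Proof.
move=> /andP[t0 t1]; elim: n => [|n IH]; first by rewrite mul0r subr0 expr0.
rewrite exprS -natr1; have : 0 <= n%:R :> R by [].
have : (1 - t) ^+ n <= 1 by rewrite exprn_ile1// ?subr_ge0// lerBlDr lerDl.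
by move: ((1 - t) ^+ n) IH => z; nra.
Qed.

Section Hitting.
Context {R : realType}.
Variables (b : nat) (mu mubar : nat -> R) (nu : probability VT R).
Hypothesis HL : brw_law b mu mubar nu.
Let m := marg b mu mubar.
Let law : forall (l : seq prim) v, uniq l ->
  nu (cyl l v) = (\prod_(i <- l) m i (v i))%:E := bl_law HL.
Let m_ge0 := marg_ge0 HL.
Variable e : nat -> prim.
Hypothesis e_PX : forall k, isPX (e k).
Hypothesis e_inj : injective e.

Lemma measurable_nohit up a n lv : measurable [set y : VT | nohit up e a n lv y].
Proof.
suff : dmeas (fun y : VT => nohit up e a n lv y) by apply.
elim: n a lv => [|n IH] a [|lv] /=; try exact: dmeas_cst.
by apply: (@dmeas_bind _ _ nat _ (fun y : VT => y (e a.+1)) (fun s y =>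
  nohit up e a.+1 n (if (s == 0%N) == up then lv else lv.+2) y)); [exact: dmeas_coord|].
Qed.

Lemma nohit_determined up a n lv (y y' : V) :
  (forall k, (0 < k <= n)%N -> y (e (a + k)%N) = y' (e (a + k)%N)) ->
  nohit up e a n lv y = nohit up e a n lv y'.
Proof.
elim: n a lv => [|n IH] a [|lv] //= h.
rewrite -addn1 h//; apply: IH => k /andP[k0 kn].
by rewrite -addnA add1n; apply: h.
Qed.

Lemma pr_PX_eq0 i : isPX i -> pr nu [set y : VT | y i = 0%N] = 2^-1.
Proof. by move=> hi; rewrite (law_coord law); case: i hi. Qed.

Lemma pr_nohit_split up a n lv :
  pr nu [set y : VT | nohit up e a n.+1 lv.+1 y] =
  2^-1 * (pr nu [set y : VT | nohit up e a.+1 n lv y] +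
          pr nu [set y : VT | nohit up e a.+1 n lv.+2 y]).
Proof.
have me : measurable [set y : VT | y (e a.+1) = 0%N] := @dmeas_coord _ _.
rewrite (pr_split _ (measurable_nohit up a n.+1 lv.+1) me).
have fr lv0 : insens (e a.+1) [set y : VT | nohit up e a.+1 n lv0 y].
  move=> y k /=; rewrite (@nohit_determined _ _ _ _ _ y)// => j /andP[j0 _].
  by rewrite upd_neq//; apply/eqP => /e_inj; lia.
have half0 lv0 : pr nu ([set y : VT | nohit up e a.+1 n lv0 y] `&` [set y : VT | y (e a.+1) = 0%N]) =
    2^-1 * pr nu [set y : VT | nohit up e a.+1 n lv0 y].
  rewrite (@indep_coord _ nu m m_ge0 law _ _ (fun x => x = 0%N) (measurable_nohit _ _ _ _))//.
  by rewrite pr_PX_eq0// mulrC.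
have half1 lv0 : pr nu ([set y : VT | nohit up e a.+1 n lv0 y] `&` ~` [set y : VT | y (e a.+1) = 0%N]) =
    2^-1 * pr nu [set y : VT | nohit up e a.+1 n lv0 y].
  rewrite (@indep_coord _ nu m m_ge0 law _ _ (fun x => ~ x = 0%N) (measurable_nohit _ _ _ _))//.
  by rewrite pr_setC// pr_PX_eq0// mulrC; congr (_ * _); lra.
rewrite mulrDr.
case: up fr half0 half1 => fr half0 half1; last rewrite addrC.
- congr (_ + _).
    rewrite -half0; congr pr; apply/seteqP; split => y /= [h1 h]; split => //; by move: h1; rewrite h.
  rewrite -half1; congr pr; apply/seteqP; split => y /= [h1 h]; split => //; by move: h1; move/eqP/negbTE: h => ->.
- congr (_ + _).
    rewrite -half1; congr pr; apply/seteqP; split => y /= [h1 h]; split => //; by move: h1; move/eqP/negbTE: h => ->.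
  rewrite -half0; congr pr; apply/seteqP; split => y /= [h1 h]; split => //; by move: h1; rewrite h.
Qed.

(* [rho ^+ k * r ^+ level] is a martingale when [rho = 2 r / (1 + r^2)]. *)
Lemma nohit_exp up a n lv (r : R) : 0 < r < 1 ->
  (1 - (2 * r / (1 + r ^+ 2)) ^+ n) * pr nu [set y : VT | nohit up e a n lv y] <= 1 - r ^+ lv.
Proof.
move=> /andP[r0 r1]; set rho := 2 * r / (1 + r ^+ 2).
have d0 : 0 < 1 + r ^+ 2 by rewrite ltr_pwDl// exprn_ge0// ltW.
have rho1 : rho <= 1 by rewrite ler_pdivrMr// mul1r; have := sqr_ge0 (1 - r); rewrite !expr2; lra.
have rho0 : 0 <= rho by rewrite divr_ge0 ?mulr_ge0 ?ltW.
elim: n a lv => [|n IH] a lv.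
  by rewrite expr0 subrr mul0r subr_ge0 exprn_ile1// ltW.
case: lv => [|lv].
  rewrite expr0 subrr (_ : [set _ | _] = set0) ?/pr ?measure0 ?mulr0//.
  by apply/seteqP; split.
rewrite pr_nohit_split.
have := IH a.+1 lv; have := IH a.+1 lv.+2.
set u1 := pr nu _; set u2 := pr nu _; rewrite [rho ^+ n.+1]exprS.
have hr : rho * (r ^+ lv + r ^+ lv.+2) = 2 * r ^+ lv.+1.
  by rewrite /rho !exprS; field; rewrite -expr2; apply: lt0r_neq0.
have u1le : u1 <= 1 by apply: pr_le1; exact: measurable_nohit.
have u2le : u2 <= 1 by apply: pr_le1; exact: measurable_nohit.
move: (rho ^+ n) => z h1 h2.
have {h1} h1 : rho * r ^+ lv.+2 <= rho * (1 - (1 - z) * u1) by apply: ler_wpM2l => //; lra.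
have {h2} h2 : rho * r ^+ lv <= rho * (1 - (1 - z) * u2) by apply: ler_wpM2l => //; lra.
have : 0 <= (1 - rho) * (1 - u1) by apply: mulr_ge0; lra.
have : 0 <= (1 - rho) * (1 - u2) by apply: mulr_ge0; lra.
lra.
Qed.

(** The diffusive scale: in time [4 ^ k] the walk covers a distance of order [2 ^ k]. In [nohit_exp]
    one takes [r = 1 - 2^-k], for which [rho <= 1 - 4^-k / 2]; so [rho ^+ (4 ^ k)] stays away from 1
    while [1 - r ^+ lv] is at most [lv * 2^-k]. *)
Lemma nohit_bound up a k lv :
  pr nu [set y : VT | nohit up e a (4 ^ k) lv y] <= 3 * lv%:R * 2^-1 ^+ k.
Proof.
have mn := measurable_nohit up a (4 ^ k) lv.
case: lv mn => [|lv] mn.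
  rewrite (_ : [set _ | _] = set0) ?/pr ?measure0 ?mulr0 ?mul0r//.
  by apply/seteqP; split => // y /=; case: (4 ^ k)%N.
case: k mn => [|k] mn.
  rewrite expr0 mulr1; apply: le_trans (pr_le1 nu mn) _.
  by rewrite -natrM ler1n.
set t := 2^-1 ^+ k.+1 : R.
have t0 : 0 < t by rewrite exprn_gt0// invr_gt0.
have t1 : t <= 2^-1.
  rewrite /t exprS -[leRHS]mulr1 ler_wpM2l ?invr_ge0//.
  by rewrite exprn_ile1 ?invr_ge0// invf_le1// ler1n.
have := @nohit_exp up a (4 ^ k.+1) lv.+1 (1 - t); set rho := 2 * _ / _.
set u := pr nu _; have u0 : 0 <= u by exact: pr_ge0.
have -> : 0 < 1 - t < 1 by apply/andP; split; lra.
move=> /(_ isT) h.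
have b1 : 1 - lv.+1%:R * t <= (1 - t) ^+ lv.+1 by apply: bernoulli_sub; apply/andP; split; lra.
have rhoE : rho <= 1 - t ^+ 2 / 2.
  have d0 : 0 < 1 + (1 - t) ^+ 2 by rewrite ltr_pwDl// sqr_ge0.
  rewrite /rho ler_pdivrMr//.
  have : 0 <= t ^+ 3 * (2 - t) by apply: mulr_ge0; [rewrite exprn_ge0// ltW|lra].
  rewrite !exprS expr0; lra.
have rho0 : 0 <= rho by rewrite /rho divr_ge0// ?mulr_ge0//; [lra|rewrite addr_ge0// sqr_ge0].
have tt : t ^+ 2 <= 1 by rewrite expr_le1//; lra.
(* As [4 ^ k.+1 * (t ^+ 2 / 2) = 1/2], the Bernoulli inequality gives
   [(1 + 1/2) * rho ^+ (4 ^ k.+1) <= 1]; the remaining factor [1 - 2/3] is the origin of the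
   constant 3. *)
have z : rho ^+ (4 ^ k.+1) <= 2 / 3.
  apply: (@le_trans _ _ ((1 - t ^+ 2 / 2) ^+ (4 ^ k.+1))).
    by apply: lerXn2r => //; rewrite nnegrE//; lra.
  have := @bernoulli_pow R (t ^+ 2 / 2) (4 ^ k.+1).
  have e1 : (4 ^ k.+1)%:R * (t ^+ 2 / 2) = 2^-1.
    rewrite mulrA natrX /t -exprM mulnC exprM -exprMn.
    rewrite (_ : 4%:R * 2^-1 ^+ 2 = 1 :> R) ?expr1n ?mul1r//.
    by rewrite expr2; lra.
  rewrite e1; have := sqr_ge0 t => t2.
  have -> : 0 <= t ^+ 2 / 2 <= 1 by apply/andP; split; lra.
  by move=> /(_ isT); lra.
have : (1 - 2 / 3) * u <= lv.+1%:R * t.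
  apply: (@le_trans _ _ ((1 - rho ^+ (4 ^ k.+1)) * u)); last lra.
  by apply: ler_wpM2r => //; lra.
lra.
Qed.

End Hitting.

(** * A zero-one law *)

(** A top digit [0] stored as a reverse step would be read back as a step to the parent, whence the
    positivity. *)
Lemma psi_invol i (y : V) : isPX i -> (0 < y (PU 0))%N -> psi i (psi i y) = y.
Proof.
case: i => // p w _ y0; apply/funext => k; rewrite /psi eqxx.
have [->|ki] := eqVneq k (PX p w).
  have [e|e] := eqVneq (y (PX p w)) 0%N => /=; last by [].
  by rewrite (gtn_eqF y0) e.
case: k ki => //= j _.
have [e|e] := eqVneq (y (PX p w)) 0%N => /=; last by [].
by rewrite (gtn_eqF y0); case: j.
Qed.

Lemma psi_U_pos i (y : V) : isPX i -> (forall j, (0 < y (PU j))%N) ->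
  forall j, (0 < psi i y (PU j))%N.
Proof.
case: i => // p w _ hU j; rewrite /psi /=; case: ifP => [_|/negbT yi]; first exact: hU.
by case: j => [|j]; [rewrite lt0n|exact: hU].
Qed.

(* Undoes the exchanges of [psis] from the step [a + n] back to [a + 1]. *)
Fixpoint unps (e : nat -> prim) (a n : nat) (y : V) : V :=
  if n is n'.+1 then psi (e a.+1) (unps e a.+1 n' y) else y.

(* Lower bound for the number of digits of [unps e a n y] that are read off the
   steps [e (a+1), ..., e (a+n)], i.e. that do not depend on the digits of [y]. *)
Fixpoint kdep (e : nat -> prim) (a n : nat) (y : V) : nat :=
  if n is n'.+1 then
    if y (e a.+1) == 0%N then (kdep e a.+1 n' y).-1 else (kdep e a.+1 n' y).+1
  else 0%N.

Section Path.
Variable e : nat -> prim.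
Hypothesis e_PX : forall k, isPX (e k).
Hypothesis e_inj : injective e.

Lemma unpsSr a n y : unps e a n.+1 y = unps e a n (psi (e (a + n.+1)%N) y).
Proof.
elim: n a => [|n IH] a; first by rewrite /= addn1.
by rewrite -[LHS]/(psi (e a.+1) (unps e a.+1 n.+1 y)) IH /= addSnnS.
Qed.

Lemma unps_psis r (y : V) : (forall j, (0 < y (PU j))%N) -> unps e 0 r (psis e r y) = y.
Proof.
move=> hU; suff : unps e 0 r (psis e r y) = y /\ forall j, (0 < psis e r y (PU j))%N by case.
elim: r => [//|r [IH1 IH2]]; split; last exact: psi_U_pos.
by rewrite unpsSr add0n /= psi_invol.
Qed.

Lemma unpsD a m n y : unps e a (m + n) y = unps e a m (unps e (a + m)%N n y).
Proof.
elim: m a => [|m IH] a; first by rewrite addn0.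
by rewrite addSn /= IH addSnnS.
Qed.

Lemma unps_other a n y i : ~~ isPU i -> (forall k, (0 < k <= n)%N -> i != e (a + k)%N) ->
  unps e a n y i = y i.
Proof.
move=> iU; elim: n a => [//|n IH] a h /=.
rewrite psi_other//; last by rewrite -addn1; apply: h.
by apply: IH => k /andP[k0 kn]; rewrite addSnnS; apply: h.
Qed.

Lemma unps_next a n y : unps e a.+1 n y (e a.+1) = y (e a.+1).
Proof.
apply: unps_other; first by have := e_PX a.+1; case: (e a.+1).
by move=> k /andP[k0 _]; apply/eqP => /e_inj; lia.
Qed.

Lemma psi_agree i (z z' : V) d : isPX i -> z i = z' i ->
  (forall j, (j < d)%N -> z (PU j) = z' (PU j)) ->
  forall j, (j < if z i == 0%N then d.-1 else d.+1)%N -> psi i z (PU j) = psi i z' (PU j).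
Proof.
case: i => // p w _ hi h j; rewrite /psi /= -hi; case: ifP => zi jd.
  by apply: h; lia.
by case: j jd => // j jd; apply: h.
Qed.

Lemma unps_agree_digits a n (z z' : V) : (forall i, ~~ isPU i -> z i = z' i) ->
  forall j, (j < kdep e a n z)%N -> unps e a n z (PU j) = unps e a n z' (PU j).
Proof.
move=> h; elim: n a => [//|n IH] a j /= jd; apply: (psi_agree (d := kdep e a.+1 n z)) => //.
- by rewrite !unps_next; apply: h; have := e_PX a.+1; case: (e a.+1).
- exact: IH.
- by rewrite unps_next.
Qed.

(** Each exchange shortens the agreement of the digits by at most one. *)
Lemma unps_agree_prefix a n (z z' : V) d :
  (forall k, (0 < k <= n)%N -> z (e (a + k)%N) = z' (e (a + k)%N)) ->
  (forall j, (j < d)%N -> z (PU j) = z' (PU j)) -> (n <= d)%N ->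
  (forall j, (j < d - n)%N -> unps e a n z (PU j) = unps e a n z' (PU j)) /\
  (forall k, (0 < k <= n)%N -> unps e a n z (e (a + k)%N) = unps e a n z' (e (a + k)%N)).
Proof.
elim: n a => [|n IH] a hz hU nd.
  by split => [j|k]; [rewrite subn0; exact: hU|case: k].
have [||h1 h2] := IH a.+1 _ hU _; last 1 first.
- have hn : unps e a.+1 n z (e a.+1) = unps e a.+1 n z' (e a.+1).
    by rewrite !unps_next; have := hz 1%N isT; rewrite addn1.
  split => [j jd|k /andP[k0 kn]] /=.
    apply: (psi_agree (d := (d - n)%N)) => //; case: ifP => _; lia.
  have [->|k1] := eqVneq k 1%N.
    rewrite addn1 !psi_at hn; case: ifP => // _; apply: h1; lia.
  have eU i : ~~ isPU (e i) by have := e_PX i; case: (e i).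
  have ne : e (a + k)%N != e a.+1 by apply/eqP => /e_inj; lia.
  rewrite !psi_other//; have := h2 k.-1; rewrite addSnnS (ltn_predK k0); apply; lia.
- by move=> k /andP[k0 kn]; rewrite addSnnS; apply: hz.
- exact: ltnW.
Qed.

Lemma unps_local a n (z z' : V) (Q : prim -> Prop) :
  (forall k, (0 < k <= n)%N -> Q (e (a + k)%N)) -> (forall j, Q (PU j)) ->
  (forall i, Q i -> z i = z' i) -> forall i, Q i -> unps e a n z i = unps e a n z' i.
Proof.
move=> + QU hz; elim: n a => [//|n IH] a Qe i Qi /=.
have h k : Q k -> unps e a.+1 n z k = unps e a.+1 n z' k.
  by apply: IH => j /andP[j0 jn]; rewrite addSnnS; apply: Qe.
have Q1 : Q (e a.+1) by have := Qe 1%N isT; rewrite addn1.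
rewrite /psi; case: (i == e a.+1); first by rewrite !h.
by case: i Qi => [p w|p|[|j]|p w] Qi; rewrite !h.
Qed.

(** [kdep] is the running maximum of the walk that goes up on nonzero steps and down on zero steps,
    computed from the last step backwards; the walk of [nohit false] is its opposite. *)
Lemma hit_kdep a n lv y : ~~ nohit false e a n lv y -> (lv <= kdep e a n y)%N.
Proof.
elim: n a lv => [|n IH] a [|lv] //=.
by case: (y (e a.+1) == 0%N) => /= /IH; lia.
Qed.

Lemma measurable_kdep a n : dmeas (fun y : VT => kdep e a n y).
Proof.
elim: n a => [|n IH] a /=; first exact: dmeas_cst.
apply: dmeas_if; first exact: (dmeas_comp (fun s => s == 0%N) (@dmeas_coord _)).
- exact: (dmeas_comp predn (IH _)).
- exact: (dmeas_comp succn (IH _)).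
Qed.

Lemma measurable_unps a n : measurable_fun setT (unps e a n : VT -> VT).
Proof.
elim: n a => [|n IH] a; first exact: measurable_id.
exact: (measurableT_comp (measurable_psi (e a.+1)) (IH a.+1)).
Qed.

Lemma kdep_local a n (z z' : V) : (forall k, (0 < k <= n)%N -> z (e (a + k)%N) = z' (e (a + k)%N)) ->
  kdep e a n z = kdep e a n z'.
Proof.
elim: n a => [//|n IH] a h /=; rewrite -addn1 h// addn1 (IH a.+1)// => k /andP[k0 kn].
by rewrite addSnnS; apply: h.
Qed.

End Path.

Lemma seq_bound (A : eqType) (l : seq A) (Q : A -> nat -> Prop) :
  (forall i, exists n0, forall n, (n0 <= n)%N -> Q i n) ->
  exists n0, forall n i, (n0 <= n)%N -> i \in l -> Q i n.
Proof.
move=> h; elim: l => [|i l [n0 IH]]; first by exists 0%N.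
have [n1 h1] := h i; exists (maxn n0 n1) => n j; rewrite geq_max => /andP[h2 h3].
by rewrite inE => /orP[/eqP->|jl]; [exact: h1|exact: IH].
Qed.

Section ZeroOne.
Context {R : realType}.
Variables (b : nat) (mu mubar : nat -> R) (nu : probability VT R).
Hypothesis HL : brw_law b mu mubar nu.
Let m := marg b mu mubar.
Let law : forall (l : seq prim) v, uniq l ->
  nu (cyl l v) = (\prod_(i <- l) m i (v i))%:E := bl_law HL.
Let m_ge0 := marg_ge0 HL.
Variable e : nat -> prim.
Hypothesis e_PX : forall k, isPX (e k).
Hypothesis e_inj : injective e.
Variables (E : set VT) (Er : nat -> set VT) (S : nat -> prim -> Prop).
Hypothesis mE : measurable E.
Hypothesis mEr : forall r, measurable (Er r).
Hypothesis EEr : forall r, exists N : set VT, [/\ measurable N, pr nu N = 0 &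
  forall y, ~ N y -> E y <-> Er r (psis e r y)].
Hypothesis Er_insens : forall r i, ~ S r i -> ~~ isPU i -> insens i (Er r).
Hypothesis S_e : forall r k, (0 < k <= r)%N -> ~ S r (e k).
Hypothesis S_tail : forall i, ~~ isPU i -> exists r0, forall r, (r0 <= r)%N -> ~ S r i.

(* Forgetting the digits does not change the first [M + J] digits of [unps] on the
   likely event [G], so that [E] is almost independent of any cylinder. *)
Let zeroU (y : V) : V := fun i => if isPU i then 0%N else y i.

Let indep_approx l v (eps : R) : 0 < eps ->
  `|pr nu (E `&` cyl l v) - pr nu E * pr nu (cyl l v)| <= 2 * eps.
Proof.
move=> eps0.
have [M hM] : exists M, forall k, e k \in l -> (k <= M)%N.
  have [|M hM] := @seq_bound _ l (fun i n => forall k, e k = i -> (k <= n)%N).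
    move=> i; case: (pselect (exists k, e k = i)) => [[k <-]|nk].
      by exists k => n kn k' /e_inj ->.
    by exists 0%N => n _ k hk; case: nk; exists k.
  by exists M => k kl; exact: (hM M _ (leqnn M) kl).
have [J hJ] : exists J, forall j, PU j \in l -> (j < J)%N.
  have [|J hJ] := @seq_bound _ l (fun i n => forall j, i = PU j -> (j < n)%N).
    by case=> [p w|p|j|p w]; first [by exists 0%N|exists j.+1 => n jn j' [<-]].
  by exists J => j jl; exact: (hJ J _ (leqnn J) jl).
have [r0 hr0] : exists r0, forall r i, (r0 <= r)%N -> i \in l -> ~~ isPU i -> ~ S r i.
  have [|r0 h] := @seq_bound _ l (fun i r => ~~ isPU i -> ~ S r i).
    move=> i; case: (boolP (isPU i)) => iU; first by exists 0%N.
    by have [r0 h] := S_tail iU; exists r0 => n /h.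
  by exists r0 => r i; exact: h.
(* [K] makes [nohit_bound] at level [M + J] at most [eps], and the path long enough for [S r] to
   have left the coordinates of [l]. *)
have [K hK] : exists K : nat, 3 * (M + J)%:R * 2^-1 ^+ K <= eps /\ (r0 <= 4 ^ K)%N.
  have [K hK] : exists K : nat, 3 * (M + J)%:R / eps + r0%:R < K%:R.
    exists (Num.truncn (3 * (M + J)%:R / eps + r0%:R)).+1; exact: truncnS_gt.
  have h2 : (K < 2 ^ K)%N by exact: ltn_expl.
  have A0 : 0 <= 3 * (M + J)%:R / eps by rewrite divr_ge0 ?mulr_ge0// ltW.
  exists K; split.
    have K0 : 0 < 2 ^+ K :> R by rewrite exprn_gt0.
    have h3 : K%:R < 2 ^+ K :> R by rewrite -natrX ltr_nat.
    rewrite exprVn ler_pdivrMr// [eps * _]mulrC -ler_pdivrMr//.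
    apply: ltW; apply: lt_trans h3.
    by apply: le_lt_trans hK; rewrite lerDl.
  rewrite -(ler_nat R); apply: (@le_trans _ _ K%:R).
    by apply: ltW; apply: le_lt_trans hK; rewrite lerDr.
  rewrite ler_nat; apply: (leq_trans (ltnW h2)).
  by case: (K) => // k; rewrite leq_exp2r.
(* The first [M] steps contain those read by [l]. The next [n] make the first [M + J] digits
   recoverable from the steps alone, and undoing the first [M] steps then loses at most [M] of these
   digits. *)
pose n := (4 ^ K)%N; pose r := (M + n)%N.
pose C := cyl l v.
pose G : set VT := [set y | (M + J <= kdep e M n y)%N].
have mC : measurable C by exact: measurable_cyl.
have mG : measurable G.
  exact: (dmeas_pred (fun d => (M + J <= d)%N) (measurable_kdep e M n)).
pose RC : set VT := [set y | C (unps e 0 r y)].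
have mRC : measurable RC.
  exact: (measurable_precomp (measurable_unps e 0 r) mC).
pose C' : set VT := G `&` [set y | C (unps e 0 r (zeroU y))].
have mz : measurable_fun setT (zeroU : VT -> VT).
  apply: measurable_coord_map => i; rewrite /zeroU.
  by case: (isPU i); [exact: dmeas_cst|exact: dmeas_coord].
have mC' : measurable C'.
  apply: measurableI => //.
  exact: (measurable_precomp (measurableT_comp (measurable_unps e 0 r) mz) mC).
have C'E : C' = G `&` RC.
  have agree (y : V) : G y -> forall i, i \in l -> unps e 0 r (zeroU y) i = unps e 0 r y i.
    move=> Gy i il; rewrite /r !unpsD add0n.
    have h0 k : ~~ isPU k -> y k = zeroU y k by rewrite /zeroU => /negbTE->.
    have h1 := unps_agree_digits e_PX e_inj (a := M) (n := n) h0.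
    have eU k : ~~ isPU (e k) by have := e_PX k; case: (e k).
    have [||h2 h3] := @unps_agree_prefix e e_PX e_inj 0 M (unps e M n y) (unps e M n (zeroU y)) (M + J) _ _ (leq_addr _ _).
    - move=> k /andP[k0 kM]; rewrite add0n.
      by rewrite !unps_other//; [exact: h0| |] => k' /andP[? ?]; apply/eqP => /e_inj; lia.
    - by move=> j jd; apply: h1; apply: leq_trans jd Gy.
    case: (boolP (isPU i)) => iU.
      case: i il iU => // j /hJ jJ _; apply/esym; apply: h2; lia.
    case: (pselect (exists k, (0 < k)%N /\ e k = i)) => [[k [k0 ek]]|nk].
      subst i; apply/esym; have := h3 k; rewrite add0n; apply; rewrite k0; exact: hM.
    have ne k : (0 < k)%N -> i != e k by move=> k0; apply/eqP => h; apply: nk; exists k.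
    rewrite ![unps e 0 M _ i]unps_other//; last 2 first.
    - by move=> k /andP[k0 _]; rewrite add0n; apply: ne.
    - by move=> k /andP[k0 _]; rewrite add0n; apply: ne.
    rewrite !unps_other//; last 2 first.
    - by move=> k /andP[k0 _]; apply: ne; rewrite addn_gt0 k0 orbT.
    - by move=> k /andP[k0 _]; apply: ne; rewrite addn_gt0 k0 orbT.
    by rewrite -h0.
  apply/seteqP; split => y /= [Gy h]; split => // i il; rewrite -h//.
    by rewrite agree.
  exact: agree.
(* The digits being replaced by [0], [C'] is read off the steps [e 1, ..., e r] and finitely many
   other coordinates, all outside [S r]. *)
have indC' : pr nu (Er r `&` C') = pr nu (Er r) * pr nu C'.
  apply: (indep_determined m_ge0 law (L := map e (iota 1 r) ++ [seq i <- l | ~~ isPU i])) => //.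
    move=> i; rewrite mem_cat => /orP[/mapP[k]|].
      rewrite mem_iota => /andP[k0 kr] ->; apply: Er_insens; last by have := e_PX k; case: (e k).
      by apply: S_e; lia.
    rewrite mem_filter => /andP[iU il]; apply: Er_insens => //; apply: hr0 => //.
    by rewrite /r; case: hK => _ /leq_trans; apply; rewrite leq_addl.
  move=> y y' h [Gy Cy]; split.
    move: Gy; rewrite /G /= (@kdep_local e M n y y')// => k /andP[k0 kn].
    apply: h; rewrite mem_cat map_f// mem_iota; lia.
  move=> i il; rewrite -Cy//.
  apply/esym; apply: (@unps_local e 0 r _ _ (fun i => isPU i \/ (exists k, (0 < k <= r)%N /\ i = e k) \/ i \in l)).
  - by move=> k kr; right; left; exists k.
  - by move=> j; left.
  - move=> k; rewrite /zeroU; case: (boolP (isPU k)) => // kU [//|[[k' [/andP[k0 kr] ->]]|kl]].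
      apply: h; rewrite mem_cat map_f// mem_iota; lia.
    by apply: h; rewrite mem_cat mem_filter kU kl orbT.
  - by right; right.
have [N [mN N0 hN]] := EEr r.
have Upos0 := U_pos_null HL.
pose N2 : set VT := [set y : VT | exists j, y (PU j) = 0%N].
have mN2 : measurable N2 by apply: meas_exists => j; exact: dmeas_coord.
have CRC y : ~ N2 y -> C y <-> RC (psis e r y).
  move=> ny; rewrite /RC /= unps_psis// => j; rewrite lt0n; apply/eqP => hj; apply: ny.
  by exists j.
have mNN : measurable (N `|` N2) by exact: measurableU.
have NN0 : pr nu (N `|` N2) = 0.
  apply/eqP; rewrite eq_le pr_ge0 andbT -[leRHS]addr0 -{1}N0 -Upos0; exact: pr_leD.
have pres A : measurable A -> pr nu [set y | A (psis e r y : VT)] = pr nu A.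
  by move=> mA; rewrite /pr (psis_preserves HL).
have mps A : measurable A -> measurable [set y : VT | A (psis e r y : VT)].
  by move=> mA; exact: (measurable_precomp (measurable_psis e r) mA).
have EC : pr nu (E `&` C) = pr nu (Er r `&` RC).
  have mI : measurable (Er r `&` RC) by exact: measurableI.
  rewrite -[RHS]pres//; apply: (pr0_ext _ _ mNN NN0); [exact: measurableI|exact: mps|].
  move=> y ny; have n1 : ~ N y by move=> ?; apply: ny; left.
  have n2 : ~ N2 y by move=> ?; apply: ny; right.
  by have := hN _ n1; have := CRC _ n2; rewrite /setI /=; tauto.
have EE : pr nu E = pr nu (Er r).
  by rewrite -[RHS]pres//; apply: (pr0_ext mE _ mN N0) => //; exact: mps.
have CC : pr nu C = pr nu RC.
  by rewrite -[RHS]pres//; apply: (pr0_ext mC _ mN2 Upos0); [exact: mps|exact: CRC].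
have GC : pr nu (~` G) <= eps.
  apply: le_trans hK.1.
  apply: le_trans (nohit_bound HL e_PX e_inj false M K (M + J)%N).
  apply: pr_mono; [exact: measurableC|exact: measurable_nohit|].
  by move=> y /= nG; apply/negPn/negP => h; apply: nG; apply: hit_kdep.
have s1 : pr nu (Er r `&` RC) = pr nu (Er r `&` C') + pr nu ((Er r `&` RC) `&` ~` G).
  rewrite (pr_split nu (measurableI _ _ (mEr r) mRC) mG); congr (_ + _); congr pr.
  by rewrite C'E -setIA; congr setI; rewrite setIC.
have s2 : pr nu RC = pr nu C' + pr nu (RC `&` ~` G).
  by rewrite (pr_split nu mRC mG) C'E setIC.
have b1 : pr nu ((Er r `&` RC) `&` ~` G) <= eps.
  apply: le_trans GC; apply: pr_mono; [|exact: measurableC|by move=> y []].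
  by apply: measurableI; [exact: measurableI|exact: measurableC].
have b2 : pr nu (RC `&` ~` G) <= eps.
  apply: le_trans GC; apply: pr_mono; [|exact: measurableC|by move=> y []].
  by apply: measurableI; [|exact: measurableC].
rewrite EC EE CC s1 s2 indC' -/C.
have z1 := pr_ge0 nu ((Er r `&` RC) `&` ~` G); have z2 := pr_ge0 nu (RC `&` ~` G).
have z3 := pr_ge0 nu (Er r); have z4 := pr_le1 nu (mEr r).
set u1 := pr nu _ in b1 z1 *; set u2 := pr nu (RC `&` _) in b2 z2 *.
rewrite ler_norml; apply/andP; split; nra.
Qed.

(** [Er r] is the event [E] seen from the [r]-th point of the path. It may read all digits, but
    otherwise only coordinates in [S r], which excludes the first [r] steps and, for large [r], any
    given coordinate that is not a digit. So [E] is independent of every cylinder, hence of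
    itself. *)
Lemma zero_one : pr nu E = 0 \/ pr nu E = 1.
Proof.
have ind l v : pr nu (E `&` cyl l v) = pr nu E * pr nu (cyl l v).
  apply/eqP; rewrite -subr_eq0 -normr_le0; apply/ler_addgt0Pl => x x0; rewrite addr0.
  by apply: le_trans (indep_approx l v (_ : 0 < x / 2)) _; lra.
suff h : pr nu E = pr nu E * pr nu E.
  have : pr nu E * (1 - pr nu E) == 0 by rewrite mulrBr mulr1 -h subrr.
  rewrite mulf_eq0 => /orP[/eqP->|/eqP h']; [by left|right; lra].
pose m2 : {measure set VT -> \bar R} := mscale (NngNum (pr_ge0 nu E)) nu.
have hh : forall A, measurable A -> (mrestr nu mE : {measure set VT -> \bar R}) A = m2 A.
  apply: cyl_measure_unique.
    by rewrite /= /mrestr setTI prE// ltry.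
  move=> l; exists l => // v; rewrite /= /mrestr /m2 /= /mscale /= setIC.
  rewrite prE; last by apply: measurableI => //; exact: measurable_cyl.
  by rewrite ind [nu _]prE//; exact: measurable_cyl.
have := hh E mE; rewrite /= /mrestr /m2 /= /mscale /= setIid => h.
by rewrite {1}/pr h [nu _]prE.
Qed.
End ZeroOne.

(** * Leaving finite subtrees *)

Lemma inGW_cat n pre u w : inGW n pre (u ++ w) = inGW n pre u && inGW n (pre ++ u) w.
Proof.
elim: u pre => [|i u IH] pre /=; first by rewrite cats0.
by rewrite IH cat_rcons andbA.
Qed.

(* Excludes the redundant codes [(p.+1, 0 :: w)] of the vertices [(p, w)]. *)
Definition canonical (p : nat) (w : seq nat) := (p == 0%N) || (0 < head 0%N w)%N.

Lemma present0 y w : isSome (B y 0 w) = inGW (fun u => y (PN 0 u)) [::] w.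
Proof. by rewrite /B /= /pcoord; case: ifP. Qed.

Lemma presentS y p i w : isSome (B y p.+1 (i.+1 :: w)) =
  (i.+1 < y (PK p))%N && inGW (fun u => y (PN p.+1 u)) [:: i.+1] w.
Proof. by rewrite /B /= /pcoord; case: ifP. Qed.

Lemma present_rcons y p w i : canonical p w ->
  isSome (B y p (rcons w i)) = isSome (B y p w) && (i < y (PN p w))%N.
Proof.
case: p => [_|p]; first by rewrite !present0 -cats1 inGW_cat /= andbT.
case: w => [|[|j] w] // _.
by rewrite rcons_cons !presentS -cats1 inGW_cat /= andbT andbA.
Qed.

Section DepthFirst.
Variable y : V.
Let th := B y.
Hypothesis inf_branch : forall p, exists q, (p < q)%N /\ isSome (th q [:: 1%N]).

Let jump_indep p w w' : jump th p w = jump th p w'.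
Proof.
case: (jumpP th p) => [[q [h1 h2 h3]]|h]; first by rewrite !(jump_some _ h1 h2 h3).
by have [q [pq hq]] := inf_branch p; have := h _ pq; rewrite hq.
Qed.

(** The vertex explored next once [(p, w)] and all its descendants are finished. *)
Definition after p w := if nextw_rev th p (rev w) is Some w' then (p, w') else jump th p w.

Lemma after_rcons p w j : after p (rcons w j) =
  if isSome (th p (rcons w j.+1)) then (p, rcons w j.+1) else after p w.
Proof.
rewrite /after rev_rcons /= revK; case: ifP => // _.
by case: (nextw_rev th p (rev w)) => //; exact: jump_indep.
Qed.

Let lex_leaf p w : ~~ isSome (th p (rcons w 0%N)) -> lex_succ th (p, w) = after p w.
Proof. by rewrite lex_succE => /negbTE->. Qed.

Lemma siblings p w j0 N : (forall j, (j0 <= j)%N -> isSome (th p (rcons w j)) -> (j < N)%N) ->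
  (forall j, (j0 <= j)%N -> isSome (th p (rcons w j)) ->
     exists k, iter k (lex_succ th) (p, rcons w j) = after p (rcons w j)) ->
  forall j, (j0 <= j)%N -> isSome (th p (rcons w j)) ->
    exists k, iter k (lex_succ th) (p, rcons w j) = after p w.
Proof.
move=> hN hk j; have [n] := ubnP (N - j); elim: n j => // n IH j nj j0j hj.
have [k kE] := hk j j0j hj; move: kE; rewrite after_rcons; case: ifP => [h|_]; last by exists k.
move=> kE; have jN := hN _ j0j hj; have [||//|k' k'E] := IH j.+1; [lia|lia|].
by exists (k' + k)%N; rewrite iterD kE.
Qed.

Lemma subtree_exit p w n : canonical p w -> isSome (th p w) ->
  (forall u, size u = n -> ~~ inGW (fun v => y (PN p v)) w u) ->
  exists k, iter k (lex_succ th) (p, w) = after p w.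
Proof.
elim: n w => [|n IH] w cw hw fin; first by have := fin [::] erefl.
case: (boolP (isSome (th p (rcons w 0%N)))) => h0; last by exists 1%N; exact: lex_leaf.
have cr j : canonical p (rcons w j).
  move: cw; rewrite /canonical; case: (p == 0%N) => //=.
  by case: (w) => //.
have [||k kE] := @siblings p w 0 (y (PN p w)) _ _ 0%N isT h0.
- by move=> j _; rewrite present_rcons// => /andP[].
- move=> j _ hj; apply: IH => // u su.
  have := fin (j :: u); rewrite /= su => /(_ erefl); rewrite negb_and => /orP[|//].
  by move: hj; rewrite /th present_rcons// => /andP[_ ->].
- exists k.+1; rewrite iterSr lex_succE h0; exact: kE.
Qed.

Hypothesis finite0 : exists n, forall u, size u = n -> ~~ inGW (fun v => y (PN 0 v)) [::] u.
Hypothesis finiteS : forall p i, exists n, forall u, size u = n ->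
  ~~ inGW (fun v => y (PN p v)) [:: i] u.

(** The subtrees grafted on the ancestors up to [rho(r)] are finite, so the exploration leaves them
    all and meets the first vertex grafted higher; from there on it depends only on the tree seen
    from [rho(r)]. *)
Lemma exists_jump r : exists n, lex_vertex th n = jump th r [::].
Proof.
elim: r => [|r [n nE]].
  have [n fin] := finite0; have [//|//|//|k kE] := @subtree_exit 0 [::] n.
  by exists k; rewrite /lex_vertex kE.
case: (jumpP th r) => [[q [h1 h2 h3]]|h]; last first.
  by have [q [pq hq]] := inf_branch r; have := h _ pq; rewrite hq.
rewrite (jump_some _ h1 h2 h3) in nE.
have [qr|qr] := eqVneq q r.+1; last first.
  exists n; rewrite nE; apply/esym; apply: jump_some => //; first by lia.
  by move=> k /andP[h4 h5]; apply: h3; lia.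
subst q.
have [||k kE] := @siblings r.+1 [::] 1 (y (PK r)) _ _ 1%N isT h2.
- by move=> [//|j] _; rewrite presentS => /andP[].
- move=> [//|j] _ hj; have [n' fin] := finiteS r.+1 j.+1.
  by apply: (@subtree_exit r.+1 [:: j.+1] n').
- by exists (k + n)%N; rewrite /lex_vertex iterD -/(lex_vertex th n) nE kE.
Qed.
End DepthFirst.

(** * Extinction of critical Galton-Watson trees *)

Section Extinction.
Context {R : realType}.
Variables (b : nat) (mu mubar : nat -> R) (nu : probability VT R).
Hypothesis HL : brw_law b mu mubar nu.
Let m := marg b mu mubar.
Let law : forall (l : seq prim) v, uniq l ->
  nu (cyl l v) = (\prod_(i <- l) m i (v i))%:E := bl_law HL.
Let m_ge0 := marg_ge0 HL.
Let mu_ge0 := bl_mu_ge0 HL.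

Lemma mu_mean_le n : \sum_(0 <= k < n) k%:R * mu k <= 1.
Proof.
rewrite -lee_fin -(bl_mu_mean HL) -sumEFin; apply: nneseries_lim_ge => k _ _.
by rewrite lee_fin mulr_ge0.
Qed.

Lemma mu_le1 k : (0 < k)%N -> mu k <= 1.
Proof.
move=> k0; have := mu_mean_le k.+1; rewrite big_nat_recr//= => h.
have : 0 <= \sum_(0 <= i < k) i%:R * mu i by apply: sumr_ge0 => i _; rewrite mulr_ge0.
have : 1 * mu k <= k%:R * mu k by apply: ler_wpM2r => //; rewrite ler1n.
lra.
Qed.

Definition reach (n p : nat) (w : seq nat) : set VT :=
  [set y : VT | exists u, size u = n /\ inGW (fun v => y (PN p v)) w u].

Lemma measurable_reach n p w : measurable (reach n p w).
Proof.
apply: meas_exists => u; apply: meas_and; first exact: meas_const.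
exact: (dmeas_pred (fun x : bool => x) (@dmeas_inGW p w u)).
Qed.

Lemma reachS n p w y : reach n.+1 p w y <-> exists i, (i < y (PN p w))%N /\ reach n p (rcons w i) y.
Proof.
split => [[[|i u] [su hu]]|[i [h1 [u [su h2]]]]] //.
  by move: hu => /= /andP[h1 h2]; exists i; split => //; exists u; split => //; case: su.
by exists (i :: u); rewrite /= su h1.
Qed.

Lemma reach_insens n p w i : (forall u, i != PN p (w ++ u)) -> insens i (reach n p w).
Proof.
move=> h y k; split => -[u [su hu]]; exists u; split => //; move: hu;
rewrite (@eq_inGW _ (fun v => y (PN p v)) _ w)// => v; by rewrite upd_neq// eq_sym.
Qed.

(** The subtrees of the [k] children are treated one at a time. That the last one does not reach
    generation [n] is insensitive to the others, so this event is added to [C] for the next step;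
    the outcome is a product, sharper than the sum of the bounds. *)
Let union_bound n (a : R) p w : 0 <= a <= 1 ->
  (forall i (C : set VT), measurable C -> (forall u, insens (PN p (rcons w i ++ u)) C) ->
     pr nu (C `&` reach n p (rcons w i)) <= a * pr nu C) ->
  forall k (C : set VT), measurable C ->
    (forall i u, (i < k)%N -> insens (PN p (rcons w i ++ u)) C) ->
    pr nu (C `&` [set y | exists i, (i < k)%N /\ reach n p (rcons w i) y]) <=
    (1 - (1 - a) ^+ k) * pr nu C.
Proof.
move=> /andP[a0 a1] ha; elim => [|k IH] C mC fC.
  rewrite expr0 subrr mul0r (_ : C `&` _ = set0) ?/pr ?measure0//.
  by apply/seteqP; split => // y [_ [i []]].
have mr := measurable_reach n p.
pose A := reach n p (rcons w k).
have mA : measurable A by exact: mr.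
have mU : measurable [set y : VT | exists i, (i < k)%N /\ reach n p (rcons w i) y].
  by apply: meas_exists => i; apply: meas_and; [exact: meas_const|exact: mr].
have h1 : pr nu (C `&` A) <= a * pr nu C.
  by apply: ha => // u; exact: fC.
pose C' := C `&` ~` A.
have mC' : measurable C' by apply: measurableI => //; exact: measurableC.
have h2 : pr nu (C' `&` [set y | exists i, (i < k)%N /\ reach n p (rcons w i) y]) <=
    (1 - (1 - a) ^+ k) * pr nu C'.
  apply: IH => // i u ik; apply: insens_setI; first by apply: fC; exact: ltnW.
  apply: insens_setC; apply: reach_insens => u'; apply/eqP => -[]; rewrite !cat_rcons.
  by move/eqP; rewrite eqseq_cat// eqseq_cons (ltn_eqF ik) andbF.
set D := [set y | _] in h2 *; rewrite -/D.
have mD : measurable [set y : VT | exists i, (i < k.+1)%N /\ reach n p (rcons w i) y].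
  by apply: meas_exists => i; apply: meas_and; [exact: meas_const|exact: mr].
have h3 : pr nu (C `&` [set y | exists i, (i < k.+1)%N /\ reach n p (rcons w i) y]) <=
    pr nu (C `&` A) + pr nu (C' `&` D).
  apply: pr_leD; [exact: measurableI|exact: measurableI|exact: measurableI|].
  move=> y [Cy [i []]]; case: (pselect (A y)) => Ay; first by left.
  rewrite ltnS leq_eqVlt => /orP[/eqP->//|ik] hi; right; split => //; by exists i.
have h4 : pr nu C = pr nu (C `&` A) + pr nu C' by exact: pr_split.
have z1 : 0 <= (1 - a) ^+ k by rewrite exprn_ge0// subr_ge0.
rewrite exprS; move: ((1 - a) ^+ k) z1 h2 => z z1 h2.
have hz : z * pr nu (C `&` A) <= z * (a * pr nu C) by apply: ler_wpM2l.
rewrite h4 in hz h1 *; nra.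
Qed.

Let pow_bound (a : R) k : 0 <= a <= 1 -> 1 - (1 - a) ^+ k.+2 <= k.+2%:R * a - a ^+ 2.
Proof.
move=> /andP[a0 a1]; elim: k => [|k IH]; first by rewrite !expr2; lra.
rewrite exprS -natr1.
have : 0 <= (1 - a) ^+ k.+2 <= 1.
  by rewrite exprn_ge0 ?subr_ge0//= exprn_ile1 ?subr_ge0// lerBlDr lerDl.
move: ((1 - a) ^+ k.+2) IH => z IH /andP[z0 z1]; nra.
Qed.

Let pow_bound1 (a : R) k : 0 <= a <= 1 -> 1 - (1 - a) ^+ k <= k%:R * a.
Proof. by move=> ha; have := bernoulli_sub k ha; lra. Qed.

(* Criticality gives the bound [a]; one atom [k0 >= 2] of [mu] makes it strict. *)
Lemma reach_step (a : R) n p w k0 : 0 <= a <= 1 -> (2 <= k0)%N ->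
  (forall i (C : set VT), measurable C -> (forall u, insens (PN p (rcons w i ++ u)) C) ->
     pr nu (C `&` reach n p (rcons w i)) <= a * pr nu C) ->
  forall (C : set VT), measurable C -> (forall u, insens (PN p (w ++ u)) C) ->
    pr nu (C `&` reach n.+1 p w) <= (a - mu k0 * a ^+ 2) * pr nu C.
Proof.
move=> ha k02 hi C mC fC.
have mCr : measurable (C `&` reach n.+1 p w).
  by apply: measurableI => //; exact: measurable_reach.
apply: (@resample_le _ nu m m_ge0 law _ (PN p w) _ k0.+1 mCr) => K kK.
have fCw : insens (PN p w) C by have := fC [::]; rewrite cats0.
have hk k : pr nu [set y | (C `&` reach n.+1 p w) (upd y (PN p w) k)] <= (1 - (1 - a) ^+ k) * pr nu C.
  have := union_bound ha hi (k := k) mC.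
  have -> : [set y | (C `&` reach n.+1 p w) (upd y (PN p w) k)] =
     C `&` [set y | exists i, (i < k)%N /\ reach n p (rcons w i) y].
    have ri i : insens (PN p w) (reach n p (rcons w i)).
      apply: reach_insens => u; apply/eqP => -[] /(congr1 size).
      by rewrite size_cat size_rcons; lia.
    apply/seteqP; split => y.
      move=> [/fCw Cy /reachS[i []]]; rewrite upd_eq => ik /ri h.
      by split => //; exists i.
    move=> [Cy [i [ik h]]]; split; first exact/fCw.
    by apply/reachS; exists i; rewrite upd_eq; split => //; exact/ri.
  by apply => i u _; rewrite cat_rcons; exact: fC.
have a01 := ha; move: a01 => /andP[a0 a1].
have C0 := pr_ge0 nu C.
apply: (@le_trans _ _ (\sum_(0 <= k < K) (mu k * (k%:R * a - (k == k0)%:R * a ^+ 2)) * pr nu C)).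
  apply: ler_sum => k _; rewrite -mulrA -[m (PN p w) k]/(mu k); apply: ler_wpM2l => //.
  apply: (le_trans (hk k)); apply: ler_wpM2r => //.
  have [->|_] := eqVneq k k0; last by rewrite mul0r subr0; exact: pow_bound1.
  by rewrite mul1r; case: (k0) k02 => [//|[//|k']] _; exact: pow_bound.
rewrite -mulr_suml; apply: ler_wpM2r => //.
rewrite (eq_bigr (fun k => a * (k%:R * mu k) - a ^+ 2 * ((k == k0)%:R * mu k))); last first.
  by move=> k _; ring.
rewrite sumrB -!mulr_sumr.
have -> : \sum_(0 <= k < K) (k == k0)%:R * mu k = mu k0.
  rewrite big_mkord (bigD1 (Ordinal kK)) //= eqxx mul1r big1 ?addr0// => i ik.
  by rewrite (_ : (nat_of_ord i == k0) = false) ?mul0r//; apply/negbTE.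
have := mu_mean_le K => hm.
have : a * (\sum_(0 <= k < K) k%:R * mu k) <= a * 1 by apply: ler_wpM2l.
lra.
Qed.

Fixpoint extb (del : R) (n : nat) : R :=
  if n is n'.+1 then extb del n' - del * extb del n' ^+ 2 else 1.

Lemma extb_itv del n : 0 <= del <= 1 -> 0 <= extb del n <= 1.
Proof.
move=> /andP[d0 d1]; elim: n => [|n /andP[h0 h1]] /=; first by rewrite ler01 lexx.
have : extb del n ^+ 2 <= extb del n by rewrite expr2 ler_piMl.
have := sqr_ge0 (extb del n); move: (extb del n ^+ 2) => z z0 z1.
have : del * z <= 1 * z by apply: ler_wpM2r.
have : 0 <= del * z by apply: mulr_ge0.
by move=> *; apply/andP; split; lra.
Qed.

(** The sequence is nonincreasing, so each of the [n] decrements that lead from 1 down to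
    [extb del n] is at least [del * extb del n ^+ 2]. In particular it tends to 0 when [del > 0]. *)
Lemma extb_small del n : 0 <= del <= 1 -> n%:R * (del * extb del n ^+ 2) <= 1 - extb del n.
Proof.
move=> hd; elim: n => [|n IH] /=; first by rewrite mul0r subrr.
have /andP[h0 h1] := extb_itv n hd; have := extb_itv n.+1 hd => /= /andP[g0 g1].
have d0 : 0 <= del by case/andP: hd.
set x := extb del n in IH h0 h1 g0 g1 *; set x' := x - _ in g0 g1 *.
have dx : 0 <= del * x ^+ 2 by rewrite mulr_ge0// sqr_ge0.
have le : x' ^+ 2 <= x ^+ 2 by rewrite lerXn2r// ?nnegrE// /x'; lra.
have le2 : del * x' ^+ 2 <= del * x ^+ 2 by apply: ler_wpM2l.
have : n%:R * (del * x' ^+ 2) <= n%:R * (del * x ^+ 2) by apply: ler_wpM2l.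
rewrite -natr1 mulrDl mul1r.
have x'E : x' = x - del * x ^+ 2 by [].
move: (del * x ^+ 2) (del * x' ^+ 2) le2 IH x'E => A1 A2 ? ? ? ?; lra.
Qed.

Lemma reach_bound k0 n p w (C : set VT) : (2 <= k0)%N -> measurable C ->
  (forall u, insens (PN p (w ++ u)) C) ->
  pr nu (C `&` reach n p w) <= extb (mu k0) n * pr nu C.
Proof.
move=> k02.
have hd : 0 <= mu k0 <= 1 by rewrite mu_ge0 mu_le1//; exact: ltnW.
elim: n w C => [|n IH] w C mC fC.
  rewrite /= mul1r; apply: pr_mono; [|exact: mC|by move=> y []].
  by apply: measurableI => //; exact: measurable_reach.
by apply: reach_step => //; [exact: extb_itv|move=> i C0 mC0 fC0; exact: IH].
Qed.

Lemma extinct_null p w : mu 0 != 0 ->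
  pr nu [set y : VT | forall n, exists u, size u = n /\ inGW (fun v => y (PN p v)) w u] = 0.
Proof.
move=> mu00; set A := [set y | _].
have mA : measurable A by apply: meas_forall => n; exact: measurable_reach.
(* With mean 1 and [mu 0] nonzero, [mu] cannot be concentrated on 0 and 1. *)
have [k0 [k02 hk0]] : exists k0, (2 <= k0)%N /\ mu k0 != 0.
  apply: contrapT => h.
  have z k : (2 <= k)%N -> mu k = 0 by move=> hk; apply/eqP/negPn/negP => hn; apply: h; exists k.
  have b2 : mubar 2 = 0.
    by apply: EFin_inj; rewrite (bl_mubar HL) ereal_series eseries0// => i _ hi; rewrite z.
  have m1 : mu 1 = 1.
    apply: EFin_inj; rewrite -(bl_mu_mean HL) (@eseries_single _ _ 1%N) ?mul1r//.
      by move=> k; rewrite lee_fin mulr_ge0.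
    by move=> [|[|k]] // _; rewrite ?mul0r// z// mulr0.
  by have := mubarE HL 1; rewrite (mubar1 HL) b2 m1 => h1; case/eqP: mu00; lra.
have hd : 0 < mu k0 by rewrite lt_neqAle eq_sym hk0 mu_ge0.
have hb n : n%:R * (mu k0 * pr nu A ^+ 2) <= 1.
  have fT u : insens (PN p (w ++ u)) [set: VT] by [].
  have := reach_bound n k02 measurableT fT; rewrite setTI prT mulr1 => h1.
  have h2 : pr nu A <= pr nu (reach n p w).
    by apply: pr_mono; [exact: mA|exact: measurable_reach|move=> y; apply].
  have hd' : 0 <= mu k0 <= 1 by rewrite mu_ge0 mu_le1//; exact: ltnW.
  have h3 := extb_small n hd'; have /andP[h4 h5] := extb_itv n hd'.
  have h6 : pr nu A ^+ 2 <= extb (mu k0) n ^+ 2.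
    by rewrite lerXn2r// ?nnegrE ?pr_ge0//; exact: le_trans h1.
  apply: (@le_trans _ _ (n%:R * (mu k0 * extb (mu k0) n ^+ 2))); last lra.
  by do 2 apply: ler_wpM2l => //.
apply/eqP; rewrite -sqrf_eq0; apply/negPn/negP => hA.
have A2 : 0 < mu k0 * pr nu A ^+ 2 by rewrite mulr_gt0// lt_neqAle eq_sym hA sqr_ge0.
have := hb (Num.truncn ((mu k0 * pr nu A ^+ 2)^-1)).+1.
rewrite leNgt => /negP; apply; rewrite -ltr_pdivrMr// mul1r; exact: truncnS_gt.
Qed.

Lemma branching_null r : mu 0 != 0 ->
  pr nu [set y : VT | forall q, (r <= q)%N -> (y (PK q) <= 1)%N] = 0.
Proof.
move=> mu00; set A := [set y | _].
have mA1 q : measurable [set y : VT | (y (PK q) <= 1)%N].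
  exact: (meas_coord (PK q) (fun a => (a <= 1)%N)).
have mA : measurable A.
  by apply: meas_forall => q; apply: meas_imply; [exact: meas_const|exact: mA1].
pose An n := [set y : VT | forall j, (j < n)%N -> (y (PK (r + j)%N) <= 1)%N].
have mAn n : measurable (An n).
  by apply: meas_forall => j; apply: meas_imply; [exact: meas_const|exact: mA1].
have pAn n : pr nu (An n) = mubar 1 ^+ n.
  elim: n => [|n IH].
    by rewrite expr0 -(prT nu); congr pr; apply/seteqP; split.
  have -> : An n.+1 = An n `&` [set y : VT | (y (PK (r + n)%N) <= 1)%N].
    apply/seteqP; split => y /=.
      by move=> h; split => [j jn|]; apply: h => //; exact: ltnW.
    by move=> [h1 h2] j; rewrite ltnS leq_eqVlt => /orP[/eqP->//|]; exact: h1.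
  rewrite (@indep_coord _ nu m m_ge0 law _ _ (fun a => (a <= 1)%N))//.
    by rewrite (pr_PK_le1 HL) IH exprSr.
  move=> y k /=; split => h j jn; have := h j jn; rewrite upd_neq//; apply/eqP => -[]; lia.
have mb : 0 <= mubar 1 < 1.
  by rewrite (mubar_ge0 HL) (mubar1 HL) /=; have := mu_ge0 0; have : mu 0 != 0 := mu00; lra.
apply/eqP; rewrite eq_le pr_ge0 andbT; apply/ler_addgt0Pl => x x0; rewrite addr0.
have [n hn] : exists n, mubar 1 ^+ n < x.
  have /cvgrPdist_lt /(_ x x0) [n _ hn] : (fun n => mubar 1 ^+ n) @ \oo --> (0 : R).
    by apply: cvg_expr; case/andP: mb => ? ?; rewrite ger0_norm.
  exists n; have := hn n (leqnn n) => /=; rewrite sub0r normrN ger0_norm//.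
  by rewrite exprn_ge0//; case/andP: mb.
apply: ltW; apply: le_lt_trans hn; rewrite -pAn; apply: pr_mono => //.
by move=> y h j _; apply: h; exact: leq_addr.
Qed.

End Extinction.

(** * Ergodicity of the label sequence *)

(** The limsup of the frequencies of [d] is at least [lam], in countable form. *)
Definition tailev (R : realType) (lam : R) (d : nat -> bool) :=
  forall j N, exists n, (N <= n)%N /\ (lam - j.+1%:R^-1) * n%:R <= (hits d n)%:R.

(** Changing and shifting a finite part moves the counts by a bounded amount, for which half of the
    slack is given up: the index [2 * j + 1] halves [j.+1%:R^-1], and [T] is the time after which
    the other half exceeds the boundary terms. *)
Lemma tailev_tail (R : realType) (lam : R) d d' a a' :
  (forall k, d' (a' + k)%N = d (a + k)%N) -> tailev lam d -> tailev lam d'.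
Proof.
move=> h td j N.
pose x : R := lam - j.+1%:R^-1.
pose T : R := (2 * j.+1%:R) * (a%:R + `|x| * (a%:R + a'%:R)).
have [n [hn1 hn2]] := td (2 * j + 1)%N (a + N + (Num.truncn T).+1)%N.
have [k kE] : exists k, n = (a + k)%N by exists (n - a)%N; lia.
subst n; exists (a' + k)%N; split; first by lia.
rewrite hitsD.
have -> : hits (fun i => d' (a' + i)%N) k = hits (fun i => d (a + i)%N) k.
  by apply: eq_bigr => i _; rewrite h.
have ha : (hits d a)%:R <= a%:R :> R by rewrite ler_nat hits_le.
have ha' : 0 <= (hits d' a')%:R :> R by [].
have e2 : (2 * j + 1).+1%:R^-1 = j.+1%:R^-1 / 2 :> R.
  by rewrite (_ : (2 * j + 1).+1 = (j.+1 * 2)%N)%N; [rewrite natrM invfM|lia].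
rewrite e2 hitsD natrD in hn2; rewrite natrD.
have i0 : 0 < j.+1%:R^-1 :> R by rewrite invr_gt0 ltr0n.
have xE : lam = x + j.+1%:R^-1 by rewrite /x; ring.
rewrite -/x; rewrite xE in hn2.
have Tn : T < (a + k)%:R.
  apply: (@lt_le_trans _ _ (Num.truncn T).+1%:R); first exact: truncnS_gt.
  by rewrite ler_nat; lia.
have Tn2 : a%:R + `|x| * (a%:R + a'%:R) < j.+1%:R^-1 / 2 * (a + k)%:R.
  have -> : a%:R + `|x| * (a%:R + a'%:R) = j.+1%:R^-1 / 2 * T.
    by rewrite /T mulrA (_ : j.+1%:R^-1 / 2 * (2 * j.+1%:R) = 1) ?mul1r//; field.
  by rewrite ltr_pM2l// divr_gt0.
have xa : x * a'%:R <= `|x| * a'%:R by apply: ler_wpM2r => //; exact: ler_norm.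
have xa2 : - (x * a%:R) <= `|x| * a%:R.
  by rewrite -mulNr; apply: ler_wpM2r => //; rewrite -normrN; exact: ler_norm.
move: hn2 Tn2 xa xa2 ha ha'; rewrite !natrD.
move: x {T Tn xE hn1} => x; move: `|x| (j.+1%:R^-1) => ax dl.
move: (hits d a)%:R (hits d' a')%:R (hits _ k)%:R a%:R a'%:R k%:R => H1 H2 H3 A A' K.
nra.
Qed.

Fixpoint plab (e : nat -> prim) (y : V) (k : nat) : W :=
  if k is k'.+1 then stepW (y (e k)) (plab e y k') else org y.

Lemma psis_plab e r (y : V) j : (forall k, isPX (e k)) -> injective e ->
  psis e r y (PU j) = (plab e y r).2 j.
Proof.
move=> eX ei; elim: r j => [//|r IH] j; rewrite /= (psi_PU _ _ (plab e y r).1)// psis_other.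
- by congr ((stepW _ _).2 j); rewrite [RHS]surjective_pairing; congr pair; apply/funext => i.
- by move=> p /andP[_ pr]; apply/eqP => /ei; lia.
- by have := eX r.+1; case: (e r.+1).
Qed.

Section LabelErgodicity.
Context {R : realType}.
Variables (b : nat) (mu mubar : nat -> R) (nu : probability VT R).
Hypothesis HL : brw_law b mu mubar nu.
Let m := marg b mu mubar.
Let law : forall (l : seq prim) v, uniq l ->
  nu (cyl l v) = (\prod_(i <- l) m i (v i))%:E := bl_law HL.
Let m_ge0 := marg_ge0 HL.
Variable F : (nat -> option W) -> Prop.
Hypothesis F_shift : forall h s, F (fun n => omap (shiftW h) (s n)) <-> F s.
Hypothesis F_meas : forall k, measurable [set y : VT | F (fun n => lab y (k + n)%N)].

Definition Fat (k : nat) (y : V) : bool := `[< F (fun n => lab y (k + n)%N) >].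

Let mFat k : dmeas (fun y : VT => Fat k y).
Proof. exact: dmeas_asbool. Qed.

Lemma Fat_ext y y' a a' h :
  (forall n, lab y' (a' + n)%N = omap (shiftW h) (lab y (a + n)%N)) -> Fat a' y' = Fat a y.
Proof.
move=> e; apply/asboolP/asboolP.
  by rewrite (_ : (fun n => _) = fun n => omap (shiftW h) (lab y (a + n)%N)) ?F_shift//; apply/funext.
by rewrite (_ : (fun n => lab y' _) = fun n => omap (shiftW h) (lab y (a + n)%N)) ?F_shift//; apply/funext.
Qed.

Lemma Fat_shiftT k y : regular y -> Fat k (shiftT y) = Fat k.+1 y.
Proof.
move=> /lex_label_shiftT[h hn]; apply: (@Fat_ext _ _ _ _ h) => n; exact: hn.
Qed.

Lemma Fat_stationary (Q : (nat -> bool) -> Prop) :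
  (forall j, measurable [set y : VT | Q (fun k => Fat (j + k)%N y)]) ->
  forall j, pr nu [set y : VT | Q (fun k => Fat (j + k)%N y)] =
            pr nu [set y : VT | Q (fun k => Fat (0 + k)%N y)].
Proof.
move=> mQ; elim => [//|j IH]; rewrite -IH -(shiftT_preserves HL (mQ j)).
apply: (pr0_ext _ _ (measurableC measurable_regular) (regular_null HL)).
- exact: mQ.
- exact: (measurable_precomp measurable_shiftT (mQ j)).
- move=> y /contrapT hy /=; rewrite (_ : (fun k => _) = fun k => Fat (j + k)%N (shiftT y))//.
  by apply/funext => k; rewrite Fat_shiftT.
Qed.

Definition tailF (lam : R) : set VT := [set y : VT | tailev lam (fun k => Fat k y)].

Lemma measurable_tailF lam : measurable (tailF lam).
Proof.
apply: meas_forall => j; apply: meas_forall => N; apply: meas_exists => n.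
apply: meas_and; first exact: meas_const.
exact: (dmeas_pred (fun a : nat => (lam - j.+1%:R^-1) * n%:R <= a%:R) (dmeas_hits mFat 0 n)).
Qed.

Lemma tailF_ext lam y y' a a' h :
  (forall n, lab y' (a' + n)%N = omap (shiftW h) (lab y (a + n)%N)) ->
  tailF lam y <-> tailF lam y'.
Proof.
move=> e.
have E k : Fat (a' + k)%N y' = Fat (a + k)%N y.
  by apply: (@Fat_ext _ _ _ _ h) => n; rewrite -!addnA.
by split; [apply: (@tailev_tail _ lam _ _ a a')|apply: (@tailev_tail _ lam _ _ a' a)] => k; rewrite E.
Qed.

Let ray (k : nat) : prim := PX 0 (nseq k 0%N).

Let ray_inj : injective ray.
Proof. by move=> k k' [] /(congr1 size); rewrite !size_nseq. Qed.

Let lab_ray (y : V) n : (forall w, (0 < y (PN 0 w))%N) -> lab y n = Some (plab ray y n).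
Proof.
move=> hN.
have hG u pre : inGW (fun v => y (PN 0 v)) pre (nseq u 0%N).
  by elim: u pre => [//|u IH] pre /=; rewrite hN IH.
have nseqr k : rcons (nseq k 0%N) 0%N = nseq k.+1 0%N by elim: k => //= k ->.
have Bn k : B y 0 (nseq k 0%N) = Some (plab ray y k).
  rewrite /B /= /pcoord hG; congr Some.
  elim: k => [//|k IH].
  by rewrite -nseqr walk_rcons IH /= nseqr.
have vE k : lex_vertex (B y) k = (0%N, nseq k 0%N).
  elim: k => [//|k IH]; rewrite /lex_vertex iterS -/(lex_vertex _ k) IH lex_succE.
  by rewrite nseqr Bn.
by rewrite /lab /lex_label vE Bn.
Qed.

(* If [mu 0 = 0], then [mu] is the Dirac mass at 1. *)
Lemma zero_one_ray lam : mu 0 = 0 -> pr nu (tailF lam) = 0 \/ pr nu (tailF lam) = 1.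
Proof.
move=> mu00.
(* The tree reduced to its ray and seen from the [r]-th point. Offspring numbers are frozen to 1,
   which keeps every first child present; only the digits and the later steps of the ray are
   read. *)
pose prune r (y : V) : V := fun i => match i with
  | PN _ _ => 1%N
  | PX 0 w => if (0 < size w)%N then y (ray (r + size w)%N) else 0%N
  | PU j => y (PU j)
  | _ => 0%N end.
have mprune r : measurable_fun setT (prune r : VT -> VT).
  apply: measurable_coord_map => -[p w|p|j|[|p] w] /=; try exact: dmeas_cst; try exact: dmeas_coord.
  by case: (0 < size w)%N; [exact: dmeas_coord|exact: dmeas_cst].
apply: (@zero_one R b mu mubar nu HL ray _ ray_inj (tailF lam)
  (fun r => [set y | tailF lam (prune r y)]) (fun r i => exists k, (r < k)%N /\ i = ray k)).
- by [].
- exact: measurable_tailF.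
- by move=> r; exact: (measurable_precomp (mprune r) (measurable_tailF lam)).
- move=> r; exists [set y : VT | exists w, y (PN 0 w) = 0%N]; split.
  + by apply: meas_exists => w; exact: dmeas_coord.
  + by apply: pr_null_exists => w; [exact: dmeas_coord|rewrite (law_coord law)].
  + move=> y ny; have hN w : (0 < y (PN 0 w))%N.
      by rewrite lt0n; apply/eqP => h; apply: ny; exists w.
    pose y' := prune r (psis ray r y); change (tailF lam y <-> tailF lam y').
    have hN' w : (0 < y' (PN 0 w))%N by [].
    apply: (@tailF_ext lam y y' r 0%N (plab ray y r).1) => n; rewrite add0n !lab_ray//=.
    congr Some; elim: n => [|n IH].
      rewrite addn0 /= /origin /shiftW subrr; congr pair; apply/funext => j.
      exact: (psis_plab r y j _ ray_inj).
    rewrite addnS /= -stepW_shift -IH; congr stepW.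
    rewrite /y' /prune size_nseq/= psis_other ?addnS//.
    by move=> k /andP[_ kr]; apply/eqP => /ray_inj; lia.
- move=> r i ni iU y k /=.
  have -> // : prune r (upd y i k) = prune r y.
  apply/funext => -[p w|p|j|[|p] w] //=; last first.
    case: ifP => // w0; rewrite upd_neq//; apply/eqP => h; apply: ni.
    by exists (r + size w)%N; split => //; lia.
  by rewrite upd_neq//; case: i iU ni.
- by move=> r k /andP[k0 kr] [k' [rk /ray_inj]]; lia.
- move=> i _; case: (pselect (exists k, i = ray k)) => [[k ->]|nk].
    by exists k => r kr [k' [rk' /ray_inj]]; lia.
  by exists 0%N => r _ [k [_ h]]; apply: nk; exists k.
Qed.

Lemma zero_one_spine lam : mu 0 != 0 -> pr nu (tailF lam) = 0 \/ pr nu (tailF lam) = 1.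
Proof.
move=> mu00.
(* The tree seen from [rho(r)], where everything below [rho(r)] is cut off by making the new root a
   leaf; what remains is read off the digits and the coordinates attached to the later ancestors. *)
pose prune r (y : V) : V := fun i => match i with
  | PN p w => if p is 0 then 0%N else y (PN (r + p)%N w)
  | PX p w => if p is 0 then 0%N else y (PX (r + p)%N w)
  | PK p => y (PK (r + p)%N)
  | PU j => y (PU j) end.
have mprune r : measurable_fun setT (prune r : VT -> VT).
  by apply: measurable_coord_map => -[[|p] w|p|j|[|p] w] /=; try exact: dmeas_cst; try exact: dmeas_coord.
have spine_i : injective spine by move=> p q [].
pose Sr r (i : prim) := match i with
  | PN p _ => (r < p)%N | PX p _ => (r < p)%N | PK p => (r <= p)%N | PU _ => false end.
apply: (@zero_one R b mu mubar nu HL spine _ spine_i (tailF lam)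
  (fun r => [set y | tailF lam (prune r y)]) (fun r i => Sr r i)).
- by [].
- exact: measurable_tailF.
- by move=> r; exact: (measurable_precomp (mprune r) (measurable_tailF lam)).
- move=> r.
  pose N1 : set VT := [set y : VT | exists p w, forall n, exists u,
     size u = n /\ inGW (fun v => y (PN p v)) w u].
  pose N2 : set VT := [set y : VT | exists r, forall q, (r <= q)%N -> (y (PK q) <= 1)%N].
  have mreach p w : measurable [set y : VT | forall n, exists u, size u = n /\ inGW (fun v => y (PN p v)) w u].
    by apply: meas_forall => n; exact: measurable_reach.
  have mN1 : measurable N1 by apply: meas_exists => p; apply: meas_exists => w; exact: mreach.
  have mb r0 : measurable [set y : VT | forall q, (r0 <= q)%N -> (y (PK q) <= 1)%N].
    apply: meas_forall => q; apply: meas_imply; first exact: meas_const.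
    exact: (meas_coord (PK q) (fun a => (a <= 1)%N)).
  have mN2 : measurable N2 by apply: meas_exists => r0; exact: mb.
  have N10 : pr nu N1 = 0.
    apply: pr_null_exists => p; first by apply: meas_exists => w; exact: mreach.
    by apply: pr_null_exists => w; [exact: mreach|exact: (extinct_null HL)].
  have N20 : pr nu N2 = 0.
    by apply: pr_null_exists => r0; [exact: mb|exact: (branching_null HL)].
  exists (N1 `|` N2); split; first exact: measurableU.
    have := @pr_leD _ _ _ nu _ _ _ (measurableU _ _ mN1 mN2) mN1 mN2 (fun y h => h).
    by rewrite N10 N20 addr0 => h; apply/eqP; rewrite eq_le h pr_ge0.
  move=> y ny.
  have fin p w : exists n, forall u, size u = n -> ~~ inGW (fun v => y (PN p v)) w u.
    apply: contrapT => h; apply: ny; left; exists p, w => n; apply: contrapT => h2; apply: h.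
    by exists n => u su; apply/negP => hu; apply: h2; exists u.
  have infb p : exists q, (p < q)%N /\ isSome (B y q [:: 1%N]).
    apply: contrapT => h; apply: ny; right; exists p => q pq; rewrite leqNgt; apply/negP => hq.
    by apply: h; exists q.+1; rewrite B_leaf.
  pose y' := prune r (psis spine r y); change (tailF lam y <-> tailF lam y').
  set h := (ancV y r).1.
  have psE i : ~~ isPU i -> (forall p, (0 < p <= r)%N -> i != spine p) -> psis spine r y i = y i.
    by move=> iU hi; rewrite psis_other.
  have ancE p : ancV y' p = shiftW h (ancV y (r + p)%N).
    elim: p => [|p IH].
      rewrite addn0 /= /origin /shiftW subrr; congr pair; apply/funext => j.
      exact: psis_spine_PU.
    rewrite addnS /= -stepW_shift -IH; congr stepW.
    rewrite /pcoord /y' /= addnS psE// => k /andP[_ kr].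
    by rewrite -/(spine _) spine_inj; apply/eqP; lia.
  have BE p i w : B y' p.+1 (i.+1 :: w) = omap (shiftW h) (B y (r + p.+1)%N (i.+1 :: w)).
    rewrite addnS /B [brw _ _ _ _]/= [brw pcoord y _ _]/= /pcoord.
    have -> : y' (PK p) = y (PK (r + p)%N) by rewrite /y' /= psE.
    rewrite (@eq_inGW _ (fun u => y (PN (r + p)%N.+1 u)) _ [:: i.+1]).
      case: ifP => // _; congr Some.
      rewrite -[LHS]/(walk (fun u => y' (PX p.+1 u)) [::] (ancV y' p.+1) (i.+1 :: w)).
      rewrite -[RHS]/(shiftW h (walk (fun u => y (PX (r + p)%N.+1 u)) [::]
        (ancV y (r + p)%N.+1) (i.+1 :: w))).
      rewrite ancE addnS -walk_shift.
      apply: eq_walk_cons => u; rewrite /y' /= addnS psE// => k _; exact: spine_neq.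
    by move=> u; rewrite /y' /= addnS psE.
  have BS p i w : isSome (B y' (1 + p)%N (i.+1 :: w)) = isSome (B y (r.+1 + p)%N (i.+1 :: w)).
    by rewrite add1n BE addSnnS; case: (B y _ _).
  (* After [n0] steps in the tree and one step in the pruned tree, both explorations are at the
     first vertex grafted above [rho(r)]; [lex_succ_far] keeps them together from then on. *)
  have [n0 n0E] := exists_jump infb (fin 0%N [::]) (fun p i => fin p [:: i]) r.
  case: (jumpP (B y) r) => [[q [h1 h2 h3]]|hn]; last first.
    by have [q [rq hq]] := infb r; have := hn _ rq; rewrite hq.
  rewrite (jump_some _ h1 h2 h3) in n0E.
  have v1 : lex_vertex (B y') 1 = ((1 + (q - r.+1))%N, [:: 1%N]).
    rewrite -[lex_vertex _ 1]/(lex_succ (B y') (0%N, [::])) lex_succE.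
    have -> : isSome (B y' 0 (rcons [::] 0%N)) = false by rewrite present0.
    rewrite /=; apply: jump_some => //.
      by rewrite BS subnKC.
    move=> [//|k] /andP[_ kq]; rewrite -add1n BS; apply: h3; lia.
  have corr k : exists p i w, lex_vertex (B y') (1 + k)%N = ((1 + p)%N, i.+1 :: w) /\
      lex_vertex (B y) (n0 + k)%N = ((r.+1 + p)%N, i.+1 :: w).
    elim: k => [|k [p [i [w [e1 e2]]]]].
      by exists (q - r.+1)%N, 0%N, [::]; rewrite !addn0 v1 n0E subnKC.
    have [p1 [i1 [w1 [f1 f2]]]] := @lex_succ_far (B y) (B y') r.+1 1 p i w BS.
    exists p1, i1, w1; rewrite !addnS.
    rewrite -[lex_vertex (B y') _]/(lex_succ (B y') (lex_vertex (B y') (1 + k)%N)).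
    rewrite -[lex_vertex (B y) _]/(lex_succ (B y) (lex_vertex (B y) (n0 + k)%N)).
    by rewrite e1 e2.
  apply: (@tailF_ext lam y y' n0 1%N h) => n; rewrite /lab /lex_label.
  by have [p [i [w [-> ->]]]] := corr n; rewrite [LHS](BE p i w) -addSnnS.
- move=> r i ni iU y k /=.
  have -> // : prune r (upd y i k) = prune r y.
  apply/funext => -[[|p] w|p|j|[|p] w] //=; rewrite upd_neq//; apply/eqP => h; subst i; apply: ni => //=; lia.
- by move=> r k /andP[_ kr] /=; rewrite ltnNge kr.
- by move=> [p w|p|j|p w] // _; exists p.+1 => r pr /=; apply/negP; lia.
Qed.

(** Otherwise the limsup of the frequencies would be at least [lam] almost surely, by the zero-one
    law, and [KW_le] at a level strictly between the probability and [lam] would give a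
    contradiction. *)
Theorem ergodic_upper (lam : R) : pr nu [set y : VT | F (lab y)] < lam ->
  exists N : set VT, [/\ measurable N, pr nu N = 0 &
    forall y, ~ N y -> exists n0, forall n, (n0 <= n)%N ->
      (hits (fun k => Fat k y) n)%:R <= lam * n%:R].
Proof.
move=> hlam; exists (tailF lam); split; first exact: measurable_tailF.
  have : pr nu (tailF lam) = 0 \/ pr nu (tailF lam) = 1.
    by have [?|?] := eqVneq (mu 0) 0; [exact: zero_one_ray|exact: zero_one_spine].
  case=> // full; exfalso.
  set c := pr nu _ in hlam.
  have [j hj] : exists j, c < lam - j.+1%:R^-1.
    have d0 : 0 < lam - c by lra.
    exists (Num.truncn (lam - c)^-1).
    have h := truncnS_gt (lam - c)^-1.
    rewrite ltrBrDr addrC -ltrBrDr.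
    by rewrite -[ltRHS]invrK ltf_pV2 ?posrE ?invr_gt0 ?ltr0n.
  set l' := lam - _ in hj.
  have sub : tailF lam `<=` [set y : VT | exists M, quick l' M (fun k => Fat (0 + k)%N y)].
    move=> y /(_ j 1%N) [n [n0 hn]]; exists n, n; rewrite n0 leqnn; split => //.
  have mq : measurable [set y : VT | exists M, quick l' M (fun k => Fat (0 + k)%N y)].
    by apply: meas_exists => M; exact: (measurable_quick mFat).
  have full' : pr nu [set y : VT | exists M, quick l' M (fun k => Fat (0 + k)%N y)] = 1.
    apply/eqP; rewrite eq_le pr_le1//= -full; apply: pr_mono => //; exact: measurable_tailF.
  have l'1 : l' <= 1.
    have [y [M [n [/andP[n0 _] hn]]]] : [set y : VT | exists M, quick l' M (fun k => Fat (0 + k)%N y)] !=set0.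
      apply/set0P/eqP => h0; move: full'; rewrite h0 /pr measure0 /= => /eqP.
      by rewrite eq_sym oner_eq0.
    rewrite -(@ler_pM2r _ n%:R) ?ltr0n// mul1r; apply: (le_trans hn).
    by rewrite ler_nat hits_le.
  have c0 : 0 <= c by exact: pr_ge0.
  have l'b : 0 <= l' <= 1 by apply/andP; split; lra.
  have := KW_le mFat Fat_stationary l'b full'.
  rewrite (_ : pr nu [set y : VT | Fat 0 y] = c); first by lra.
  by congr pr; apply/seteqP; split => y /= /asboolP.
move=> y; rewrite /tailF /= /tailev => /existsNP[j /existsNP[N hN]]; exists N => n Nn.
apply: contrapT => /negP; rewrite -ltNge => h; apply: hN; exists n; split => //.
apply: ltW; apply: le_lt_trans h; apply: ler_wpM2r => //.
by rewrite lerBlDr lerDl invr_ge0.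
Qed.

End LabelErgodicity.

(** * The range of the label sequence *)

Section LastOccurrences.
Variables (T : eqType) (x : nat -> T).

Lemma size_undup_last a n : size (undup [seq x k | k <- iota a n]) =
  (\sum_(a <= k < a + n) `[< forall j, (k < j < a + n)%N -> x j <> x k >])%N.
Proof.
elim: n a => [|n IH] a; first by rewrite addn0 big_geq.
rewrite /= big_ltn; last by rewrite addnS ltnS leq_addr.
rewrite -addSnnS -IH.
have -> : `[< forall j, (a < j < a.+1 + n)%N -> x j <> x a >] =
    (x a \notin [seq x k | k <- iota a.+1 n]).
  apply/asboolP/idP => [h|h j hj e].
    by apply/mapP => -[j]; rewrite mem_iota => hj e; exact: (h j).
  by move/mapP: h; apply; exists j; rewrite ?mem_iota.
by case: ifP.
Qed.

Lemma size_undup_first n : size (undup [seq x k | k <- iota 1 n]) = ndistinct x n.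
Proof.
have -> : size (undup [seq x k | k <- iota 1 n]) = size (undup (rev [seq x k | k <- iota 1 n])).
  apply: perm_size; apply: uniq_perm; rewrite ?undup_uniq// => z.
  by rewrite !mem_undup mem_rev.
rewrite /ndistinct; elim: n => [|n IH]; first by rewrite big_geq.
have -> : iota 1 n.+1 = rcons (iota 1 n) n.+1 by rewrite -[n.+1 in LHS]addn1 iotaD cats1 add1n.
rewrite big_nat_recr//= -IH map_rcons rev_rcons /=.
have -> : `[< forall j, (0 < j < n.+1)%N -> x j <> x n.+1 >] =
    (x n.+1 \notin rev [seq x k | k <- iota 1 n]).
  rewrite mem_rev; apply/asboolP/idP => [h|h j hj e].
    by apply/mapP => -[j]; rewrite mem_iota add1n => hj e; exact: (h j).
  by move/mapP: h; apply; exists j; rewrite ?mem_iota ?add1n.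
by case: ifP => _ /=; rewrite ?addn0 ?addn1.
Qed.

End LastOccurrences.

Definition escape (m : nat) (s : nat -> option W) :=
  forall j, (0 < j <= m)%N -> s j <> s 0%N.

Definition comeback (s : nat -> option W) := exists j, (0 < j)%N /\ s j = s 0%N.

(** Counting distinct values at their last occurrences turns a condition on the past into one on the
    future, as in [escape] and [comeback]. *)
Lemma ndistinct_last (x : nat -> option W) n : ndistinct x n =
  (\sum_(1 <= k < n.+1) `[< forall j, (k < j < n.+1)%N -> x j <> x k >])%N.
Proof.
rewrite -[LHS](@size_undup_first {eclassic option W} x n).
by rewrite (@size_undup_last {eclassic option W}) add1n.
Qed.

(** A last occurrence at distance at least [m] from the end escapes during [m] steps; the last [m]
    indices are counted in full. *)
Lemma ndistinct_le (x : nat -> option W) m n :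
  (ndistinct x n <= hits (fun k => `[< escape m (fun j => x (k + j)%N) >]) n.+1 + m)%N.
Proof.
rewrite ndistinct_last.
case: (leqP n m) => nm.
  apply: (leq_trans _ (leq_addl _ _)); apply: (leq_trans _ nm).
  apply: (@leq_trans (\sum_(1 <= k < n.+1) 1)%N).
    by apply: leq_sum => k _; case: asboolP.
  by rewrite sum_nat_const_nat muln1 subn1.
have -> : n.+1 = ((n - m).+1 + m)%N by lia.
rewrite (@big_cat_nat _ _ _ (n - m).+1)//=; last by rewrite leq_addr.
apply: leq_add.
  rewrite hitsD; apply: leq_trans (leq_addr _ _).
  rewrite /hits [leqRHS]big_ltn//; apply: (leq_trans _ (leq_addl _ _)).
  rewrite [leqLHS]big_nat_cond [leqRHS]big_nat_cond; apply: leq_sum => k /andP[/andP[k1 k2] _].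
  case: asboolP => // h; case: asboolP => // ne; exfalso; apply: ne => j /andP[j0 jm].
  rewrite addn0; apply: h; lia.
apply: (@leq_trans (\sum_((n - m).+1 <= k < (n - m).+1 + m) 1)%N).
  by apply: leq_sum => k _; case: asboolP.
by rewrite sum_nat_const_nat muln1 addKn.
Qed.

Lemma ndistinct_ge (x : nat -> option W) n :
  (n <= ndistinct x n + hits (fun k => `[< comeback (fun j => x (k + j)%N) >]) n.+1)%N.
Proof.
rewrite ndistinct_last /hits [X in (_ + X)%N]big_ltn//.
apply: (@leq_trans (\sum_(1 <= k < n.+1) 1)%N).
  by rewrite sum_nat_const_nat muln1 subn1.
rewrite addnCA; apply: (leq_trans _ (leq_addl _ _)).
rewrite -big_split /=; apply: leq_sum => k _.
case: asboolP => // h; case: asboolP => // ne; exfalso; apply: h => j /andP[kj _] e.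
by apply: ne; exists (j - k)%N; split; [lia|rewrite addn0 subnKC// ltnW].
Qed.

Section Range.
Context {R : realType}.
Variables (b : nat) (mu mubar : nat -> R) (nu : probability VT R).
Hypothesis HL : brw_law b mu mubar nu.

Let omap_shift_inj h : injective (omap (shiftW h) : option W -> option W).
Proof.
move=> [[a f]|] [[a' f']|] //= [] /eqP; rewrite (inj_eq (addIr _)) => /eqP -> ->.
by [].
Qed.

Lemma escape_shift m h s : escape m (fun n => omap (shiftW h) (s n)) <-> escape m s.
Proof. by split => e j hj => [e'|/omap_shift_inj e']; apply: (e j hj); rewrite ?e'. Qed.

Lemma comeback_shift h s : comeback (fun n => omap (shiftW h) (s n)) <-> comeback s.
Proof. by split => -[j [j0 e]]; exists j; split => //; [exact: omap_shift_inj e|rewrite e]. Qed.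

Lemma measurable_escape m k : measurable [set y : VT | escape m (fun n => lab y (k + n)%N)].
Proof.
apply: meas_forall => j; apply: meas_imply; first exact: meas_const.
by apply: meas_not; exact: measurable_lab_eq.
Qed.

Lemma measurable_comeback k : measurable [set y : VT | comeback (fun n => lab y (k + n)%N)].
Proof.
apply: meas_exists => j; apply: meas_and; first exact: meas_const.
exact: measurable_lab_eq.
Qed.

Definition no_return : set VT := [set y : VT | forall n, (1 <= n)%N -> lab y n <> Some (org y)].

Lemma no_returnE : no_return = ~` [set y : VT | comeback (lab y)].
Proof.
apply/seteqP; split => y /=; first by move=> h [j [j0 e]]; exact: (h j j0).
by move=> h n n0 e; apply: h; exists n.
Qed.

Lemma measurable_no_return : measurable no_return.
Proof. by rewrite no_returnE; apply: measurableC; exact: (measurable_comeback 0). Qed.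

(** [ergodic_upper] is used with [escape m], whose probability decreases to that of [no_return] as
    [m] grows, which bounds the range from above, and with [comeback], the complement of
    [no_return], which bounds it from below. *)
Theorem range_cvg : exists N : set VT, [/\ measurable N, pr nu N = 0 &
  forall y, ~ N y ->
    (fun n => (ndistinct (lab y) n)%:R / n%:R : R) @ \oo --> pr nu no_return].
Proof.
set c := pr nu no_return.
have cG : pr nu [set y : VT | comeback (lab y)] = 1 - c.
  rewrite /c no_returnE pr_setC; last exact: (measurable_comeback 0).
  by rewrite opprB addrC subrK.
have dpos j : 0 < j.+1%:R^-1 :> R by rewrite invr_gt0 ltr0n.
have esc j : exists m, pr nu [set y : VT | escape m (lab y)] < c + j.+1%:R^-1.
  have [||m hm] := @pr_nondecreasing_ge _ _ _ nu (fun m => ~` [set y : VT | escape m (lab y)])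
      (1 - c - j.+1%:R^-1) (fun m => measurableC (measurable_escape m 0)).
  - by move=> m y h e; apply: h => i /andP[i0 im]; apply: e; rewrite i0 leqW.
  - rewrite (_ : \bigcup_k _ = [set y : VT | comeback (lab y)]).
      by rewrite cG; move: (dpos j); move: (j.+1%:R^-1) => dl; lra.
    apply/seteqP; split => y /=.
      move=> [m _ h]; apply: contrapT => nc; apply: h => i /andP[i0 _] e; apply: nc; by exists i.
    by move=> [i [i0 e]]; exists i => //= h; apply: (h i) => //; rewrite i0 leqnn.
  exists m; move: hm; rewrite pr_setC; last exact: (measurable_escape m 0).
  by move: (j.+1%:R^-1) => dl; lra.
have up j : exists N : set VT, [/\ measurable N, pr nu N = 0 & forall y, ~ N y ->
    exists m n0, forall n, (n0 <= n)%N -> (ndistinct (lab y) n)%:R <= (c + j.+1%:R^-1) * n.+1%:R + m%:R].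
  have [m hm] := esc j.
  have [N [mN N0 hN]] := ergodic_upper HL (@escape_shift m) (measurable_escape m) hm.
  exists N; split => // y /hN[n0 hn0]; exists m, n0 => n n0n.
  apply: (@le_trans _ _ ((hits (fun k => Fat (escape m) k y) n.+1)%:R + m%:R)).
    by rewrite -natrD ler_nat; exact: ndistinct_le.
  by rewrite lerD2r; apply: hn0; exact: leqW.
have lo j : exists N : set VT, [/\ measurable N, pr nu N = 0 & forall y, ~ N y ->
    exists n0, forall n, (n0 <= n)%N -> n%:R - (1 - c + j.+1%:R^-1) * n.+1%:R <= (ndistinct (lab y) n)%:R].
  have hm : pr nu [set y : VT | comeback (lab y)] < 1 - c + j.+1%:R^-1.
    by rewrite cG; move: (dpos j); move: (j.+1%:R^-1) => dl; lra.
  have [N [mN N0 hN]] := ergodic_upper HL comeback_shift measurable_comeback hm.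
  exists N; split => // y /hN[n0 hn0]; exists n0 => n n0n.
  have h1 : n%:R <= (ndistinct (lab y) n)%:R + (hits (fun k => Fat comeback k y) n.+1)%:R :> R.
    by rewrite -natrD ler_nat; exact: ndistinct_ge.
  by have := hn0 n.+1 (leqW n0n); move: (j.+1%:R^-1) => dl; lra.
have [Nu hNu] := choice up; have [Nl hNl] := choice lo.
exists ((\bigcup_j Nu j) `|` (\bigcup_j Nl j)).
have mNu : measurable (\bigcup_j Nu j) by apply: bigcupT_measurable => j; have [] := hNu j.
have mNl : measurable (\bigcup_j Nl j) by apply: bigcupT_measurable => j; have [] := hNl j.
split; first exact: measurableU.
  have Nu0 : pr nu (\bigcup_j Nu j) = 0 by apply: pr_null_bigcup => j; have [] := hNu j.
  have Nl0 : pr nu (\bigcup_j Nl j) = 0 by apply: pr_null_bigcup => j; have [] := hNl j.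
  have := @pr_leD _ _ _ nu _ _ _ (measurableU _ _ mNu mNl) mNu mNl (fun y h => h).
  by rewrite Nu0 Nl0 addr0 => h; apply/eqP; rewrite eq_le h pr_ge0.
move=> y ny; apply/cvgrPdist_le => x x0.
have [j hj] : exists j, j.+1%:R^-1 < x / 2.
  exists (Num.truncn (x / 2)^-1); rewrite -[ltRHS]invrK ltf_pV2 ?posrE ?invr_gt0 ?ltr0n ?divr_gt0//.
  exact: truncnS_gt.
have [_ _ /(_ y)] := hNu j; case=> [h|m [n1 hn1]]; first by apply: ny; left; exists j.
have [_ _ /(_ y)] := hNl j; case=> [h|n2 hn2]; first by apply: ny; right; exists j.
have [n3 hn3] : exists n3 : nat, (2 / x) * (m%:R + 2 + `|c|) < n3%:R.
  exists (Num.truncn ((2 / x) * (m%:R + 2 + `|c|))).+1; exact: truncnS_gt.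
exists (maxn 1 (maxn n1 (maxn n2 n3))) => // n; rewrite /= !geq_max => /and4P[n0 nn1 nn2 nn3].
have np : 0 < n%:R :> R by rewrite ltr0n.
have c1 : 0 <= c <= 1 by rewrite pr_ge0 pr_le1//; exact: measurable_no_return.
have d1 : j.+1%:R^-1 <= 1 :> R by rewrite invf_le1 ?ltr0n// ler1n.
have := dpos j; have := hn1 n nn1; have := hn2 n nn2.
have n3n : (2 / x) * (m%:R + 2 + `|c|) < n%:R by apply: (lt_le_trans hn3); rewrite ler_nat.
have key : m%:R + 2 + `|c| < x / 2 * n%:R.
  have -> : m%:R + 2 + `|c| = x / 2 * ((2 / x) * (m%:R + 2 + `|c|)) by field; apply: lt0r_neq0.
  by rewrite ltr_pM2l// divr_gt0.
move: (dpos j) hj d1; move: (j.+1%:R^-1) => dl d0 hj d1.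
move: c1 => /andP[c0 c1]; move: key; rewrite ger0_norm// => key.
rewrite -natr1 => g2 g1 _.
have dn : dl * n%:R < x / 2 * n%:R by rewrite ltr_pM2r.
have m0 : 0 <= m%:R :> R by [].
rewrite distrC ler_norml; apply/andP; split.
  rewrite lerBrDr; rewrite ler_pdivlMr//; lra.
rewrite lerBlDr ler_pdivrMr//; lra.
Qed.

End Range.

(** * Returning to the origin *)

(* [x] lies below the [k]-th ancestor of the origin, but not below the [k-1]-th one;
   a critical branching walk started from such an [x] hits the origin with
   probability at most [b^-k]. *)
Definition St (k : nat) (x : W) (y : V) := exists a : nat,
  [/\ x.1 = a%:Z - k%:Z, (forall j, x.2 (a + j)%N = y (PU (k + j)%N)) &
      ((0 < a)%N -> (0 < k)%N -> x.2 a.-1 <> y (PU k.-1))].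

Lemma St_org k y : St k (org y) y -> k = 0%N.
Proof.
move=> [a [/= h1 h2 h3]]; have ak : a = k by apply/eqP; rewrite -eqz_nat -subr_eq0 -h1.
subst a; case: k h1 h2 h3 => // k _ _ h3; by case: h3.
Qed.

(** The class [k] of a label can change only at the [k]-th ancestor of the origin itself: to [k.+1]
    by going up, to [k.-1] by the one child leading back to the origin. This lemma and the next ones
    list the cases. *)
Lemma St_step_strict k x y s : St k x y -> x.1 != - k%:Z -> St k (stepW s x) y.
Proof.
move=> [[|a] [h1 h2 h3]] xk; first by rewrite h1 sub0r eqxx in xk.
case: s => [|s] /=.
  exists a; split => /=; first by rewrite h1 -addn1 PoszD; ring.
    by move=> j; rewrite -addSn h2.
  by move=> a0 k0; rewrite (ltn_predK a0); apply: h3.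
exists a.+2; split => /=; first by rewrite h1 -(addn1 a.+1) PoszD; ring.
  by move=> j; rewrite h2.
by move=> _ k0; exact: h3.
Qed.

Lemma St_flat k x y : St k x y -> x.1 = - k%:Z -> forall j, x.2 j = y (PU (k + j)%N).
Proof.
move=> [a [h1 h2 _]] xk j; have a0 : a = 0%N.
  by apply/eqP; rewrite -eqz_nat; apply/eqP; move: h1; rewrite xk => h; lia.
by have := h2 j; rewrite a0.
Qed.

Lemma St_step_up k x y : St k x y -> x.1 = - k%:Z -> St k.+1 (stepW 0 x) y.
Proof.
move=> hs xk; have h := St_flat hs xk; exists 0%N; split => //=.
  by rewrite xk -(addn1 k) PoszD; ring.
by move=> j; rewrite h addnS.
Qed.

Lemma St_step_other k x y s : St k x y -> x.1 = - k%:Z -> s != 0%N ->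
  s <> y (PU k.-1) -> St k (stepW s x) y.
Proof.
case: s => // s hs xk _ ne; have h := St_flat hs xk; exists 1%N; split => //=.
  by rewrite xk; ring.
Qed.

Lemma St_step_back k x y : (0 < y (PU k))%N -> St k.+1 x y -> x.1 = - k.+1%:Z ->
  St k (stepW (y (PU k)) x) y.
Proof.
move=> y0 hs xk; have h := St_flat hs xk; exists 0%N; split => //=.
  by case: (y (PU k)) y0 => // s _ /=; rewrite xk -(addn1 k) PoszD; ring.
case E : (y (PU k)) y0 => [//|s] _ [|j] /=; first by rewrite addn0 E.
by rewrite h addSnnS.
Qed.

Definition Ugood : set VT := [set y : VT | forall j, (0 < y (PU j))%N].

Lemma measurable_Ugood : measurable Ugood.
Proof. by apply: meas_forall => j; exact: (meas_coord (PU j) (fun a => (0 < a)%N)). Qed.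

Lemma insens_Ugood j : ~~ isPU j -> insens j Ugood.
Proof.
move=> jU y s; split => h i; have := h i; rewrite upd_neq//; by apply: contraNneq jU => <-.
Qed.

Lemma eq_walk_prefix (xi xi' : seq nat -> nat) pre x w :
  (forall k, (0 < k <= size w)%N -> xi (pre ++ take k w) = xi' (pre ++ take k w)) ->
  walk xi pre x w = walk xi' pre x w.
Proof.
elim: w pre x => [//|i w IH] pre x h /=.
have := h 1%N isT; rewrite /= take0 cats1 => ->; apply: IH => k /andP[k0 kw].
by rewrite cat_rcons; exact: (h k.+1).
Qed.

(** The label that [(p, w)] would carry, whether or not it is a vertex of the tree. *)
Definition Lb (p : nat) (w : seq nat) (y : V) : W :=
  walk (fun u => y (PX p u)) [::] (ancV y p) w.

Lemma Lb_rcons p w i y : Lb p (rcons w i) y = stepW (y (PX p (rcons w i))) (Lb p w y).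
Proof. exact: walk_rcons. Qed.

Lemma wmeas_Lb p w : wmeas (fun y => Lb p w y).
Proof. exact: wmeas_walk (wmeas_anc p). Qed.

Fixpoint hitv (n p : nat) (w : seq nat) (y : V) : Prop :=
  Lb p w y = org y \/
  (if n is n'.+1 then exists i, (i < y (PN p w))%N /\ hitv n' p (rcons w i) y else False).

Lemma hitv_succ n p w y : hitv n p w y -> hitv n.+1 p w y.
Proof.
elim: n w => [|n IH] w; first by case=> // h; left.
by case=> [h|[i [ik h]]]; [left|right; exists i; split => //; exact: IH].
Qed.

Lemma measurable_hitv n p w : measurable [set y : VT | hitv n p w y].
Proof.
have mo w' : measurable [set y : VT | Lb p w' y = org y].
  have -> : [set y : VT | Lb p w' y = org y] =
      [set y : VT | (Lb p w' y).1 = 0 /\ forall j, (Lb p w' y).2 j = y (PU j)].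
    apply/seteqP; split => y /=; first by move=> ->.
    by move=> [h1 h2]; rewrite [LHS]surjective_pairing h1; congr pair; apply/funext.
  apply: meas_and; first exact: (wmeas_Lb p w').1.
  by apply: meas_forall => j; apply: dmeas_eq; [exact: (wmeas_Lb p w').2|exact: dmeas_coord].
elim: n w => [|n IH] w /=; first by apply: meas_or; [exact: mo|exact: meas_const].
apply: meas_or; first exact: mo.
apply: meas_exists => i; apply: meas_and; last exact: IH.
exact: (meas_coord (PN p w) (fun a => (i < a)%N)).
Qed.

Lemma anc_local p (y y' : V) : (forall j, y (PU j) = y' (PU j)) ->
  (forall q, (0 < q <= p)%N -> y (spine q) = y' (spine q)) -> ancV y p = ancV y' p.
Proof.
move=> hU; elim: p => [|p IH] h.
  by rewrite /= /origin; congr pair; apply/funext => j; exact: hU.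
rewrite /= /pcoord -/(spine p.+1) h ?leqnn//; congr stepW.
by apply: IH => q /andP[q0 qp]; apply: h; rewrite q0 leqW.
Qed.

Lemma Lb_local p w (y y' : V) : (forall j, y (PU j) = y' (PU j)) ->
  (forall q, (0 < q <= p)%N -> y (spine q) = y' (spine q)) ->
  (forall k, (0 < k <= size w)%N -> y (PX p (take k w)) = y' (PX p (take k w))) ->
  Lb p w y = Lb p w y'.
Proof.
by move=> hU hs hw; rewrite /Lb (anc_local hU hs); apply: eq_walk_prefix.
Qed.

(* The coordinates which decide the walk strictly below the vertex [(p, w)]. *)
Definition Fut (p : nat) (w : seq nat) (j : prim) :=
  (exists u, j = PN p (w ++ u)) \/ (exists i u, j = PX p (w ++ i :: u)).

Lemma Lb_insens p w j s y : ~~ isPU j -> (forall q, (0 < q <= p)%N -> j != spine q) ->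
  (forall k, (0 < k <= size w)%N -> j != PX p (take k w)) ->
  Lb p w (upd y j s) = Lb p w y.
Proof.
move=> jU js jw; apply: Lb_local => [i|q hq|k hk]; rewrite upd_neq// eq_sym; [|exact: js|exact: jw].
by apply: contraNneq jU => ->.
Qed.

Lemma Lb_Fut p w j s y : Fut p w j -> Lb p w (upd y j s) = Lb p w y.
Proof.
move=> hj; apply: Lb_insens.
- by move: hj => [[u ->]|[i [u ->]]].
- move=> q _; move: hj => [[u ->]|[i [u ->]]]; apply/eqP => -[] // _ /(congr1 size).
  by rewrite size_cat /= addnS.
- move=> k /andP[k0 kw]; move: hj => [[u ->]|[i [u ->]]]; apply/eqP => -[] // /(congr1 size).
  by rewrite size_cat /= size_take; case: ltnP; lia.
Qed.

Lemma hitv_PN n p w v y s : (forall u, v <> w ++ u) ->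
  hitv n p w (upd y (PN p v) s) <-> hitv n p w y.
Proof.
have oE : org (upd y (PN p v) s) = org y by rewrite /origin; congr pair.
have LE w' : Lb p w' (upd y (PN p v) s) = Lb p w' y by apply: Lb_insens.
elim: n w => [|n IH] w hv /=; rewrite LE oE//.
have -> : upd y (PN p v) s (PN p w) = y (PN p w).
  by rewrite upd_neq//; apply/eqP => -[] e; apply: (hv [::]); rewrite cats0.
split=> -[h|[i [ik h]]]; [by left|right|by left|right]; exists i; split => //;
  apply/IH; rewrite // => u e; apply: (hv (i :: u)); by rewrite e cat_rcons.
Qed.

Lemma hitv_path n p w u y : (size u <= n)%N -> inGW (fun v => y (PN p v)) w u ->
  Lb p (w ++ u) y = org y -> hitv n p w y.
Proof.
elim: n w u => [|n IH] w [|i u] //=; rewrite ?cats0; try by left.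
rewrite ltnS => su /andP[ik hu] e; right; exists i; split => //.
by apply: (IH _ u) => //; rewrite cat_rcons.
Qed.

(** * Probability of hitting the origin from a distant label *)

Section ReturnBounds.
Context {R : realType}.
Variables (b : nat) (mu mubar : nat -> R) (nu : probability VT R).
Hypothesis HL : brw_law b mu mubar nu.
Let m := marg b mu mubar.
Let law : forall (l : seq prim) v, uniq l ->
  nu (cyl l v) = (\prod_(i <- l) m i (v i))%:E := bl_law HL.
Let m_ge0 := marg_ge0 HL.
Let beta : R := b%:R^-1.
Let b0 : 0 < b%:R :> R. Proof. by rewrite ltr0n (b_gt0 HL). Qed.
Let beta0 : 0 < beta. Proof. by rewrite invr_gt0. Qed.
Let beta1 : beta <= 1. Proof. by rewrite invf_le1// ler1n (b_gt0 HL). Qed.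

Definition wmeas_insens (X : VT -> W) i := forall y k, X (upd y i k) = X y.

(** [C] may depend on the digit, so the step is resampled: whatever the digit, a given positive step
    has probability at most [1 / (2b)]. *)
Lemma pr_PX_match (C : set VT) i k : isPX i -> measurable C -> insens i C -> C `<=` Ugood ->
  pr nu (C `&` [set y | y i = y (PU k)]) <= beta / 2 * pr nu C.
Proof.
move=> iX mC fC CU.
have mU : measurable [set y : VT | y i = y (PU k)] by apply: dmeas_eq; exact: dmeas_coord.
have mA := measurableI _ _ mC mU.
have iU : PU k != i by case: i iX {fC mU mA}.
apply: (@resample_le _ nu m m_ge0 law _ i _ 0 mA) => n _.
have E s : [set y | (C `&` [set y | y i = y (PU k)]) (upd y i s)] = C `&` [set y : VT | y (PU k) = s].
  by apply/seteqP; split => y /= [/fC Cy]; rewrite upd_eq upd_neq// => h; split => //; apply/fC.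
apply: (@le_trans _ _ (\sum_(0 <= s < n) beta / 2 * pr nu (C `&` [set y : VT | y (PU k) = s]))).
  apply: ler_sum => s _; rewrite E; case: s => [|s].
    rewrite (_ : C `&` _ = set0) ?/pr ?measure0 ?mulr0//.
    by apply/seteqP; split => // y [/CU /(_ k) + h]; rewrite h.
  apply: ler_wpM2r; first exact: pr_ge0.
  case: i iX {fC mU mA E iU} => // p w _; rewrite /m /=; case: ifP => _.
    by rewrite /beta invfM mulrC.
  by rewrite divr_ge0// ltW.
rewrite -mulr_sumr; apply: ler_wpM2l; first by rewrite divr_ge0// ltW.
apply: (@pr_sum_disj_le _ _ _ nu C (fun s => C `&` [set y : VT | y (PU k) = s])) => //.
- by move=> s; apply: measurableI => //; exact: dmeas_coord.
- by move=> s y [].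
- by move=> s s' y [_ <-] [_ <-].
Qed.

(** For [k > 0] the weight [beta ^+ k] is harmonic: [beta ^+ k.+1 / 2 + beta ^+ k.-1 * beta / 2 +
    beta ^+ k * (1 - beta) / 2 = beta ^+ k]. The event [G] and the later coordinates [Fu] are
    abstract, so that the same step serves along the ancestral line and inside a subtree. *)
Lemma St_step_bound (X : VT -> W) i (Fu : prim -> Prop) (G : set VT) :
  isPX i -> wmeas X -> wmeas_insens X i -> measurable G ->
  ~ Fu i -> (forall j, ~ Fu (PU j)) -> (forall j, Fu j -> wmeas_insens X j) ->
  (forall k (C : set VT), measurable C -> C `<=` Ugood -> (forall j, Fu j -> insens j C) ->
     (forall y, C y -> St k (stepW (y i) (X y)) y) -> pr nu (C `&` G) <= beta ^+ k * pr nu C) ->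
  forall k (C : set VT), measurable C -> C `<=` Ugood ->
     (forall j, Fu j -> insens j C) -> insens i C ->
     (forall y, C y -> St k (X y) y) -> pr nu (C `&` G) <= beta ^+ k * pr nu C.
Proof.
move=> iX mX fX mG Fi FU FX IH [|k] C mC CU CFu fC CS.
  by rewrite expr0 mul1r; apply: pr_mono; [exact: measurableI|exact: mC|move=> y []].
pose flat : set VT := [set y : VT | (X y).1 = - k.+1%:Z].
have mflat : measurable flat by exact: mX.1.
pose C0 := C `&` flat; pose C1 := C `&` ~` flat.
have mC0 : measurable C0 by exact: measurableI.
have mC1 : measurable C1 by apply: measurableI => //; exact: measurableC.
have fflat j : wmeas_insens X j -> insens j flat by move=> h y s; rewrite /flat /= h.
have fC0 : insens i C0 by apply: insens_setI => //; exact: fflat.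
have C0U : C0 `<=` Ugood by move=> y [/CU].
pose Z := C0 `&` [set y : VT | y i = 0%N].
pose B := C0 `&` [set y : VT | y i = y (PU k)].
pose O := C0 `&` [set y : VT | y i <> 0%N /\ y i <> y (PU k)].
have mi0 : measurable [set y : VT | y i = 0%N] := @dmeas_coord i 0%N.
have miU : measurable [set y : VT | y i = y (PU k)] by apply: dmeas_eq; exact: dmeas_coord.
have mZ : measurable Z by exact: measurableI.
have mB : measurable B by exact: measurableI.
have mO : measurable O.
  by apply: measurableI => //; apply: meas_and; exact: meas_not.
have iFu j : Fu j -> j != i by move=> hj; apply/eqP => e; apply: Fi; rewrite -e.
have UFu j : Fu j -> j != PU k by move=> hj; apply/eqP => e; apply: (FU k); rewrite -e.
have fu1 j : Fu j -> insens j C1.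
  by move=> hj; apply: insens_setI; [exact: CFu|apply: insens_setC; apply: fflat; exact: FX].
have fu0 j : Fu j -> insens j C0.
  by move=> hj; apply: insens_setI; [exact: CFu|apply: fflat; exact: FX].
have h1 : pr nu (C1 `&` G) <= beta ^+ k.+1 * pr nu C1.
  apply: IH => //; first by move=> y [/CU].
  by move=> y [Cy ny]; apply: St_step_strict; [exact: CS|exact/eqP].
have hZ : pr nu (Z `&` G) <= beta ^+ k.+2 * pr nu Z.
  apply: IH => //; first by move=> y [/C0U].
    move=> j hj; apply: insens_setI; first exact: fu0.
    by move=> y s /=; rewrite upd_neq// eq_sym iFu.
  by move=> y [[Cy fy] /= ->]; apply: St_step_up; [exact: CS|].
have hB : pr nu (B `&` G) <= beta ^+ k * pr nu B.
  apply: IH => //; first by move=> y [/C0U].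
    move=> j hj; apply: insens_setI; first exact: fu0.
    by move=> y s /=; rewrite !upd_neq// eq_sym ?iFu ?UFu.
  by move=> y [[Cy fy] /= ->]; apply: St_step_back => //; [exact: CU|exact: CS].
have hO : pr nu (O `&` G) <= beta ^+ k.+1 * pr nu O.
  apply: IH => //; first by move=> y [/C0U].
    move=> j hj; apply: insens_setI; first exact: fu0.
    by move=> y s /=; rewrite !upd_neq// eq_sym ?iFu ?UFu.
  by move=> y [[Cy fy] /= [/eqP n0 ne]]; apply: St_step_other => //; exact: CS.
have pZ : pr nu Z = 2^-1 * pr nu C0.
  rewrite /Z (indep_coord_eq m_ge0 law)// mulrC; congr (_ * _).
  by case: (i) iX.
have pB : pr nu B <= beta / 2 * pr nu C0 by exact: pr_PX_match.
have pO : pr nu C0 = pr nu Z + pr nu B + pr nu O.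
  rewrite (pr_split nu mC0 mi0) -addrA; congr (_ + _).
  have mN : measurable (C0 `&` ~` [set y : VT | y i = 0%N]).
    by apply: measurableI => //; exact: measurableC.
  rewrite (pr_split nu mN miU); congr (_ + _); congr pr; apply/seteqP; split => y /=.
  - by move=> [[? ?] ?].
  - move=> [Cy e]; split; last by [].
    by split; [exact: Cy|rewrite e => h; have := C0U y Cy k; rewrite h].
  - by move=> [[? ?] ?].
  - by move=> [? [? ?]].
have pC : pr nu C = pr nu C0 + pr nu C1 by exact: pr_split.
have le : pr nu (C `&` G) <= pr nu (C1 `&` G) + (pr nu (Z `&` G) + (pr nu (B `&` G) + pr nu (O `&` G))).
  have mI A : measurable A -> measurable (A `&` G) by move=> mA; exact: measurableI.
  apply: (@le_trans _ _ (pr nu (C1 `&` G) + pr nu (C0 `&` G))).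
    apply: pr_leD; try exact: mI.
    by move=> y [Cy Gy]; case: (pselect (flat y)) => fy; [right|left].
  rewrite lerD2l.
  apply: (@le_trans _ _ (pr nu (Z `&` G) + pr nu ((B `|` O) `&` G))).
    apply: pr_leD; try exact: mI; first by apply: mI; exact: measurableU.
    move=> y [Cy Gy]; case: (pselect (y i = 0%N)) => i0; first by left.
    by right; split => //; case: (pselect (y i = y (PU k))) => iu; [left|right].
  rewrite lerD2l; apply: pr_leD; try exact: mI; first by apply: mI; exact: measurableU.
  by move=> y [[hBy|hOy] Gy]; [left|right].
apply: (le_trans le); rewrite pC.
have bk : 0 <= beta ^+ k by rewrite exprn_ge0// ltW.
move: hZ hB hO h1; rewrite !exprS.
have bb : 0 <= beta ^+ k * (1 - beta) by rewrite mulr_ge0// subr_ge0.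
(* Only an upper bound on the mass of [B] is known; it suffices, because moving mass from [O] to [B]
   raises its weight from [beta ^+ k.+1] to [beta ^+ k]. *)
have t1 : beta ^+ k * (1 - beta) * pr nu B <= beta ^+ k * (1 - beta) * (beta / 2 * pr nu C0).
  by apply: ler_wpM2l.
have OE : pr nu O = pr nu C0 - pr nu Z - pr nu B by rewrite pO; ring.
rewrite OE pZ; move: t1 bk.
move: (beta ^+ k) (pr nu C0) (pr nu B) (pr nu C1) => t P0 PB P1 t1 tk g1 g2 g3 g4.
lra.
Qed.

Lemma pr_finite_le (C : set VT) (E : nat -> set VT) n (c : R) : measurable C ->
  (forall i, measurable (E i)) -> (forall i, (i < n)%N -> pr nu (C `&` E i) <= c) ->
  pr nu (C `&` [set y | exists i, (i < n)%N /\ E i y]) <= n%:R * c.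
Proof.
move=> mC mE; elim: n => [|n IH] h.
  rewrite mul0r (_ : C `&` _ = set0) ?/pr ?measure0//.
  by apply/seteqP; split => // y [_ [i []]].
have mU k : measurable [set y : VT | exists i, (i < k)%N /\ E i y].
  by apply: meas_exists => i; apply: meas_and; [exact: meas_const|exact: mE].
apply: (@le_trans _ _ (pr nu (C `&` [set y | exists i, (i < n)%N /\ E i y]) + pr nu (C `&` E n))).
  apply: pr_leD; try by apply: measurableI.
  move=> y [Cy [i [+ Ei]]]; rewrite ltnS leq_eqVlt => /orP[/eqP e|ilt].
    by right; split => //; rewrite -e.
  by left; split => //; exists i.
rewrite -natr1 mulrDl mul1r; apply: lerD; last exact: h.
by apply: IH => i ilt; apply: h; exact: ltnW.
Qed.

(** A union bound over the children, each treated by [St_step_bound]; it costs the mean number of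
    children, which is 1. *)
Lemma hit_bound n p w k (C : set VT) : measurable C -> C `<=` Ugood ->
  (forall j, Fut p w j -> insens j C) -> (forall y, C y -> St k (Lb p w y) y) ->
  pr nu (C `&` [set y | hitv n p w y]) <= beta ^+ k * pr nu C.
Proof.
elim: n p w k C => [|n IH] p w [|k] C mC CU fC CS;
  try by rewrite expr0 mul1r; apply: pr_mono;
    [apply: measurableI => //; exact: measurable_hitv|exact: mC|move=> y []].
  rewrite (_ : C `&` _ = set0).
    by rewrite {1}/pr measure0 mulr_ge0 ?exprn_ge0 ?pr_ge0// ltW.
  by apply/seteqP; split => // y [/CS + [e|//]]; rewrite e => /St_org.
have mh := measurable_hitv.
have mCh : measurable (C `&` [set y | hitv n.+1 p w y]) by apply: measurableI => //; exact: mh.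
have fN : insens (PN p w) C by apply: fC; left; exists [::]; rewrite cats0.
apply: (@resample_le _ nu m m_ge0 law _ (PN p w) _ 0 mCh) => K _.
have hs s : pr nu [set y | (C `&` [set y | hitv n.+1 p w y]) (upd y (PN p w) s)] <=
    s%:R * (beta ^+ k.+1 * pr nu C).
  have -> : [set y | (C `&` [set y | hitv n.+1 p w y]) (upd y (PN p w) s)] =
      C `&` [set y | exists i, (i < s)%N /\ [set y : VT | hitv n p (rcons w i) y] y].
    have hN i y : hitv n p (rcons w i) (upd y (PN p w) s) <-> hitv n p (rcons w i) y.
      apply: hitv_PN => u /(congr1 size); rewrite size_cat size_rcons; lia.
    apply/seteqP; split => y /=.
      move=> [/[dup] Cu /fN Cy]; case=> [e|[i []]].
        by have := CS _ Cu; rewrite e => /St_org.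
      by rewrite upd_eq => ik /hN h; split => //; exists i.
    move=> [Cy [i [ik h]]]; split; first exact/fN.
    by right; exists i; rewrite upd_eq; split => //; exact/hN.
  apply: pr_finite_le => // i _.
  apply: (@St_step_bound (fun y => Lb p w y) (PX p (rcons w i)) (Fut p (rcons w i))) => //.
  - exact: wmeas_Lb.
  - by move=> y t; apply: Lb_Fut; right; exists i, [::]; rewrite cats1.
  - move=> [[u []//]|[j [u [] /(congr1 size)]]].
    by rewrite size_cat /= addnS; lia.
  - by move=> j [[u []//]|[? [u []//]]].
  - move=> j hj y t; apply: Lb_Fut; move: hj => [[u ->]|[i' [u ->]]]; rewrite cat_rcons.
      by left; exists (i :: u).
    by right; exists i, (i' :: u).
  - move=> k' C' mC' C'U fC' C'S; apply: IH => // y Cy; rewrite Lb_rcons; exact: C'S.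
  - move=> j hj; apply: fC; move: hj => [[u ->]|[i' [u ->]]]; rewrite cat_rcons.
      by left; exists (i :: u).
    by right; exists i, (i' :: u).
  - by apply: fC; right; exists i, [::]; rewrite cats1.
apply: (@le_trans _ _ (\sum_(0 <= s < K) (s%:R * mu s) * (beta ^+ k.+1 * pr nu C))).
  apply: ler_sum => s _; rewrite -[m (PN p w) s]/(mu s) mulrAC -mulrA mulrC -mulrA.
  rewrite [X in _ <= X]mulrC -mulrA [X in _ <= X]mulrC -mulrA.
  rewrite mulrC; apply: le_trans (ler_wpM2l (bl_mu_ge0 HL s) (hs s)) _.
  by rewrite le_eqVlt; apply/orP; left; apply/eqP; ring.
rewrite -mulr_suml ler_piMl ?(mu_mean_le HL)// mulr_ge0 ?exprn_ge0 ?pr_ge0// ltW//.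
Qed.

Definition futspine (r : nat) (j : prim) := exists q, (r < q)%N /\ j = spine q.

Lemma anc_insens r j s y : ~~ isPU j -> (forall q, (0 < q <= r)%N -> j != spine q) ->
  ancV (upd y j s) r = ancV y r.
Proof.
move=> jU js; apply: anc_local => [i|q hq]; rewrite upd_neq// eq_sym; last exact: js.
by apply: contraNneq jU => ->.
Qed.

Definition Fut1 p i j := Fut p [:: i] j \/ j = PX p [:: i].

Lemma Fut1_nonspine p i j q : Fut1 p i j -> j != spine q.
Proof.
by move=> [[[u ->]|[a [u ->]]]|->]; apply/eqP.
Qed.

Lemma Fut1_nonU p i j : Fut1 p i j -> ~~ isPU j.
Proof. by move=> [[[u ->]|[a [u ->]]]|->]. Qed.

Lemma spine_hit_bound n p i d r k (C : set VT) : (r + d)%N = p -> measurable C -> C `<=` Ugood ->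
  (forall j, Fut1 p i j -> insens j C) -> (forall j, futspine r j -> insens j C) ->
  (forall y, C y -> St k (ancV y r) y) ->
  pr nu (C `&` [set y | hitv n p [:: i] y]) <= beta ^+ k * pr nu C.
Proof.
elim: d r k C => [|d IH] r k C rp mC CU f1 f2 CS.
  rewrite addn0 in rp; subst r.
  apply: (@St_step_bound (fun y => ancV y p) (PX p [:: i]) (Fut p [:: i])) => //.
  - exact: wmeas_anc.
  - by move=> y t; apply: anc_insens => // q _; exact: spine_neq.
  - exact: measurable_hitv.
  - move=> [[u []//]|[j [u [] /(congr1 size)]]] //.
  - by move=> j [[u []//]|[? [u []//]]].
  - move=> j hj y t; have h1 : Fut1 p i j by left.
    by apply: anc_insens; [exact: (Fut1_nonU h1)|move=> q _; exact: (Fut1_nonspine _ h1)].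
  - by move=> k' C' mC' C'U fC' C'S; apply: hit_bound.
  - by move=> j hj; apply: f1; left.
  - by apply: f1; right.
apply: (@St_step_bound (fun y => ancV y r) (spine r.+1)
   (fun j => Fut1 p i j \/ futspine r.+1 j)) => //.
- exact: wmeas_anc.
- by move=> y t; apply: anc_insens => // q hq; rewrite spine_inj; apply/eqP; lia.
- exact: measurable_hitv.
- by move=> [/(@Fut1_nonspine _ _ _ r.+1)|[q [rq []]]]; [rewrite eqxx|lia].
- by move=> j [/Fut1_nonU|[q [_]]].
- move=> j hj y t; apply: anc_insens.
    by move: hj => [/Fut1_nonU|[q [_ ->]]].
  move=> q hq; move: hj => [hj|[q' [rq' ->]]]; first exact: Fut1_nonspine hj.
  by rewrite spine_inj; apply/eqP; lia.
- move=> k' C' mC' C'U fC' C'S; apply: (IH r.+1) => //.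
  + by rewrite addSnnS.
  + by move=> j hj; apply: fC'; left.
  + by move=> j hj; apply: fC'; right.
- move=> j [hj|[q [rq ->]]]; [exact: f1|apply: f2].
  by exists q; split => //; exact: ltnW.
- by apply: f2; exists r.+1.
Qed.

(* [x] sits [l] levels below the [lv]-th ancestor of the origin. *)
Definition Above (lv l : nat) (x : W) (y : V) :=
  x.1 = l%:Z - lv%:Z /\ forall j, x.2 (l + j)%N = y (PU (lv + j)%N).

(** The ancestral line is followed until it first reaches the [lv]-th ancestor of the origin, that
    is [l = 0]. There the label has class [lv], and [spine_hit_bound] treats the rest of the
    path. *)
Lemma far_hit_bound lv n p i d r l (C : set VT) : (r + d)%N = p -> measurable C -> C `<=` Ugood ->
  (forall j, Fut1 p i j -> insens j C) -> (forall j, futspine r j -> insens j C) ->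
  (forall y, C y -> Above lv l (ancV y r) y) ->
  pr nu (C `&` [set y | ~~ nohit true spine r d l y /\ hitv n p [:: i] y]) <= beta ^+ lv * pr nu C.
Proof.
have mh : measurable [set y : VT | hitv n p [:: i] y] by exact: measurable_hitv.
have mno a c e : measurable [set y : VT | ~~ nohit true spine a c e y /\ hitv n p [:: i] y].
  apply: meas_and => //.
  rewrite (_ : [set _ | _] = ~` [set y : VT | nohit true spine a c e y]).
    by apply: measurableC; exact: measurable_nohit.
  by apply/seteqP; split => y /= /negP.
elim: d r l C => [|d IH] r l C rp mC CU f1 f2 CA.
  case: l CA => [|l] CA; last first.
    rewrite (_ : C `&` _ = set0); last by apply/seteqP; split => // y [_ []].
    by rewrite {1}/pr measure0 mulr_ge0 ?exprn_ge0 ?pr_ge0// ltW.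
  apply: le_trans (@spine_hit_bound n p i 0 r lv C rp mC CU f1 f2 _).
    by apply: pr_mono; [exact: measurableI|exact: measurableI|move=> y [? []]].
  by move=> y /CA[h1 h2]; exists 0%N; split => //; rewrite h1.
case: l CA => [|l] CA.
  apply: le_trans (@spine_hit_bound n p i d.+1 r lv C rp mC CU f1 f2 _).
    by apply: pr_mono; [exact: measurableI|exact: measurableI|move=> y [? []]].
  by move=> y /CA[h1 h2]; exists 0%N; split => //; rewrite h1.
pose Z : set VT := [set y : VT | y (spine r.+1) = 0%N].
have mZ : measurable Z := @dmeas_coord _ _.
have mCZ : measurable (C `&` Z) by exact: measurableI.
have mCZ' : measurable (C `&` ~` Z) by apply: measurableI => //; exact: measurableC.
have fZ j : j != spine r.+1 -> insens j Z by move=> hj y s; rewrite /Z /= upd_neq// eq_sym.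
have rp' : (r.+1 + d)%N = p by rewrite addSnnS.
have fs j : futspine r.+1 j -> futspine r j /\ j != spine r.+1.
  move=> [q [rq ->]]; split; first by exists q; split => //; exact: ltnW.
  by rewrite spine_inj; apply/eqP; lia.
have h0 := IH r.+1 l (C `&` Z) rp' mCZ (fun y h => CU y h.1).
have h1 := IH r.+1 l.+2 (C `&` ~` Z) rp' mCZ' (fun y h => CU y h.1).
rewrite (pr_split nu mC mZ) mulrDr.
apply: le_trans (lerD (h0 _ _ _) (h1 _ _ _)).
- apply: pr_leD; [exact: measurableI|exact: measurableI|exact: measurableI|].
  move=> y [Cy [/= hn hh]]; move: hn; rewrite -/(spine r.+1).
  case: (boolP (y (spine r.+1) == 0%N)) => [/eqP|/eqP] hy /= hn; [left|right].
    by split.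
  by split.
- by move=> j hj; apply: insens_setI; [exact: f1|apply: fZ; exact: Fut1_nonspine hj].
- by move=> j /fs[hj1 hj2]; apply: insens_setI; [exact: f2|exact: fZ].
- move=> y [/CA[a1 a2] yz]; rewrite /= -/(spine r.+1) /pcoord yz /=; split => /=.
    by rewrite a1 -(addn1 l) PoszD; ring.
  by move=> j; rewrite -addSn a2.
- by move=> j hj; apply: insens_setI; [exact: f1|apply: insens_setC; apply: fZ; exact: Fut1_nonspine hj].
- by move=> j /fs[hj1 hj2]; apply: insens_setI; [exact: f2|apply: insens_setC; exact: fZ].
- move=> y [/CA[a1 a2] yz]; rewrite /= -/(spine r.+1) /pcoord.
  case E : (y (spine r.+1)) => [|s] /=; first by case: yz.
  split => /=; first by rewrite a1 -(addn1 l.+1) PoszD; ring.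
  by move=> j; rewrite a2.
Qed.

Lemma Above_org lv y : Above lv lv (org y) y.
Proof. by split => /=; rewrite ?subrr. Qed.

End ReturnBounds.

Lemma nohit_mono up e a n n' lv y : (n <= n')%N ->
  nohit up e a n' lv y -> nohit up e a n lv y.
Proof.
elim: n n' a lv => [|n IH] [|n'] a [|lv] //= nn; exact: IH.
Qed.

(** * Vertices met by the exploration *)

Lemma nextw_rev_inv (th : Theta) p rw w : nextw_rev th p rw = Some w ->
  [/\ isSome (th p w), w != [::] & (0 < head 0%N (rev rw))%N -> (0 < head 0%N w)%N].
Proof.
elim: rw => [//|i ru IH] /=; case: ifP => [h [<-]|_].
  split => //; first by case: (rev ru).
  by rewrite rev_cons; case: (rev ru).
move=> /[dup] e /IH[h1 h2 h3]; split => //; rewrite rev_cons => h; apply: h3; move: h.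
case E : (rev ru) => [|a u] //=.
by move: e; rewrite -(revK ru) E.
Qed.

(** Vertices off the ancestral line, in their canonical code: such a vertex lies below a child of
    the root or in a subtree grafted on an ancestor. *)
Definition visited (th : Theta) (v : nat * seq nat) :=
  [/\ isSome (th v.1 v.2), v.2 != [::] & (0 < v.1)%N -> (0 < head 0%N v.2)%N].

Lemma visited_succ th v : visited th v -> visited th (lex_succ th v).
Proof.
case: v => p w [h1 h2 h3]; rewrite lex_succE; case: ifP => [h|_].
  split => //=; first by case: (w).
  by move=> /h3 /=; case: (w) h2.
case E : (nextw_rev th p (rev w)) => [w'|].
  have [g1 g2 g3] := nextw_rev_inv E; split => //= p0.
  by apply: g3; rewrite revK; exact: h3.
case: (jumpP th p) => [[q [g1 g2 g3]]|hn].
  by rewrite (jump_some _ g1 g2 g3).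
by rewrite (jump_none _ hn).
Qed.

Lemma visited_root y q : qis q y -> visited (B y) (lex_succ (B y) (0%N, [::])).
Proof.
move=> hq; rewrite (lex_succ_root hq); split; [|by []|by case: (q)].
case: q hq => [|q] hq.
  by change (isSome (B y 0 [:: 0%N])); rewrite present0 /=; move: hq => /= ->.
by change (isSome (B y q.+1 [:: 1%N])); rewrite presentS; case/and3P: hq => _ _ ->.
Qed.

Lemma visited_lex y q n : qis q y -> visited (B y) (lex_vertex (B y) n.+1).
Proof.
move=> hq; elim: n => [|n IH]; first exact: visited_root hq.
by rewrite /lex_vertex iterS; apply: visited_succ.
Qed.

Lemma visited_return y v : visited (B y) v -> B y v.1 v.2 = Some (org y) ->
  (exists n i, (i < y (PN 0 [::]))%N /\ hitv n 0 [:: i] y) \/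
  (exists p i n, (i.+1 < y (PK p))%N /\ hitv n p.+1 [:: i.+1] y).
Proof.
case: v => -[|p] [|i w] [h1 h2 h3] e //.
  have {}h1 : isSome (B y 0 (i :: w)) := h1; have {}e : B y 0 (i :: w) = Some (org y) := e.
  left; exists (size w), i; move: h1; rewrite present0 /= => /andP[hi hw]; split => //.
  apply: (@hitv_path _ _ _ w) => //; move: e; rewrite /B /= /pcoord hi hw /= => -[e].
  by rewrite /Lb.
right; case: i h1 h2 h3 e => [|i] h1 h2 h3 e; first by have := h3 isT.
have {}h1 : isSome (B y p.+1 (i.+1 :: w)) := h1.
have {}e : B y p.+1 (i.+1 :: w) = Some (org y) := e.
exists p, i, (size w); move: h1; rewrite presentS => /andP[hi hw]; split => //.
apply: (@hitv_path _ _ _ w) => //; move: e; rewrite /B /= /pcoord hi hw /= => -[e].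
by rewrite /Lb.
Qed.

(** * Returns below the root and in the grafted subtrees *)

Section Positivity.
Context {R : realType}.
Variables (b : nat) (mu mubar : nat -> R) (nu : probability VT R).
Hypothesis HL : brw_law b mu mubar nu.
Let m := marg b mu mubar.
Let law : forall (l : seq prim) v, uniq l ->
  nu (cyl l v) = (\prod_(i <- l) m i (v i))%:E := bl_law HL.
Let m_ge0 := marg_ge0 HL.
Let mu_ge0 := bl_mu_ge0 HL.
Let beta : R := b%:R^-1.
Let b0 : 0 < b%:R :> R. Proof. by rewrite ltr0n (b_gt0 HL). Qed.
Let beta0 : 0 < beta. Proof. by rewrite invr_gt0. Qed.
Let beta_half : beta <= 2^-1.
Proof. by rewrite /beta lef_pV2 ?posrE// ler_nat (bl_b HL). Qed.

Let mUgood := measurable_Ugood.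

Lemma pr_Ugood : pr nu Ugood = 1.
Proof.
have := U_pos_null HL; rewrite (_ : [set y | _] = ~` Ugood).
  by rewrite pr_setC// => h; lra.
apply/seteqP; split => y /=; first by move=> [j h] /(_ j); rewrite h.
move=> h; apply: contrapT => h2; apply: h => j; rewrite lt0n; apply/eqP => e.
by apply: h2; exists j.
Qed.

Definition root_return : set VT :=
  [set y : VT | exists n i, (i < y (PN 0 [::]))%N /\ hitv n 0 [:: i] y].

Let mroot_n n : measurable [set y : VT | exists i, (i < y (PN 0 [::]))%N /\ hitv n 0 [:: i] y].
Proof.
apply: meas_exists => i; apply: meas_and; last exact: measurable_hitv.
exact: (meas_coord (PN 0 [::]) (fun a => (i < a)%N)).
Qed.

Lemma measurable_root_return : measurable root_return.
Proof. by apply: meas_exists => n; exact: mroot_n. Qed.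

(** With probability 1/2 the child moves to the first ancestor of the origin, from where the origin
    is hit with probability at most [beta]; the other case is bounded by its probability 1/2. *)
Let child_hit n i : pr nu (Ugood `&` [set y | hitv n 0 [:: i] y]) <= (1 + beta) / 2.
Proof.
pose Z : set VT := [set y : VT | y (PX 0 [:: i]) = 0%N].
have mZ : measurable Z := @dmeas_coord _ _.
have mh : measurable [set y : VT | hitv n 0 [:: i] y] by exact: measurable_hitv.
have mUZ : measurable (Ugood `&` Z) by exact: measurableI.
have mUZ' : measurable (Ugood `&` ~` Z) by apply: measurableI => //; exact: measurableC.
have pZ : pr nu (Ugood `&` Z) = 2^-1.
  have fi : insens (PX 0 [:: i]) Ugood by exact: insens_Ugood.
  by rewrite (indep_coord_eq m_ge0 law 0%N mUgood fi) pr_Ugood mul1r.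
have pZ' : pr nu (Ugood `&` ~` Z) = 2^-1.
  by have := pr_split nu mUgood mZ; rewrite pZ pr_Ugood; lra.
apply: (@le_trans _ _ (pr nu ((Ugood `&` Z) `&` [set y | hitv n 0 [:: i] y]) + pr nu (Ugood `&` ~` Z))).
  apply: pr_leD => //; [exact: measurableI|exact: measurableI|].
  by move=> y [Uy hy]; case: (pselect (Z y)) => Zy; [left|right].
have := @hit_bound _ _ _ _ _ HL n 0 [:: i] 1 (Ugood `&` Z) mUZ (fun y h => h.1).
rewrite pZ pZ' expr1 -/beta => h.
have : pr nu ((Ugood `&` Z) `&` [set y | hitv n 0 [:: i] y]) <= beta * 2^-1.
  apply: h.
    move=> j hj; apply: insens_setI.
      by apply: insens_Ugood; move: hj => [[u ->]|[? [u ->]]].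
    move=> y s; rewrite /Z /= upd_neq//; move: hj => [[u ->]|[a [u ->]]]; apply/eqP => -[] //.
  move=> y [Uy Zy]; rewrite /Lb /= Zy /=; exists 0%N; split => //=.
lra.
Qed.

Lemma pr_root_return : pr nu (Ugood `&` root_return) <= (1 + beta) / 2.
Proof.
have mUR : measurable (Ugood `&` root_return) by apply: measurableI => //; exact: measurable_root_return.
apply: (@pr_nondecreasing_le _ _ _ nu _
  (fun n => [set y : VT | exists i, (i < y (PN 0 [::]))%N /\ hitv n 0 [:: i] y]) _ mUR mroot_n).
- by move=> y [_ [n h]]; exists n.
- by move=> n y [i [ik h]]; exists i; split => //; exact: hitv_succ.
move=> n; pose A : set VT := [set y : VT | exists i, (i < y (PN 0 [::]))%N /\ hitv n 0 [:: i] y].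
have mA : measurable A by exact: mroot_n.
have mUA : measurable (Ugood `&` A) by exact: measurableI.
apply: (@le_trans _ _ (pr nu (Ugood `&` A))).
  by apply: pr_mono; [exact: measurableI|exact: mUA|move=> y [[? _] ?]].
apply: (@resample_le _ nu m m_ge0 law _ (PN 0 [::]) _ 0 mUA) => K _.
have hs s : pr nu [set y | (Ugood `&` A) (upd y (PN 0 [::]) s)] <= s%:R * ((1 + beta) / 2).
  have -> : [set y | (Ugood `&` A) (upd y (PN 0 [::]) s)] =
     Ugood `&` [set y | exists i, (i < s)%N /\ [set y : VT | hitv n 0 [:: i] y] y].
    have hN i y : hitv n 0 [:: i] (upd y (PN 0 [::]) s) <-> hitv n 0 [:: i] y by exact: hitv_PN.
    have fU := @insens_Ugood (PN 0 [::]) isT.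
    apply/seteqP; split => y /=.
      move=> [/fU Uy [i []]]; rewrite upd_eq => ik /hN h; split => //; by exists i.
    move=> [Uy [i [ik h]]]; split; first exact/fU.
    by exists i; rewrite upd_eq; split => //; exact/hN.
  apply: pr_finite_le; first exact: mUgood.
    by move=> i; exact: measurable_hitv.
  by move=> i _; exact: child_hit.
apply: (@le_trans _ _ (\sum_(0 <= s < K) (s%:R * mu s) * ((1 + beta) / 2))).
  apply: ler_sum => s _; rewrite -[m (PN 0 [::]) s]/(mu s).
  apply: le_trans (ler_wpM2l (mu_ge0 s) (hs s)) _.
  by rewrite [leLHS]mulrCA mulrA.
rewrite -mulr_suml ler_piMl ?(mu_mean_le HL)//.
by apply: divr_ge0 => //; apply: addr_ge0 => //; exact: ltW.
Qed.

Lemma root_return_local (y y' : V) : (forall j, y (PU j) = y' (PU j)) ->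
  (forall w, y (PN 0 w) = y' (PN 0 w)) -> (forall w, y (PX 0 w) = y' (PX 0 w)) ->
  root_return y -> root_return y'.
Proof.
move=> hU hN hX [n [i [ik h]]]; exists n, i; split; first by rewrite -hN.
have oE : org y = org y' by rewrite /origin; congr pair; apply/funext => j; exact: hU.
move: h; move: [:: i] => w; elim: n w => [|n IH] w /=;
  rewrite -oE (@Lb_local 0 w y y') //; try by move=> q /andP[]; case: q.
by case=> [h|[j [jk h]]]; [left|right; exists j; rewrite -hN; split => //; exact: IH].
Qed.

Lemma mubar1_gt0 : 0 < mubar 1.
Proof.
rewrite lt_neqAle (mubar_ge0 HL) andbT eq_sym; apply/eqP => h1.
have hk k : mubar k.+1 = 0.
  elim: k => [//|k IH]; have := mubarE HL k.+1; rewrite IH.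
  by have := mubar_ge0 HL k.+2; have := mu_ge0 k.+1; lra.
have z k : mu k.+1 = 0.
  by have := mubarE HL k.+1; rewrite !hk; lra.
have := bl_mu_mean HL; rewrite eseries0; last by move=> [|k] _ _; rewrite ?mul0r// z mulr0.
by move=> /eqP; rewrite eq_sym onee_eq0.
Qed.

(** Summation by parts: the tail of [mubar] is at most that of the size-biased law [k * mu k], to
    which the moment condition applies. *)
Lemma PK_tail p x : pr nu [set y : VT | (x < y (PK p))%N] <= 1 - \sum_(0 <= k < x.+1) k%:R * mu k.
Proof.
have mle : measurable [set y : VT | (y (PK p) <= x)%N].
  exact: (meas_coord (PK p) (fun a => (a <= x)%N)).
have -> : [set y : VT | (x < y (PK p))%N] = ~` [set y : VT | (y (PK p) <= x)%N].
  by apply/seteqP; split => y /=; [move=> h; apply/negP; rewrite -ltnNge|move/negP; rewrite -ltnNge].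
rewrite pr_setC// lerD2l lerN2.
apply: (@le_trans _ _ (\sum_(0 <= k < x.+1) pr nu [set y : VT | y (PK p) = k /\ (k <= x)%N])).
  have -> : \sum_(0 <= k < x.+1) pr nu [set y : VT | y (PK p) = k /\ (k <= x)%N] =
      \sum_(0 <= k < x.+1) m (PK p) k.
    rewrite [LHS]big_nat_cond [RHS]big_nat_cond; apply: eq_bigr => k /andP[/andP[_ kx] _].
    rewrite -(law_coord law); congr pr; apply/seteqP; split => y /=; first by case.
    by move=> ->; split.
  suff -> : \sum_(0 <= k < x.+1) m (PK p) k =
      \sum_(0 <= k < x.+1) k%:R * mu k + x%:R * mubar x.+1.
    by rewrite lerDl mulr_ge0// (mubar_ge0 HL).
  elim: x {mle} => [|x IH]; first by rewrite !big_nat1 /m /= !mul0r addr0.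
  rewrite big_nat_recr//= IH [in RHS]big_nat_recr//= /m /= (mubarE HL x.+1).
  rewrite -!natr1; ring.
apply: (@pr_sum_disj_le _ _ _ nu [set y : VT | (y (PK p) <= x)%N]
  (fun k => [set y : VT | y (PK p) = k /\ (k <= x)%N])) => //.
- by move=> k; apply: meas_and; [exact: dmeas_coord|exact: meas_const].
- by move=> k y [<-].
- by move=> j k y [<- _] [<- _].
Qed.

(* Covers the returns to the origin in the subtrees grafted on the ancestors of
   generation between [4^k] and [4^(k+1)]. *)
Definition Bad (k j : nat) (y : V) : Prop :=
  nohit true spine 0 (4 ^ k) (2 * j) y \/
  exists p, (p < 4 ^ k.+1)%N /\ ((4 ^ k <= p)%N /\ ((2 ^ j < y (PK p))%N \/
    exists i, (i < 2 ^ j)%N /\ (~~ nohit true spine 0 p.+1 (2 * j) y /\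
      exists n, hitv n p.+1 [:: i.+1] y))).

Let mnohit' n l : measurable [set y : VT | ~~ nohit true spine 0 n l y].
Proof.
rewrite (_ : [set _ | _] = ~` [set y : VT | nohit true spine 0 n l y]).
  by apply: measurableC; exact: measurable_nohit.
by apply/seteqP; split => y /= /negP.
Qed.

Let mPKgt p x : measurable [set y : VT | (x < y (PK p))%N].
Proof. exact: (meas_coord (PK p) (fun a => (x < a)%N)). Qed.

Let mhit p i : measurable [set y : VT | exists n, hitv n p [:: i] y].
Proof. by apply: meas_exists => n; exact: measurable_hitv. Qed.

Lemma measurable_Bad k j : measurable [set y : VT | Bad k j y].
Proof.
apply: meas_or; first exact: measurable_nohit.
apply: meas_exists => p; apply: meas_and; first exact: meas_const.
apply: meas_and; first exact: meas_const.
apply: meas_or; first exact: mPKgt.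
apply: meas_exists => i; apply: meas_and; first exact: meas_const.
by apply: meas_and; [exact: mnohit'|exact: mhit].
Qed.

(** The first term is [nohit_bound] at level [2 * j]. Each of the at most [4 ^ k.+1] ancestors costs
    [kap] for having too many children, plus [2 ^ j] subtrees that hit the origin with probability
    at most [beta ^+ (2 * j) <= 4^-j] each, as [b >= 2]. The level is [2 * j] rather than [j] so
    that this beats the number of subtrees. *)
Lemma Bad_bound k j (kap : R) (Q : set VT) : measurable Q -> Q `<=` Ugood ->
  (forall p, (4 ^ k <= p)%N -> insens (PK p) Q) ->
  (forall q, (0 < q)%N -> insens (spine q) Q) ->
  (forall p i l, Fut1 p.+1 i l -> insens l Q) ->
  (forall p, pr nu [set y : VT | (2 ^ j < y (PK p))%N] <= kap) ->
  pr nu (Q `&` [set y | Bad k j y]) <=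
  (6 * j%:R * 2^-1 ^+ k + (4 ^ k.+1)%:R * (kap + 2^-1 ^+ j)) * pr nu Q.
Proof.
move=> mQ QU fK fs fF hkap.
have Q0 := pr_ge0 nu Q.
have spi : injective spine by move=> p q [].
pose E1 : set VT := [set y : VT | nohit true spine 0 (4 ^ k) (2 * j) y].
have mE1 : measurable E1 by exact: measurable_nohit.
have h1 : pr nu (Q `&` E1) <= 6 * j%:R * 2^-1 ^+ k * pr nu Q.
  rewrite (indep_determined m_ge0 law (L := map spine (iota 1 (4 ^ k))))//.
  - rewrite mulrC; apply: ler_wpM2r => //.
    have := nohit_bound HL (fun k => isT : isPX (spine k)) spi true 0 k (2 * j).
    by rewrite natrM mulrA -natrM.
  - by move=> i /mapP[q]; rewrite mem_iota => /andP[q0 _] ->; exact: fs.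
  - move=> y y' h; rewrite /E1 /= (@nohit_determined spine _ _ _ _ y y')//.
    by move=> q /andP[q0 qk]; apply: h; rewrite map_f// mem_iota; lia.
pose H p i : set VT := [set y : VT | ~~ nohit true spine 0 p.+1 (2 * j) y /\ exists n, hitv n p.+1 [:: i.+1] y].
have mH p i : measurable (H p i) by apply: meas_and; [exact: mnohit'|exact: mhit].
pose Ep p : set VT := [set y : VT | (4 ^ k <= p)%N /\ ((2 ^ j < y (PK p))%N \/
    exists i, (i < 2 ^ j)%N /\ H p i y)].
have mEi p : measurable [set y : VT | exists i, (i < 2 ^ j)%N /\ H p i y].
  by apply: meas_exists => i; apply: meas_and; [exact: meas_const|exact: mH].
have mEp p : measurable (Ep p).
  apply: meas_and; first exact: meas_const.
  by apply: meas_or; [exact: mPKgt|exact: mEi].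
have h2 p : pr nu (Q `&` Ep p) <= (kap + 2^-1 ^+ j) * pr nu Q.
  have kap0 : 0 <= kap by apply: le_trans (hkap 0%N); exact: pr_ge0.
  case: (leqP (4 ^ k) p) => kp; last first.
    rewrite (_ : Q `&` Ep p = set0).
      by rewrite {1}/pr measure0 mulr_ge0// addr_ge0// exprn_ge0// invr_ge0.
    by apply/seteqP; split => // y [_ [+ _]]; rewrite leqNgt kp.
  apply: (@le_trans _ _ (pr nu (Q `&` [set y : VT | (2 ^ j < y (PK p))%N]) +
     pr nu (Q `&` [set y : VT | exists i, (i < 2 ^ j)%N /\ H p i y]))).
    apply: pr_leD; try by apply: measurableI.
    by move=> y [Qy [_ [h|h]]]; [left|right].
  rewrite mulrDl; apply: lerD.
    rewrite (@indep_coord _ nu m m_ge0 law Q (PK p) (fun a => (2 ^ j < a)%N))//; last exact: fK.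
    by rewrite mulrC; apply: ler_wpM2r.
  apply: (@le_trans _ _ ((2 ^ j)%:R * (beta ^+ (2 * j) * pr nu Q))).
    apply: pr_finite_le => // i _.
    have mQH : measurable (Q `&` H p i) by exact: measurableI.
    apply: (@pr_nondecreasing_le _ _ _ nu _ (fun n => [set y : VT | hitv n p.+1 [:: i.+1] y])) => //.
    - by move=> n; exact: measurable_hitv.
    - by move=> y [_ [_ [n h]]]; exists n.
    - by move=> n y; exact: hitv_succ.
    move=> n.
    apply: le_trans (@far_hit_bound _ _ _ _ _ HL (2 * j) n p.+1 i.+1 p.+1 0 (2 * j) Q erefl mQ QU _ _ _).
    - apply: pr_mono.
      + by apply: measurableI => //; exact: measurable_hitv.
      + apply: measurableI => //; apply: meas_and; [exact: mnohit'|exact: measurable_hitv].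
      + by move=> y [[Qy [hn _]] hh].
    - by move=> l; exact: fF.
    - by move=> l [q [q0 ->]]; exact: fs.
    - by move=> y _; exact: Above_org.
  rewrite mulrA; apply: ler_wpM2r => //.
  have -> : (2 ^ j)%:R * beta ^+ (2 * j) = (2 * beta ^+ 2) ^+ j.
    by rewrite natrX exprM -exprMn.
  have bb : 0 <= 2 * beta ^+ 2 by rewrite mulr_ge0// sqr_ge0.
  have bb2 : 2 * beta ^+ 2 <= 2^-1.
    rewrite expr2; have bh := beta_half; have b00 := ltW beta0.
    have : beta * beta <= 2^-1 * 2^-1 by apply: ler_pM.
    lra.
  by apply: lerXn2r => //; rewrite nnegrE ?invr_ge0.
have sub : Q `&` [set y : VT | Bad k j y] `<=`
   (Q `&` E1) `|` (Q `&` [set y | exists p, (p < 4 ^ k.+1)%N /\ Ep p y]).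
  by move=> y [Qy [h|[p [pk h]]]]; [left|right; split => //; exists p].
have mU : measurable [set y : VT | exists p, (p < 4 ^ k.+1)%N /\ Ep p y].
  by apply: meas_exists => p; apply: meas_and; [exact: meas_const|exact: mEp].
apply: (le_trans (pr_leD nu _ _ _ sub)).
- by apply: measurableI => //; exact: measurable_Bad.
- exact: measurableI.
- exact: measurableI.
rewrite mulrDl; apply: lerD => //.
rewrite -mulrA; apply: pr_finite_le => //.
Qed.

End Positivity.

(** * The moment condition and the choice of the levels *)

Section Moment.
Context {R : realType}.
Variables (b : nat) (mu mubar : nat -> R) (nu : probability VT R).
Hypothesis HL : brw_law b mu mubar nu.
Let mu_ge0 := bl_mu_ge0 HL.
Variable a : R.
Hypothesis a2 : 2 < a.
Hypothesis moment : (\sum_(1 <= k <oo) ((k%:R * (ln k%:R) `^ a) * mu k)%:E < +oo)%E.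

Let a0 : 0 < a. Proof. by apply: lt_trans a2. Qed.

Let g (k : nat) : R := (k%:R * (ln k%:R) `^ a) * mu k.
Let g0 k : 0 <= g k.
Proof. by rewrite !mulr_ge0// powR_ge0. Qed.

(** The Markov inequality for the size-biased law: beyond [2 ^ j] the factor [ln k] is at least
    [j * ln 2]. *)
Lemma PK_tail_moment : exists2 A : R, 0 <= A & forall j p, (0 < j)%N ->
  pr nu [set y : VT | (2 ^ j < y (PK p))%N] <= A * (j%:R `^ a)^-1.
Proof.
set S := (\sum_(1 <= k <oo) (g k)%:E)%E.
have S0 : (0 <= S)%E by apply: nneseries_ge0 => k _ _; rewrite lee_fin.
have Sf : S = (fine S)%:E by rewrite fineK// ge0_fin_numE.
have l2 : 0 < ln 2 :> R by rewrite ln_gt0// ltr1n.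
exists (fine S * (ln 2 `^ a)^-1); first by rewrite mulr_ge0 ?fine_ge0// invr_ge0 powR_ge0.
move=> j p j0; apply: (le_trans (PK_tail HL p (2 ^ j))).
set x := (2 ^ j)%N.
have x2 : (2 <= x)%N by rewrite /x -{1}(expn1 2) leq_exp2l.
have lx : ln x%:R = j%:R * ln 2 :> R by rewrite natrX lnXn// mulr_natl.
have lx0 : 0 < ln x%:R :> R by rewrite ln_gt0// ltr1n.
have lxa0 : 0 < ln x%:R `^ a by rewrite powR_gt0.
suff : (\sum_(x.+1 <= k <oo) (k%:R * mu k)%:E <= ((ln x%:R `^ a)^-1)%:E * S)%E.
  have := bl_mu_mean HL; rewrite (@nneseries_split _ _ 0 x.+1); last first.
    by move=> k _; rewrite lee_fin mulr_ge0.
  rewrite add0n sumEFin Sf; set s := \sum_(0 <= k < x.+1) _; set T := (\sum_(x.+1 <= k <oo) _)%E => e h.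
  have Tf : T = (1 - s)%:E.
    by move: e; case: (T) => [u [<-]| |]//; rewrite addrAC subrr add0r.
  move: h; rewrite Tf -EFinM lee_fin => h; apply: (le_trans h).
  rewrite lx powRM ?ler0n ?(ltW l2)// invfM [_ * fine S]mulrC /=.
  by rewrite [_^-1 / _]mulrC mulrA.
apply: (@le_trans _ _ (\sum_(x.+1 <= k <oo) ((ln x%:R `^ a)^-1)%:E * (g k)%:E)%E).
  rewrite ereal_series [leRHS]ereal_series.
  apply: lee_nneseries => k; first by move=> _ _; rewrite lee_fin mulr_ge0.
  move=> kx; rewrite -EFinM lee_fin /g.
  rewrite mulrCA mulrC -!mulrA.
  have lk : ln x%:R `^ a <= ln k%:R `^ a.
    apply: ge0_ler_powR; rewrite ?nnegrE ?(ltW a0)//.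
    - exact: ltW.
    - by apply: ltW; rewrite ln_gt0// ltr1n; lia.
    - by rewrite ler_ln ?posrE ?ltr0n ?ler_nat; lia.
  rewrite [leRHS](_ : _ = (k%:R * mu k) * (ln k%:R `^ a / ln x%:R `^ a)); last by ring.
  by rewrite mulrC ler_peMr ?mulr_ge0// ler_pdivlMr// mul1r.
rewrite nneseriesZl; last by move=> k _; rewrite lee_fin.
rewrite lee_pmul2l ?fin_numE// ?lte_fin ?invr_gt0//.
rewrite /S (@nneseries_split _ (fun k => (g k)%:E) 1 x); last by move=> k _; rewrite lee_fin.
rewrite add1n leeDr//; apply: sume_ge0 => k _; by rewrite lee_fin.
Qed.

(** [t] is the midpoint of [2 / a] and 1, which are in this order because [a > 2]. From [t < 1]
    comes [theta < 2], and from [t > 2 / a] that [theta] to the power [a] exceeds 4. *)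
Let t : R := 2^-1 + a^-1.
Let theta : R := 2 `^ t.

Let theta_gt0 : 0 < theta. Proof. exact: powR_gt0. Qed.

Let theta_lt2 : theta < 2.
Proof.
have l2 : 0 < ln 2 :> R by rewrite ln_gt0// ltr1n.
rewrite -ltr_ln ?posrE// ln_powR gtr_pMl//.
have : a^-1 < 2^-1 by rewrite ltf_pV2 ?posrE.
rewrite /t; move: (a^-1) => x; lra.
Qed.

Let theta_a : 4 < theta `^ a.
Proof.
have l2 : 0 < ln 2 :> R by rewrite ln_gt0// ltr1n.
have -> : 4 = 2 ^+ 2 :> R by rewrite expr2; ring.
rewrite -ltr_ln ?posrE ?exprn_gt0// ?powR_gt0// /theta -powRrM ln_powR lnXn// -[ln 2 *+ 2]mulr_natl ltr_pM2r//.
rewrite /t mulrDl mulVf ?gt_eqF//.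
by rewrite -(ltrD2r (- 1)) [2^-1 * a + 1 - 1]addrK [2^-1 * _]mulrC ltr_pdivlMr// (_ : (2 - 1) * 2 = 2 :> R)//; ring.
Qed.

(** The summand [4 * k] makes [2^-1 ^+ lvl k] at most [16^-k], which beats the number [4 ^ k.+1] of
    ancestors. *)
Definition lvl (k : nat) : nat := ((Num.truncn (theta ^+ k)).+1 + 4 * k)%N.

Lemma Bad_summable (A : R) : 0 <= A -> exists C r : R, [/\ 0 <= C, 0 <= r, r < 1 & forall k,
  6 * (lvl k)%:R * 2^-1 ^+ k +
  (4 ^ k.+1)%:R * (A * ((lvl k)%:R `^ a)^-1 + 2^-1 ^+ lvl k) <= C * r ^+ k].
Proof.
move=> A0; pose r1 := 4 / theta `^ a; pose r2 := theta / 2.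
have ta0 : 0 < theta `^ a by apply: lt_trans theta_a.
have r10 : 0 <= r1 by rewrite divr_ge0// ltW.
have r11 : r1 < 1 by rewrite ltr_pdivrMr// mul1r.
have r20 : 0 <= r2 by rewrite divr_ge0// ltW.
have r21 : r2 < 1 by rewrite ltr_pdivrMr// mul1r.
(* [r1] comes from the number of children, [r2] from the delay of the ancestral line, and [3 / 4]
   absorbs the linear term of [lvl k] against [2^-1 ^+ k]. *)
pose r := Num.max (Num.max r1 r2) (3 / 4).
exists (6 + 48 + 4 * A + 4), r; split.
- by rewrite !addr_ge0// mulr_ge0.
- by rewrite le_max; apply/orP; right; rewrite divr_ge0.
- by rewrite !gt_max r11 r21 /=; lra.
move=> k.
have rk x : 0 <= x -> x <= r -> x ^+ k <= r ^+ k.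
  by move=> x0 xr; rewrite lerXn2r// nnegrE (le_trans x0).
have rk1 : r1 ^+ k <= r ^+ k by apply: rk => //; rewrite !le_max lexx.
have rk2 : r2 ^+ k <= r ^+ k by apply: rk => //; rewrite !le_max lexx orbT.
have rk3 : (3 / 4 : R) ^+ k <= r ^+ k by apply: rk; rewrite ?divr_ge0// !le_max lexx orbT.
have rk4 : 4^-1 ^+ k <= r ^+ k.
  apply: rk; rewrite ?invr_ge0// le_max; apply/orP; right; lra.
have th0 : 0 <= theta ^+ k by rewrite exprn_ge0// ltW.
have l1 : theta ^+ k <= (lvl k)%:R.
  apply: ltW; apply: (lt_le_trans (truncnS_gt _)); rewrite ler_nat; exact: leq_addr.
have l2 : (lvl k)%:R <= theta ^+ k + (4 * k%:R + 1).
  rewrite natrD -natr1 natrM; have := truncn_le (theta ^+ k); rewrite th0.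
  by move=> h; lra.
have half : 0 <= 2^-1 ^+ k :> R by rewrite exprn_ge0// invr_ge0.
have T1 : 6 * (lvl k)%:R * 2^-1 ^+ k <= (6 + 48) * r ^+ k.
  have e2 : theta ^+ k * 2^-1 ^+ k = r2 ^+ k by rewrite -exprMn.
  (* This rests on [(3 / 2) ^+ k >= 1 + k / 2]; the constant 48 is 6 times this 8. *)
  have e3 : (4 * k%:R + 1) * 2^-1 ^+ k <= 8 * (3 / 4) ^+ k :> R.
    rewrite (_ : (3 / 4) ^+ k = (3 / 2) ^+ k * 2^-1 ^+ k); last first.
      by rewrite -exprMn; congr (_ ^+ k); lra.
    rewrite mulrA; apply: ler_wpM2r => //.
    have : 1 + k%:R / 2 <= (3 / 2) ^+ k :> R.
      elim: k {rk rk1 rk2 rk3 rk4 th0 l1 l2 half e2} => [|k IH]; first by rewrite mul0r addr0 expr0.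
      by rewrite exprS -natr1; have : 0 <= k%:R :> R by []; move: IH; nra.
    by have : 0 <= k%:R :> R by []; lra.
  have : (lvl k)%:R * 2^-1 ^+ k <= (theta ^+ k + (4 * k%:R + 1)) * 2^-1 ^+ k by apply: ler_wpM2r.
  by rewrite mulrDl e2; lra.
have T2 : (4 ^ k.+1)%:R * (A * ((lvl k)%:R `^ a)^-1) <= 4 * A * r ^+ k.
  have h : ((lvl k)%:R `^ a)^-1 <= ((theta `^ a) ^+ k)^-1.
    have e : (theta `^ a) ^+ k = (theta ^+ k) `^ a.
      by rewrite -powR_mulrn ?powR_ge0// -powRrM mulrC powRrM powR_mulrn// ltW.
    rewrite e lef_pV2 ?posrE; last 2 first.
    - by rewrite powR_gt0// ltr0n.
    - by rewrite powR_gt0// exprn_gt0.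
    by apply: ge0_ler_powR; rewrite ?nnegrE ?(ltW a0)// ler0n.
  apply: (@le_trans _ _ (4 * A * r1 ^+ k)); last first.
    by apply: ler_wpM2l => //; rewrite mulr_ge0.
  rewrite /r1 expr_div_n expnS natrM natrX -!mulrA; apply: ler_wpM2l => //.
  rewrite mulrCA; apply: ler_wpM2l => //; apply: ler_wpM2l => //; exact: exprn_ge0.
have T3 : (4 ^ k.+1)%:R * 2^-1 ^+ lvl k <= 4 * r ^+ k.
  apply: (@le_trans _ _ (4 * 4^-1 ^+ k)); last by apply: ler_wpM2l.
  rewrite expnS natrM -mulrA; apply: ler_wpM2l => //.
  have : 2^-1 ^+ lvl k <= 2^-1 ^+ (4 * k) :> R.
    apply: ler_wiXn2l; rewrite ?invr_ge0 ?invf_le1// ?ler1n//; exact: leq_addl.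
  move=> h; apply: le_trans (ler_wpM2l _ h) _; first by rewrite ler0n.
  rewrite natrX exprM -exprMn; apply: lerXn2r; rewrite ?nnegrE ?mulr_ge0 ?exprn_ge0 ?invr_ge0//.
  by rewrite exprVn -natrX (_ : (2 ^ 4)%N = (4 * 4)%N)// natrM invfM mulrA divff ?mul1r ?pnatr_eq0.
rewrite mulrDr addrA (mulrDl (6 + 48 + 4 * A)) (mulrDl (6 + 48)).
by apply: lerD => //; exact: lerD.
Qed.

Theorem no_return_gt0 : 0 < pr nu no_return.
Proof.
have [A A0 hA] := PK_tail_moment.
have [C [r [C0 r0 r1 hCr]]] := Bad_summable A0.
(* The bounds on the bad events of scale at least [k0] add up to at most 1/2. *)
have [k0 hk0] : exists k0, C * r ^+ k0 / (1 - r) <= 2^-1.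
  have cv : (fun k => r ^+ k) @ \oo --> (0 : R) by apply: cvg_expr; rewrite ger0_norm.
  pose e := 2^-1 * (1 - r) / (C + 1).
  have e0 : 0 < e by rewrite !divr_gt0// ?mulr_gt0// ?subr_gt0// ?invr_gt0//; lra.
  move/cvgrPdist_lt: cv => /(_ e e0)[n _ /(_ n (leqnn n))] /=.
  rewrite sub0r normrN ger0_norm ?exprn_ge0// => hn; exists n.
  rewrite ler_pdivrMr ?subr_gt0//; apply: (@le_trans _ _ (C * e)).
    by apply: ler_wpM2l => //; exact: ltW.
  rewrite /e mulrCA -[leRHS]mulr1; apply: ler_wpM2l; first by rewrite mulr_ge0 ?invr_ge0// subr_ge0 ltW.
  by rewrite ler_pdivrMr; lra.
(* The ancestors [rho(1), ..., rho(4 ^ k0)] have a single child each, which leaves no room for a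
   return below the scale [k0]; this has positive probability because [mubar 1 > 0]. *)
pose A2 : set VT := [set y : VT | forall p, (p < 4 ^ k0)%N -> y (PK p) = 1%N].
have mA2 : measurable A2.
  by apply: meas_forall => p; apply: meas_imply; [exact: meas_const|exact: dmeas_coord].
have mU := measurable_Ugood.
have mroot := measurable_root_return.
(* Returns below the root are read off the digits and the subtree of the root only, so that
   excluding them leaves the bounds on [Bad] available. *)
pose Q0 := Ugood `&` ~` root_return.
have mQ0 : measurable Q0 by apply: measurableI => //; exact: measurableC.
pose Q := Q0 `&` A2.
have mQ : measurable Q by exact: measurableI.
have fQ0 l : ~~ isPU l -> (forall w, l != PN 0 w) -> (forall w, l != PX 0 w) -> insens l Q0.
  move=> lU lN lX; apply: insens_setI; first exact: insens_Ugood.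
  apply: insens_setC => y s; split; apply: root_return_local => [j|w|w];
    by rewrite upd_neq// 1?eq_sym//; apply: contraNneq lU => e; subst l.
have fA2 l : (forall p, (p < 4 ^ k0)%N -> l != PK p) -> insens l A2.
  by move=> hl y s; split => h p pk; have := h p pk; rewrite upd_neq// eq_sym hl.
have pQ : 0 < pr nu Q.
  have -> : Q = Q0 `&` cyl (map PK (iota 0 (4 ^ k0))) (fun=> 1%N).
    congr setI; apply/seteqP; split => y /= h.
      by move=> i /mapP[p]; rewrite mem_iota => /andP[_ pk] ->; exact: h.
    by move=> p pk; apply: h; rewrite map_f// mem_iota.
  rewrite (indep_cyl (marg_ge0 HL) (bl_law HL)) //; last 2 first.
  - by rewrite map_inj_uniq ?iota_uniq// => p q [].
  - by move=> i /mapP[p _ ->]; exact: fQ0.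
  apply: mulr_gt0.
    have := pr_split nu mU mroot; rewrite (pr_Ugood HL) -/Q0.
    have := pr_root_return HL; have b2 : b%:R^-1 <= 2^-1 :> R.
      by rewrite lef_pV2 ?posrE ?ltr0n ?(b_gt0 HL)// ler_nat (bl_b HL).
    by move: b2; move: (b%:R^-1) => x; lra.
  by rewrite big_map; apply: prodr_gt0 => p _; exact: (mubar1_gt0 HL).
have QB : pr nu (Q `&` [set y : VT | exists i, Bad (k0 + i) (lvl (k0 + i)) y]) <= 2^-1 * pr nu Q.
  have mBad := measurable_Bad.
  have mE : measurable [set y : VT | exists i, Bad (k0 + i) (lvl (k0 + i)) y].
    by apply: meas_exists => i; exact: mBad.
  have Q0' := pr_ge0 nu Q.
  apply: (@pr_countable_le _ _ _ nu _ (fun i => Q `&` [set y : VT | Bad (k0 + i) (lvl (k0 + i)) y])).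
  - exact: measurableI.
  - by move=> i; apply: measurableI => //; exact: mBad.
  - by move=> y [Qy [i h]]; exists i.
  move=> n; apply: (@le_trans _ _ (\sum_(0 <= i < n) C * r ^+ (k0 + i) * pr nu Q)).
    apply: ler_sum => i _.
    have h4 : (4 ^ k0 <= 4 ^ (k0 + i))%N by rewrite leq_exp2l// leq_addr.
    apply: le_trans (@Bad_bound _ _ _ _ _ HL (k0 + i) (lvl (k0 + i))
      (A * ((lvl (k0 + i))%:R `^ a)^-1) Q mQ _ _ _ _ _) _.
    - by move=> y [[]].
    - move=> p pk; apply: insens_setI; first exact: fQ0.
      by apply: fA2 => p' p'k; apply/eqP => -[] e; move: p'k; rewrite ltnNge -e (leq_trans h4 pk).
    - move=> q q0; apply: insens_setI; last exact: fA2.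
      by apply: fQ0 => // w; apply/eqP => -[] e; rewrite e in q0.
    - move=> p i' l hl; apply: insens_setI.
        apply: fQ0; first exact: Fut1_nonU hl.
          by move=> w; move: hl => [[[u ->]|[? [u ->]]]|->]; apply/eqP.
        by move=> w; move: hl => [[[u ->]|[? [u ->]]]|->]; apply/eqP.
      by apply: fA2 => p' _; move: hl => [[[u ->]|[? [u ->]]]|->]; apply/eqP.
    - by move=> p; exact: hA.
    by apply: ler_wpM2r.
  rewrite -mulr_suml; apply: ler_wpM2r => //; apply: le_trans hk0.
  under eq_bigr do rewrite exprD mulrA.
  rewrite -mulr_sumr; apply: ler_wpM2l; first by rewrite mulr_ge0// exprn_ge0.
  rewrite -[leRHS]div1r ler_pdivlMr ?subr_gt0//.
  have -> : (\sum_(0 <= i < n) r ^+ i) * (1 - r) = 1 - r ^+ n.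
    elim: n => [|n IH]; first by rewrite big_nil mul0r expr0 subrr.
    by rewrite big_nat_recr//= mulrDl IH exprS; ring.
  by rewrite lerBlDr lerDl exprn_ge0.
set E := [set y : VT | exists i, _] in QB.
have mE : measurable E by apply: meas_exists => i; exact: measurable_Bad.
have mreg := measurable_regular.
have sub : (Q `&` ~` E) `&` ~` (~` regular) `<=` no_return.
  rewrite setCK => y [[[[hU hr] hA2] nE] [[q hq] _]] n n0 e.
  case: n n0 e => // n _ e; have hv := visited_lex n hq.
  case: (visited_return hv e) => [h|[p [i [n' [ik hh]]]]]; first by apply: hr.
  have p0 : (4 ^ k0 <= p)%N.
    by rewrite leqNgt; apply/negP => pk; move: ik; rewrite hA2.
  (* [k] is the scale of the ancestor in whose grafted subtrees the return takes place. *)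
  have [k [kk pk]] : exists k, (k0 <= k)%N /\ (4 ^ k <= p < 4 ^ k.+1)%N.
    exists (trunc_log 4 p); have p1 : (0 < p)%N by apply: leq_trans p0; rewrite expn_gt0.
    by split; [exact: trunc_log_max|exact: trunc_log_bounds].
  apply: nE; exists (k - k0)%N; rewrite subnKC//; set j := lvl k.
  case: (boolP (nohit true spine 0 (4 ^ k) (2 * j) y)) => hn; first by left.
  right; exists p; case/andP: pk => pk1 pk2; split => //; split => //.
  case: (ltnP (2 ^ j) (y (PK p))) => hK; first by left.
  right; exists i; split; first by apply: leq_trans hK; exact: ltnW.
  split; last by exists n'.
  by apply: contraNN hn; apply: nohit_mono; apply: leq_trans pk1 _.
have mQE : measurable (Q `&` ~` E) by apply: measurableI => //; exact: measurableC.
have h1 := pr_positive_nonnull mQE (measurableC mreg) (regular_null HL).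
have := pr_mono nu (measurableI _ _ mQE (measurableC (measurableC mreg))) measurable_no_return sub.
have := pr_split nu mQ mE; lra.
Qed.

End Moment.

(** * Transfer to the given probability space *)

Section JointLaw.
Context {R : realType} {d : measure_display} {Omega : measurableType d}.
Variables (P : probability Omega R) (Y : prim -> Omega -> nat).
Hypothesis Y_meas : forall i v, measurable [set om | Y i om = v].

Definition joint (om : Omega) : VT := fun i => Y i om.

Lemma measurable_joint : measurable_fun setT joint.
Proof. by apply: measurable_coord_map => i k; exact: Y_meas. Qed.

HB.instance Definition _ := isMeasurableFun.Build _ _ _ _ joint measurable_joint.

Definition joint_law : probability VT R := distribution P joint.

Lemma joint_law_cyl (m : prim -> nat -> R) : mutually_independent P Y ->
  (forall i k, P [set om | Y i om = k] = (m i k)%:E) ->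
  forall (l : seq prim) (v : V), uniq l ->
    joint_law (cyl l v) = (\prod_(i <- l) m i (v i))%:E.
Proof.
move=> ind hm l v ul.
have := ind (size l) (tnth (in_tuple l)) (fun k => v (tnth (in_tuple l) k)).
move=> /(_ (tuple_uniqP (in_tuple l) ul)) h.
rewrite (_ : \prod_(i <- l) _ = \prod_(k < size l) m (tnth (in_tuple l) k) (v (tnth (in_tuple l) k))).
  transitivity (P [set om | forall k, Y (tnth (in_tuple l) k) om = v (tnth (in_tuple l) k)]).
    change (joint_law (cyl l v)) with (P [set om | cyl l v (joint om)]).
    congr (P _); apply/seteqP; split => om /= hom.
      by move=> k; apply: hom; exact: mem_tnth.
    by move=> i /(tnthP (in_tuple l))[k ->]; exact: hom.
  by rewrite h; congr EFin; apply: eq_bigr => k _; rewrite hm.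
by rewrite -[in LHS](in_tupleE l) big_tuple.
Qed.

End JointLaw.

Theorem theorem3p20 (R : realType) (d : measure_display) (Omega : measurableType d)
  (P : probability Omega R) (b : nat) (mu : nat -> R) (Y : prim -> Omega -> nat)
  (hb : (2 <= b)%N)
  (mu_ge0 : forall k, 0 <= mu k)
  (mu_prob : (\sum_(k <oo) (mu k)%:E = 1)%E)
  (mu_mean : (\sum_(k <oo) (k%:R * mu k)%:E = 1)%E)
  (Y_meas : forall i v, measurable [set om | Y i om = v])
  (Y_indep : mutually_independent P Y)
  (Y_N : forall p w k, P [set om | Y (PN p w) om = k] = (mu k)%:E)
  (Y_K : forall p k, P [set om | Y (PK p) om = k] =
           if k == 0%N then 0%E else (\sum_(k <= l <oo) (mu l)%:E)%E)
  (Y_U : forall j i, P [set om | Y (PU j) om = i] =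
           if (1 <= i <= b)%N then (b%:R^-1)%:E else 0%E)
  (Y_X : forall p w s, P [set om | Y (PX p w) om = s] =
           if s == 0%N then (2^-1)%:E
           else if (s <= b)%N then ((2 * b%:R)^-1)%:E else 0%E) :
  let Th := fun om => brw Y om in
  let c := fine (P [set om | forall n, (1 <= n)%N ->
                             lex_label (Th om) n <> Some (origin Y om)]) in
  [/\ same_law P Th (fun om => scc (Th om)),
      {ae P, forall om,
         (fun n => (ndistinct (lex_label (Th om)) n)%:R / n%:R) @ \oo --> c}
    & (exists beta : R, 1 < beta /\
         (\sum_(1 <= k <oo) ((k%:R * (ln k%:R) `^ (1 + beta)) * mu k)%:E
            < +oo)%E) -> 0 < c].
Proof.
move=> Th c.
pose mubar k := fine (\sum_(k <= l <oo) (mu l)%:E)%E.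
have mubarE k : (mubar k)%:E = (\sum_(k <= l <oo) (mu l)%:E)%E.
  rewrite fineK// ge0_fin_numE; last by apply: nneseries_ge0 => l _ _; rewrite lee_fin.
  apply: (@le_lt_trans _ _ 1%E); last exact: ltry.
  rewrite -mu_prob (@nneseries_split _ _ 0 k) ?add0n ?leeDr//.
    by apply: sume_ge0 => l _; rewrite lee_fin.
  by move=> l _; rewrite lee_fin.
pose nu := joint_law P Y_meas.
have HL : brw_law b mu mubar nu.
  split => //; apply: joint_law_cyl => // -[p w|p|j|p w] k /=.
  - exact: Y_N.
  - by rewrite Y_K -mubarE; case: (k == 0%N).
  - by rewrite Y_U; case: (1 <= k <= b)%N.
  - by rewrite Y_X; case: (k == 0%N) => //; case: (k <= b)%N.
split.
- move=> A hA.
  have := scc_invariant HL hA.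
  have mB : measurable [set y : VT | A (B y)].
    by apply: measurable_Theta hA => j p w; exact: dmeas_obs_B.
  have mS : measurable [set y : VT | A (scc (B y))].
    by apply: measurable_Theta hA => j p w; exact: dmeas_obs_scc.
  move=> e.
  change (nu [set y | A (B y)] = nu [set y | A (scc (B y))]).
  by rewrite (prE nu mB) (prE nu mS) e.
- have [N [mN N0 hN]] := range_cvg HL.
  exists (joint Y @^-1` N); split.
  + exact: measurable_precomp (measurable_joint Y_meas) mN.
  + change (nu N = 0%E); by rewrite (prE nu mN) N0.
  + by move=> om /= h; apply: contrapT => nN; apply: h; exact: (hN (joint Y om)).
- move=> [beta [beta1 hbeta]].
  have a2 : 2 < 1 + beta by rewrite -(ltrD2l 1) in beta1.
  exact: (no_return_gt0 HL a2 hbeta).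
Qed.
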